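(* Let $(\Phi_H,H)$ be a topological strictly contact dynamical system on $(M,\alpha)$. Then there exists a continuous strictly contact dynamical system $(\Phi_F,F)$ with the same time-one map $\phi_F^1=\phi_H^1$. Given $\epsilon>0$, the continuous strictly contact dynamical system $(\Phi_F,F)$ can be chosen so that either (whichever of the two is desired) $$\overline d(\Phi_F,\Phi_H)<\epsilon\quad\text{and}\quad\|F-H\|_{(1,\infty)}<\epsilon,$$ or $$\overline d(\Phi_F,\mathrm{id})<\overline d(\Phi_H,\mathrm{id})+\epsilon\quad\text{and}\quad\|F\|_\infty<\|H\|_{(1,\infty)}+\epsilon .$$ In fact, $(\Phi_F,F)$ is smooth everywhere except possibly at time $t=1$.
   Context: Setting. $M$ is a closed (compact, without boundary), connected smooth manifold of dimension $2n+1$ with a cooriented contact structure $\xi=\ker\alpha$, where $\alpha$ is a fixed contact form with Reeb vector field $R$, and $\nu_\alpha=\alpha\wedge(d\alpha)^n$. A smooth strictly contact isotopy is a smooth isotopy $\Phi=\{\phi_t\}_{0\le t\le1}$ with $\phi_0=\mathrm{id}$ and $\phi_t^*\alpha=\alpha$ for all $t$; if $\frac{d}{dt}\phi_t=X_t\circ\phi_t$, its Hamiltonian is $H_t=\alpha(X_t)$, and one writes $\Phi=\Phi_H=\{\phi_H^t\}$. The Hamiltonians so obtained are exactly the smooth basic functions $H\colon[0,1]\times M\to\mathbb R$, i.e. those with $dH_t(R)=0$ for all $t$. Then $(\Phi_H,H)$ is called a smooth strictly contact dynamical system. Norms. For a function $H$ on $M$, $\|H\|=\max_M H-\min_M H+\left|\frac{1}{\int_M\nu_\alpha}\int_M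 H\,\nu_\alpha\right|$. For $H\colon[0,1]\times M\to\mathbb R$, $\|H\|_{(1,\infty)}=\int_0^1\|H_t\|\,dt$ and $\|H\|_\infty=\max_{0\le t\le1}\|H_t\|$. $C^0$-metric. Fix a Riemannian metric on $M$ with distance $d$. For homeomorphisms, $d(\phi,\psi)=\max_x d(\phi(x),\psi(x))$ and $\overline d(\phi,\psi)=d(\phi,\psi)+d(\phi^{-1},\psi^{-1})$; for isotopies, $\overline d(\Phi,\Psi)=\max_t\overline d(\phi_t,\psi_t)$. $\mathrm{id}$ also denotes the constant isotopy at the identity. Topological and continuous systems. A pair $(\Phi,H)$ of a continuous isotopy of homeomorphisms $\Phi$ and a function $H\colon[0,1]\times M\to\mathbb R$ is a topological strictly contact dynamical system if there are smooth strictly contact dynamical systems $(\Phi_{H_i},H_i)$ with $\Phi_{H_i}\to\Phi$ uniformly and $\|H-H_i\|_{(1,\infty)}\to0$ ($H$ being an element of $L^1([0,1],C^0(M))$). It is a continuous strictly contact dynamical system if there is such a sequence with $\|H-H_i\|_\infty\to0$ instead. By a known uniqueness theorem $\Phi$ is determined by $H$, and one writes $\Phi=\Phi_H=\{\phi_H^t\}$. ''$(\Phi_F,F)$ is smooth except possibly at $t=1$'' means that the maps $(t,x)\mapsto\phi_F^t(x)$, $(t,x)\mapsto(\phi_F^t)^{-1}(x)$ and $(t,x)\mapsto F_t(x)$ are smooth except possibly at $t=1$. *)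

(* Defs.v *)
From HB Require Import structures.
From mathcomp Require Import all_boot all_order all_algebra all_fingroup.
From mathcomp Require Import all_classical all_reals all_analysis.

Set Implicit Arguments.
Unset Strict Implicit.
Unset Printing Implicit Defensive.

Import Order.TTheory GRing.Theory Num.Theory.
Import numFieldNormedType.Exports.

Local Open Scope classical_set_scope.
Local Open Scope ring_scope.

(** * Smooth maps between normed spaces
    The domains used below are finite dimensional, where [Ck k] is the usual
    class C^k: all iterated partial derivatives of order at most [k] exist and
    are continuous. *)

Section Smooth.
Context {R : realType} {V W : normedModType R}.

Fixpoint Ck (k : nat) (U : set V) (f : V -> W) : Prop :=
  (forall x, U x -> {for x, continuous f}) /\
  match k with
  | 0 => True
  | k'.+1 => forall v : V, (forall x, U x -> derivable f x v) /\
                           Ck k' U (fun x => 'D_v f x)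
  end.

Definition smooth_on (U : set V) (f : V -> W) := forall k, Ck k U f.

(** Smoothness on a set that need not be open (such as [0,1] x U, or
    [0,1[ x U): [f] extends smoothly to a neighborhood of each point. *)
Definition smooth_within (A : set V) (f : V -> W) :=
  forall p, A p -> exists (U : set V) (g : V -> W),
    [/\ open U, U p, smooth_on U g & forall q, U q -> A q -> f q = g q].

End Smooth.

(** * Closed manifolds; the dimension is [d.+1] *)

Record chart (R : realType) (d : nat) (M : topologicalType) := Chart {
  dom : set M;
  coord :> M -> 'rV[R]_d.+1;
  cinv : 'rV[R]_d.+1 -> M;
  dom_open : open dom;
  img_open : open (coord @` dom);
  coordK : forall x, dom x -> cinv (coord x) = x;
  coord_continuous : {within dom, continuous coord};
  cinv_continuous : {within coord @` dom, continuous cinv} }.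

HB.instance Definition _ R d M := gen_eqMixin (@chart R d M).
HB.instance Definition _ R d M := gen_choiceMixin (@chart R d M).

Section Manifold.
Context {R : realType} {d : nat} {M : topologicalType}.

Local Notation E := 'rV[R]_d.+1.
Local Notation chart := (chart R d M).

Implicit Types (A : set chart) (c : chart).

Definition img c : set E := coord c @` dom c.

Definition at_chart A c (x : M) := A c /\ dom c x.

Definition transition c c' (y : E) : E := c' (cinv c y).

Definition smooth_atlas A :=
  (forall x, exists c, at_chart A c x) /\
  (forall c c', A c -> A c' ->
     smooth_on (c @` (dom c `&` dom c')) (transition c c')).

(** Second countability follows from compactness and the existence of charts. *)
Definition closed_connected_manifold A :=
  [/\ smooth_atlas A, compact [set: M], hausdorff_space M,
      connected [set: M] & [set: M] !=set0].

Definition smooth_function A (f : M -> R) :=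
  forall c, A c -> smooth_on (img c) (f \o cinv c).

(** ** Contact forms
    A differential form is given by its coefficients in each chart of the
    atlas; the values at charts outside the atlas are irrelevant. *)

Definition pairing (a v : E) : R := (a *m v^T) 0 0.

Definition one_form A (alpha : chart -> E -> E) :=
  (forall c, A c -> smooth_on (img c) (alpha c)) /\
  (forall c c' x, at_chart A c x -> at_chart A c' x -> forall v : E,
     pairing (alpha c' (c' x)) ('D_v (transition c c') (c x)) =
     pairing (alpha c (c x)) v).

Definition partial (i : 'I_d.+1) (f : E -> R) (y : E) : R :=
  'D_(delta_mx 0 i) f y.

(** d(alpha)(e_i, e_j) in the chart [c] *)
Definition dform (alpha : chart -> E -> E) c (y : E) (i j : 'I_d.+1) : R :=
  partial i (fun z => alpha c z 0 j) y - partial j (fun z => alpha c z 0 i) y.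

(** ** Riemannian metrics and their distance *)

Definition riemannian_metric A (g : chart -> E -> 'M[R]_d.+1) :=
  [/\ forall c, A c -> smooth_on (img c) (g c),
      forall c y, A c -> img c y -> (g c y)^T = g c y,
      forall c y (v : E), A c -> img c y -> v != 0 -> 0 < (v *m g c y *m v^T) 0 0 &
      forall c c' x, at_chart A c x -> at_chart A c' x -> forall v w : E,
        ('D_v (transition c c') (c x) *m g c' (c' x)
           *m ('D_w (transition c c') (c x))^T) 0 0 =
        (v *m g c (c x) *m w^T) 0 0].

Definition smooth_curve A (gamma : R -> M) :=
  {within `[0, 1], continuous gamma} /\
  forall c, A c ->
    smooth_within (`[0, 1] `&` gamma @^-1` dom c) (coord c \o gamma).

Definition curve_length A (g : chart -> E -> 'M[R]_d.+1) (gamma : R -> M)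
    (l : R) :=
  exists speed : R -> R,
    (forall (t : R) c, 0 < t < 1 -> at_chart A c (gamma t) ->
       let v := 'D_1 (coord c \o gamma) t in
       speed t = Num.sqrt ((v *m g c (c (gamma t)) *m v^T) 0 0)) /\
    l = \int[lebesgue_measure]_(t in `]0, 1[) speed t.

(** [piecewise_length A g x y l]: there is a piecewise smooth curve of
    length [l] from [x] to [y]. *)
Inductive piecewise_length A g : M -> M -> R -> Prop :=
| piecewise_nil x : piecewise_length A g x x 0
| piecewise_cons gamma y l l' :
    smooth_curve A gamma -> curve_length A g gamma l ->
    piecewise_length A g (gamma 1) y l' ->
    piecewise_length A g (gamma 0) y (l + l').

Definition rdist A g (x y : M) : R := inf [set l | piecewise_length A g x y l].

(** ** Isotopies *)

Record isotopy := Isotopy { fwd :> R -> M -> M; bwd : R -> M -> M }.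

Definition id_isotopy := Isotopy (fun _ => id) (fun _ => id).

(** Only the times in [0,1] matter, here and below. *)
Definition inverse_pair (Phi : isotopy) :=
  forall t : R, 0 <= t <= 1 ->
    cancel (Phi t) (bwd Phi t) /\ cancel (bwd Phi t) (Phi t).

Definition continuous_family {T : topologicalType} (I : set R)
    (f : R -> M -> T) :=
  {within I `*` [set: M], continuous (fun p : R * M => f p.1 p.2)}.

Definition continuous_isotopy (Phi : isotopy) :=
  [/\ inverse_pair Phi, continuous_family `[0, 1] Phi
    & continuous_family `[0, 1] (bwd Phi)].

(** C^0-distances, for a distance [dist] on [M] *)
Definition dist_map (dist : M -> M -> R) (f h : M -> M) : R :=
  sup (range (fun x => dist (f x) (h x))).

Definition dbar (dist : M -> M -> R) (Phi Psi : isotopy) : R :=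
  sup [set dist_map dist (Phi t) (Psi t) + dist_map dist (bwd Phi t) (bwd Psi t)
      | t in `[0, 1]].

(** Smoothness on I x M *)
Definition smooth_family_fun A (I : set R) (h : R -> M -> R) :=
  forall c, A c ->
    smooth_within (I `*` img c) (fun p : R * E => h p.1 (cinv c p.2)).

Definition smooth_family_map A (I : set R) (f : R -> M -> M) :=
  continuous_family I f /\
  forall c c', A c -> A c' ->
    smooth_within
      [set p : R * E | [/\ I p.1, img c p.2 & dom c' (f p.1 (cinv c p.2))]]
      (fun p : R * E => c' (f p.1 (cinv c p.2))).

Definition smooth_isotopy A (Phi : isotopy) :=
  [/\ inverse_pair Phi, Phi 0 = id, smooth_family_map A `[0, 1] Phi
    & smooth_family_map A `[0, 1] (bwd Phi)].

Definition strictly_contact A (alpha : chart -> E -> E) (f : M -> M) :=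
  forall x c c', at_chart A c x -> at_chart A c' (f x) -> forall v : E,
    pairing (alpha c' (c' (f x))) ('D_v (c' \o f \o cinv c) (c x)) =
    pairing (alpha c (c x)) v.

(** One-sided derivative when [t] is 0 or 1 *)
Definition velocity (u : R -> E) (t : R) (w : E) :=
  (s - t)^-1 *: (u s - u t) @[s --> within `[0, 1] t^'] --> w.

(** [X t c z] is the component vector in the chart [c] of X_t(z). *)
Definition generates A (X : R -> chart -> M -> E) (Phi : isotopy) :=
  forall (t : R) x c, 0 <= t <= 1 -> at_chart A c (Phi t x) ->
    velocity (fun s => c (Phi s x)) t (X t c (Phi t x)).

Definition hamiltonian_of A (alpha : chart -> E -> E) (X : R -> chart -> M -> E)
    (H : R -> M -> R) :=
  forall (t : R) z c, 0 <= t <= 1 -> at_chart A c z ->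
    H t z = pairing (alpha c (c z)) (X t c z).

Definition smooth_system A alpha (Phi : isotopy) (H : R -> M -> R) :=
  [/\ smooth_isotopy A Phi,
      forall t : R, 0 <= t <= 1 -> strictly_contact A alpha (Phi t) &
      exists X, generates A X Phi /\ hamiltonian_of A alpha X H].

Definition smooth_except_at_1 A (Phi : isotopy) (H : R -> M -> R) :=
  [/\ smooth_family_map A `[0, 1[ Phi, smooth_family_map A `[0, 1[ (bwd Phi)
    & smooth_family_fun A `[0, 1[ H].

End Manifold.

Arguments isotopy : clear implicits.
Arguments id_isotopy {R M}.

(** * The contact volume form, in dimension 2n+1 *)

Section Integration.
Context {R : realType}.

Fixpoint iterated_integral (d : nat) : ('rV[R]_d -> R) -> R :=
  match d with
  | 0 => fun f => f 0
  | d'.+1 => fun f => \int[lebesgue_measure]_(t in [set: R])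
      iterated_integral
        (fun v : 'rV[R]_d' => f (row_mx (const_mx t : 'rV[R]_1) v))
  end.

Context {n : nat} {M : topologicalType}.

Local Notation E := 'rV[R]_((n.*2).+1).
Local Notation chart := (chart R n.*2 M).

(** The coefficient (alpha /\ (d alpha)^n)(e_0, ..., e_2n) in the chart [c],
    with the normalization (beta /\ gamma)(v_1, .., v_(p+q)) =
    1/(p! q!) * sum_s sgn(s) beta(v_s(1), ..) gamma(v_s(p+1), ..)
    of the exterior product. *)
Definition volume_coef (alpha : chart -> E -> E) (c : chart) (y : E) : R :=
  2 ^- n * \sum_(s : 'S_((n.*2).+1)) (-1) ^+ s * alpha c y 0 (s ord0) *
    \prod_(k < n) dform alpha c y (s (inord k.*2.+1)) (s (inord k.*2.+2)).

Definition contact_form (A : set chart) (alpha : chart -> E -> E) :=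
  one_form A alpha /\
  forall c y, A c -> img c y -> volume_coef alpha c y != 0.

Definition partition_of_unity (A : set chart) (s : seq (chart * (M -> R))) :=
  (forall p, p \in s ->
     [/\ A p.1, smooth_function A p.2, forall x, 0 <= p.2 x
       & closure [set x | p.2 x != 0] `<=` dom p.1]) /\
  (forall x, \sum_(p <- s) p.2 x = 1).

(** A partition of unity exists as [M] is compact, and the integral below does
    not depend on it by the change of variables formula. *)
Definition chosen_partition (A : set chart) : seq (chart * (M -> R)) :=
  xget [::] [set s | partition_of_unity A s].

(** The integral of [f] against nu_alpha, [M] being oriented by nu_alpha: the
    absolute value accounts for charts that reverse the orientation. *)
Definition nu_integral (A : set chart) (alpha : chart -> E -> E) (f : M -> R) :
    R :=
  \sum_(p <- chosen_partition A)
    iterated_integral (fun y : E =>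
      if y \in img p.1
      then p.2 (cinv p.1 y) * f (cinv p.1 y) * `|volume_coef alpha p.1 y|
      else 0).

(** ** Norms *)

Definition mean (A : set chart) alpha (f : M -> R) : R :=
  (nu_integral A alpha (fun=> 1))^-1 * nu_integral A alpha f.

(** Only used for continuous [f], so that [sup] and [inf] are attained. *)
Definition hnorm (A : set chart) alpha (f : M -> R) : R :=
  sup (range f) - inf (range f) + `|mean A alpha f|.

Definition norm1oo (A : set chart) alpha (H : R -> M -> R) : \bar R :=
  (\int[lebesgue_measure]_(t in `[0%R, 1%R]) (hnorm A alpha (H t))%:E)%E.

Definition normoo (A : set chart) alpha (H : R -> M -> R) : \bar R :=
  ereal_sup [set (hnorm A alpha (H t))%:E | t in `[0, 1]].

(** [H] represents an element of L^1([0,1], C^0(M)) in the sense of Bochner.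
    Every class has a representative that is a pointwise limit of simple
    functions at all times, not only at almost every time. *)
Definition strongly_measurable (H : R -> M -> R) :=
  exists S : nat -> seq (set R * (M -> R)),
    (forall k (p : set R * (M -> R)), p \in S k ->
       measurable (p.1 : set (measurableTypeR R)) /\ continuous p.2) /\
    forall t : R, 0 <= t <= 1 -> forall e : R, 0 < e ->
      \forall k \near \oo, forall x,
        `|H t x - \sum_(p <- S k) \1_(p.1) t * p.2 x| < e.

Definition L1C0 (A : set chart) alpha (H : R -> M -> R) :=
  [/\ forall t : R, 0 <= t <= 1 -> continuous (H t), strongly_measurable H
    & (norm1oo A alpha H < +oo)%E].

Definition hsub (H K : R -> M -> R) : R -> M -> R := fun t x => H t x - K t x.

(** * Topological and continuous systems *)

Definition topological_system (A : set chart) alpha g (Phi : isotopy R M)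
    (H : R -> M -> R) :=
  [/\ continuous_isotopy Phi, L1C0 A alpha H &
      exists (Phi_ : nat -> isotopy R M) (H_ : nat -> R -> M -> R),
        [/\ forall i, smooth_system A alpha (Phi_ i) (H_ i),
            dbar (rdist A g) (Phi_ i) Phi @[i --> \oo] --> (0 : R) &
            norm1oo A alpha (hsub H (H_ i)) @[i --> \oo] --> (0 : \bar R)]].

Definition continuous_system (A : set chart) alpha g (Phi : isotopy R M)
    (H : R -> M -> R) :=
  [/\ continuous_isotopy Phi, forall t : R, 0 <= t <= 1 -> continuous (H t) &
      exists (Phi_ : nat -> isotopy R M) (H_ : nat -> R -> M -> R),
        [/\ forall i, smooth_system A alpha (Phi_ i) (H_ i),
            dbar (rdist A g) (Phi_ i) Phi @[i --> \oo] --> (0 : R) &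
            normoo A alpha (hsub H (H_ i)) @[i --> \oo] --> (0 : \bar R)]].

End Integration.

(* Main.v *)
(** The smooth systems (Phi_N, H_N) approximating (Phi_H, H) are traversed one
    after the other: with Phi_0 = id and times 0 = t_0 < t_1 < ... -> 1, follow
    phi_N^1 o (phi_N^s)^-1 o phi_(N+1)^s during [t_N, t_(N+1)], where s = z_N(t)
    is a smooth step from 0 to 1. This path leads from phi_N^1 to phi_(N+1)^1
    and stays close to phi_H^1 when N is large, so the whole isotopy ends at
    phi_H^1. Its Hamiltonian has norm at most 2 z_N'(t) |H_(N+1) - H_N| at time
    z_N(t). The integral of |H_(N+1) - H_N| can be made small compared with
    t_(N+1) - t_N; letting z_N slow down where this norm is large turns this
    into a uniform bound that tends to 0, whence continuity at t = 1.

    On [0, t_1] the isotopy is phi_1^(z_0(t)). For the first estimate z_0' is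
    nearly at most 1 and t_1 nearly 1, so that z_0 is close to the identity; for
    the second one, z_0 makes the norm of the Hamiltonian nearly constant. *)

From HB Require Import structures.
Require Import Defs.
From mathcomp Require Import all_boot all_order all_algebra.
From mathcomp Require Import all_classical all_reals all_analysis.
From mathcomp Require Import ring lra.

Set Implicit Arguments.
Unset Strict Implicit.
Unset Printing Implicit Defensive.

Import Order.TTheory GRing.Theory Num.Theory.
Import numFieldNormedType.Exports.

Local Open Scope classical_set_scope.
Local Open Scope ring_scope.

(** Strictly contact maps preserve alpha, so a product has Hamiltonian H + K o phi_H^-1, and the
    correction path has H_(N+1) - H_N composed with a map: this is how an L^1 Cauchy sequence
    becomes usable. The factor 2 is the price of composing, as the mean of f o phi is bounded but
    not computed. It is harmless for small differences but would spoil the second estimate on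
    [0, t_1]; there the start at the identity makes the composition disappear.

    Two smallness demands compete. With t_1 = 1 - delta, the Hamiltonian after t_1 has size k /
    delta, where k bounds L^1 distances. The second estimate takes delta from the norm of H alone,
    then k small compared with delta. The first one needs delta small in terms of the first
    approximation itself, which is chosen after k; but there only an integral counts, and the tail
    contributes (k / delta) delta = k for every delta. So k is fixed first, then the approximation,
    then delta.

    The norm of a Hamiltonian is merely continuous in time and may vanish, so its integral has no
    smooth inverse to serve as a time change; smooth steps over short pieces are added up
    instead. *)

(** * Directional derivatives and the classes C^k in finite dimension *)

Section FiniteDimension.
Context {R : realType}.

Definition coordinates (V : normedModType R) (m : nat) (e : 'I_m -> V)
    (l : 'I_m -> {linear V -> R^o}) :=
  (forall i, continuous (l i)) /\ forall x, x = \sum_i l i x *: e i.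

(** Functions on [R], on row vectors and on products [R * E] all occur; this notion covers the three
    and is what the passage from partial derivatives to differentiability uses. *)
Definition fin_dim (V : normedModType R) :=
  exists m (e : 'I_m -> V) (l : 'I_m -> {linear V -> R^o}), coordinates e l.

Lemma is_derive_line (V W : normedModType R) (f : V -> W) (x v : V) (t : R) :
  derivable f (t *: v + x) v ->
  is_derive t (1 : R) (fun s : R => f (s *: v + x)) ('D_v f (t *: v + x)).
Proof.
move=> df; have df' := df; rewrite /derivable in df'.
have E : (fun h : R => h^-1 *: (f ((h *: 1 + t) *: v + x) - f (t *: v + x))) =
   (fun h : R => h^-1 *: (f (h *: v + (t *: v + x)) - f (t *: v + x))).
  by apply/funext => h; rewrite [h *: 1]mulr1 scalerDl addrA.
by apply: DeriveDef; rewrite /derivable /derive /= E.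
Qed.

(** The difference quotient cannot be rescaled when [s = 0]; instead the function [f] on the line
    through [x] is composed with multiplication by [s]. *)
Lemma is_derive_scale (V W : normedModType R) (f : V -> W) (x v : V) (s : R) :
  derivable f x v -> is_derive x (s *: v) f (s *: 'D_v f x).
Proof.
move=> df.
have df0 : derivable f (0 *: v + x) v by rewrite scale0r add0r.
have /is_derive_line[dG eG] := df0.
have dG0 : differentiable (fun h : R => f (h *: v + x)) (s *: (0 : R^o)).
  by rewrite scaler0; exact/derivable1_diffP.
have E : (fun h : R => f (h *: (s *: v) + x)) =
    (fun h : R => f (h *: v + x)) \o ( *:%R s : R^o -> R^o).
  by apply/funext => h /=; rewrite scalerA mulrC.
have dF : differentiable (fun h : R => f (h *: (s *: v) + x)) (0 : R).
  rewrite E; apply: differentiable_comp => //.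
have d1 : derivable f x (s *: v) by apply/derivable1P/derivable1_diffP.
apply: DeriveDef => //.
have d1' : derivable f (0 *: (s *: v) + x) (s *: v) by rewrite scale0r add0r.
have [_] := is_derive_line d1'; rewrite scale0r add0r => <-.
rewrite deriveE // E diff_comp //.
have -> : ('d ( *:%R s : R^o -> R^o) (0 : R) : R -> R) = *:%R s by exact: diff_val.
rewrite /= linearZ /= -deriveE ?scaler0 ?eG ?scale0r ?add0r //; exact/derivable1_diffP.
Qed.

End FiniteDimension.

Section PartialDerivatives.
Context {R : realType}.

(** Parametrizing the segment by [0,1] treats both signs of [s], and [s = 0], at once. *)
Lemma mvt_direction (V : normedModType R) (f : V -> R) (y v : V) (s : R) :
  (forall t : R, 0 <= t <= 1 -> derivable f (y + (t * s) *: v) v) ->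
  exists2 t : R, 0 <= t <= 1 & f (y + s *: v) - f y = s * 'D_v f (y + (t * s) *: v).
Proof.
move=> df.
have d (t : R) : 0 <= t <= 1 -> is_derive t (1 : R) (fun u : R => f (u *: (s *: v) + y))
    (s * 'D_v f (y + (t * s) *: v)).
  move=> t01; have /(@is_derive_scale R _ _ _ _ _ s)[d1 d2] := df _ t01.
  have E : y + (t * s) *: v = t *: (s *: v) + y by rewrite scalerA addrC.
  rewrite E in d1 d2 *; have [? ?] := is_derive_line d1.
  by apply: DeriveDef => //; rewrite -[s * _]d2.
have [|||t t01] := @MVT R (fun u => f (u *: (s *: v) + y))
    (fun t : R => s * 'D_v f (y + (t * s) *: v)) 0 1.
- exact: ltr01.
- by move=> t; rewrite in_itv /= => /andP[t0 t1]; apply: d; rewrite !ltW.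
- apply: derivable_within_continuous => t; rewrite in_itv /= => /d[]//.
- rewrite scale1r scale0r add0r subr0 mulr1 (addrC (s *: v)) => e.
  exists t => //; move: t01; rewrite in_itv /= => /andP[t0 t1].
  by rewrite !ltW.
Qed.

Section Differentiable.
Context (V : normedModType R) (m : nat) (e : 'I_m -> V)
  (l : 'I_m -> {linear V -> R^o}).
Hypothesis el : coordinates e l.

Lemma coordinate_bound : exists2 C : R, 0 < C &
  forall i h, `|l i h| <= C * `|h|.
Proof.
have H i : exists2 C : R, 0 < C & forall h, `|l i h| <= C * `|h|.
  have /linear_lipschitz[C C0 H] := el.1 i.
  by exists C.
pose C i := projT1 (cid2 (H i)).
have C0 i : 0 < C i by rewrite /C; case: (cid2 _).
exists (1 + \sum_i C i) => [|i h].
  by rewrite ltr_pwDl // sumr_ge0 // => i _; exact/ltW/C0.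
apply: (@le_trans _ _ (C i * `|h|)).
  by rewrite /C; case: (cid2 _) => /= c c0; apply.
rewrite ler_wpM2r // (bigD1 i) //= addrCA lerDl addr_ge0 // sumr_ge0 // => j _.
exact/ltW/C0.
Qed.

(** The move from [x] to [x + h] is made one coordinate at a time. The mean value theorem turns each
    increment into a partial derivative at a point near [x], where continuity compares it with the
    value at [x]. *)
Lemma differentiable_partials_real (f : V -> R) (U : set V) (x : V) :
  open U -> U x -> (forall v y, U y -> derivable f y v) ->
  (forall i, {for x, continuous (fun y => 'D_(e i) f y)}) ->
  differentiable f x /\
  forall h, 'd f x h = \sum_i l i h * 'D_(e i) f x.
Proof.
move=> oU Ux df cdf.
pose D (h : V) : R^o := \sum_i l i h * 'D_(e i) f x.
have lD : linear D.
  move=> a u v; rewrite /D scaler_sumr -big_split /=; apply: eq_bigr => i _.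
  by rewrite linearP mulrDl -scalerAl.
pose DL : {linear V -> R^o} :=
  HB.pack D (GRing.isLinear.Build _ _ _ _ D lD).
have cD : continuous DL.
  have -> : (DL : V -> R^o) = \sum_i (fun h => l i h * 'D_(e i) f x).
    by apply/funext => h; rewrite fct_sumE.
  move=> h; elim/big_ind: _ => [|p q cp cq|i _].
  - exact: cvg_cst.
  - exact: continuousD.
  - by apply: cvgMr_tmp; exact: el.1.
have O : f \o shift x = cst (f x) + DL +o_ 0 id.
  apply/eqaddoP => eps eps0.
  have [C C0 lC] := coordinate_bound.
  (* [p k h] keeps the first [k] coordinates of [h]; the path from [x] to [x + h] has the corners
     [x + p k h], all within [B * |h|] of [x]. *)
  pose p (k : nat) (h : V) := \sum_(i < m | (i < k)%N) l i h *: e i.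
  pose B := 1 + \sum_i C * `|e i|.
  have B0 : 0 < B.
    by rewrite ltr_pwDl // sumr_ge0 // => i _; rewrite mulr_ge0 // ltW.
  (* Each of the [m] moves costs at most [C * eta * |h|], in total at most [eps * |h|]. *)
  pose eta := eps / (m%:R * C + 1).
  have eta0 : 0 < eta by rewrite divr_gt0 // ltr_wpDl // mulr_ge0 // ltW.
  have [r /= r0 rU] : nbhs_ball x
      (fun y => U y /\ forall i, `|'D_(e i) f x - 'D_(e i) f y| < eta).
    apply/nbhs_ballP; apply: filterI; first exact: open_nbhs_nbhs.
    apply: filter_forall => i; move/cvgrPdist_lt: (cdf i); exact.
  have sumS (W : zmodType) (F : 'I_m -> W) k (km : (k < m)%N) :
      \sum_(i < m | (i < k.+1)%N) F i =
      \sum_(i < m | (i < k)%N) F i + F (Ordinal km).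
    rewrite (bigD1 (Ordinal km)) /= ?ltnSn // addrC; congr (_ + _).
    apply: eq_bigl => i; rewrite ltnS leq_eqVlt -val_eqE /=.
    by case: ltngtP.
  have pb k (km : (k < m)%N) h (t : R) : 0 <= t <= 1 ->
      `|p k h + (t * l (Ordinal km) h) *: e (Ordinal km)| <= B * `|h|.
    move=> /andP[t0 t1]; apply: (@le_trans _ _
        (\sum_(i < m | (i < k.+1)%N) C * `|e i| * `|h|)).
      rewrite sumS; apply: (le_trans (ler_normD _ _)); apply: lerD.
        apply: (le_trans (ler_norm_sum _ _ _)); apply: ler_sum => i _.
        by rewrite normrZ mulrAC ler_wpM2r.
      rewrite normrZ normrM (ger0_norm t0) [leRHS]mulrAC ler_wpM2r //.
      by rewrite -[leRHS]mul1r; apply: ler_pM => //; exact: lC.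
    rewrite /B mulrDl mul1r -mulr_suml ler_wpDl // ler_wpM2r //.
    rewrite [leRHS](bigID (fun i : 'I_m => (i < k.+1)%N)) /= lerDl sumr_ge0 //.
    by move=> i _; rewrite mulr_ge0 // ltW.
  have key (h : V) : B * `|h| < r -> forall k, (k <= m)%N ->
      `|f (x + p k h) - f x - \sum_(i < m | (i < k)%N) l i h * 'D_(e i) f x|
        <= k%:R * (C * eta * `|h|).
    move=> hr; elim=> [|k IH] km.
      by rewrite mul0r /p !big1 ?addr0 ?subrr ?normr0 ?subr0 //.
    have IH' := IH (ltnW km); set q := Ordinal km.
    have [|t t01 et] := @mvt_direction V f (x + p k h) (e q) (l q h).
      move=> t t01; apply: df; apply: (rU _ _).1; rewrite -ball_normE /= -addrA.
      by rewrite opprD addNKr normrN (le_lt_trans _ hr) // pb.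
    have pS : x + p k.+1 h = x + p k h + l q h *: e q.
      by rewrite /p sumS addrA.
    rewrite sumS pS.
    set s1 := \sum_(i < m | _) _ in IH' *; set a := f (_ + _ *: _) in et *.
    have -> : a - f x - (s1 + l q h * 'D_(e q) f x) =
      (f (x + p k h) - f x - s1) +
      l q h * ('D_(e q) f (x + p k h + (t * l q h) *: e q) - 'D_(e q) f x).
      by rewrite mulrBr -et /q; ring.
    apply: (le_trans (ler_normD _ _)); rewrite -(addn1 k) natrD mulrDl mul1r.
    apply: lerD => //; rewrite normrM -mulrA (mulrC eta) mulrA.
    apply: ler_pM => //; rewrite distrC ltW //.
    apply: (rU _ _).2; rewrite -ball_normE /= -addrA.
    by rewrite opprD addNKr normrN (le_lt_trans _ hr) // pb.
  near=> h.
  have hr : B * `|h| < r.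
    rewrite mulrC -ltr_pdivlMr //; near: h; apply: nbhs0_lt; exact: divr_gt0.
  have := key h hr m (leqnn m); rewrite /= !fctE /=.
  have -> : x + p m h = h + x.
    rewrite addrC; congr (_ + _); rewrite [RHS](el.2 h) /p.
    by apply: eq_bigl => i; rewrite ltn_ord.
  have -> : \sum_(i < m | (i < m)%N) l i h * 'D_(e i) f x = D h.
    by apply: eq_bigl => i; rewrite ltn_ord.
  rewrite opprD addrA => /le_trans; apply.
  rewrite mulrA ler_wpM2r // /eta !mulrA ler_pdivrMr; last first.
    by rewrite ltr_wpDl // mulr_ge0 // ltW.
  by rewrite mulrC ler_wpM2l ?ltW // ltrDl.
have dE := diff_unique cD O.
split; last by move=> h; rewrite dE.
by apply/diff_locallyP; rewrite dE.
Unshelve. all: by end_near. Qed.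

End Differentiable.
End PartialDerivatives.

Section SmoothCalculus.
Context {R : realType}.
Implicit Types V W : normedModType R.

Lemma is_derive_linear_comp V W (W' : normedModType R) (f : V -> W) (L : {linear W -> W'})
    (x v : V) : continuous L -> derivable f x v ->
  is_derive x v (L \o f) (L ('D_v f x)).
Proof.
move=> cL df.
have H : h^-1 *: ((L \o f) (h *: v + x) - (L \o f) x) @[h --> 0^'] --> L ('D_v f x).
  have -> : (fun h : R => h^-1 *: ((L \o f) (h *: v + x) - (L \o f) x)) =
            L \o (fun h : R => h^-1 *: (f (h *: v + x) - f x)).
    by apply/funext => h /=; rewrite linearZ_LR (linearB L).
  by apply: continuous_cvg => //; exact: cL.
by apply: DeriveDef; [apply/cvg_ex; exists (L ('D_v f x))|exact: cvg_lim].
Qed.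

Lemma near_eq_continuous (T S : topologicalType) (f g : T -> S) (x : T) :
  (\forall y \near x, f y = g y) -> {for x, continuous f} ->
  {for x, continuous g}.
Proof.
move=> fg cf; rewrite /prop_for /continuous_at -(nbhs_singleton fg).
by apply: (cvg_trans _ cf); apply: near_eq_cvg; apply: filterS fg => y ->.
Qed.

Lemma differentiable_partials V W (f : V -> W) (U : set V) (x : V) :
  fin_dim V -> fin_dim W ->
  open U -> U x -> (forall v y, U y -> derivable f y v) ->
  (forall v, {for x, continuous (fun y => 'D_v f y)}) ->
  differentiable f x.
Proof.
move=> [m [e [l el]]] [m' [e' [l' el']]] oU Ux df cdf.
have -> : f = \sum_j (fun y => l' j (f y) *: e' j).
  by apply/funext => y; rewrite fct_sumE -(el'.2 (f y)).
apply: differentiable_sum => j; apply: differentiableZl.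
apply: (proj1 (differentiable_partials_real el (U := U) _ _ _ _)) => //.
- by move=> v y Uy; have [] := is_derive_linear_comp (el'.1 j) (df v y Uy).
- move=> i; apply: (@near_eq_continuous _ _ (l' j \o 'D_(e i) f)).
    near=> y; have Uy : U y by near: y; exact: open_nbhs_nbhs.
    by have [_ /esym] := is_derive_linear_comp (el'.1 j) (df (e i) y Uy).
  by apply: continuous_comp => //; exact: el'.1.
Unshelve. all: by end_near. Qed.

Lemma fin_dim_real : fin_dim R.
Proof.
exists 1%N, (fun=> 1 : R), (fun=> idfun : {linear R^o -> R^o}).
split=> [i x|x]; first exact: cvg_id.
by rewrite big_ord1 /= [_ *: _]mulr1.
Qed.

Lemma fin_dim_prod V W : fin_dim V -> fin_dim W -> fin_dim (V * W)%type.
Proof.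
move=> [m [e [l [cl el]]]] [m' [e' [l' [cl' el']]]].
exists (m + m')%N.
exists (fun i : 'I_(m + m') => match fintype.split i with inl j => (e j, 0) | inr j => (0, e' j) end).
exists (fun i : 'I_(m + m') => match fintype.split i with
  inl j => l j \o fst : {linear (V * W)%type -> R^o}
| inr j => l' j \o snd : {linear (V * W)%type -> R^o} end).
split.
  move=> i; case: fintype.split => j x /=.
    by apply: continuous_comp; [exact: cvg_fst|exact: cl].
  by apply: continuous_comp; [exact: cvg_snd|exact: cl'].
have sc (a : R) (u : V) (w : W) : a *: ((u, w) : V * W) = (a *: u, a *: w) by [].
move=> [x y]; rewrite big_split_ord /=.
rewrite (eq_bigr (fun i => (l i x *: e i, 0))); last first.
  by move=> i _; rewrite (unsplitK (inl i)) /= sc scaler0.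
rewrite [X in _ + X](eq_bigr (fun i => (0, l' i y *: e' i))); last first.
  by move=> i _; rewrite (unsplitK (inr i)) /= sc scaler0.
have pE (a b : V * W) : a.1 = b.1 -> a.2 = b.2 -> a = b.
  by case: a b => [? ?] [? ?] /= -> ->.
apply: pE; rewrite /= ?(raddf_sum fst) ?(raddf_sum snd) /= big1_eq ?addr0 ?add0r.
  exact: el.
exact: el'.
Qed.

Lemma fin_dim_rV k : fin_dim 'rV[R]_k.
Proof.
have lc (i : 'I_k) : linear ((fun x : 'rV[R]_k => x 0 i) : 'rV[R]_k -> R^o).
  by move=> a u v; rewrite !mxE.
pose L i : {linear 'rV[R]_k -> R^o} :=
  HB.pack (fun x : 'rV[R]_k => x 0 i) (GRing.isLinear.Build _ _ _ _ _ (lc i)).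
exists k, (fun i => delta_mx 0 i), L.
split=> [i x|x] /=; first exact: coord_continuous.
exact: row_sum_delta.
Qed.
End SmoothCalculus.

Section DifferentiabilityClasses.
Context {R : realType}.
Implicit Types V W : normedModType R.

(** Restricted to the line through [x], [g] is a function of one variable, for which derivability is
    differentiability; the chain rule for differentials then applies. *)
Lemma is_derive_chain V V' W (f : V' -> W) (g : V -> V') (x v : V) :
  differentiable f (g x) -> derivable g x v ->
  is_derive x v (f \o g) ('D_('D_v g x) f (g x)).
Proof.
move=> df dg.
have dg0 : derivable g (0 *: v + x) v by rewrite scale0r add0r.
have [dG eG] := is_derive_line dg0; have /derivable1_diffP dG' := dG.
have df0 : differentiable f ((fun s : R => g (s *: v + x)) 0).
  by rewrite scale0r add0r.
have dfG := differentiable_comp dG' df0.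
have d1 : derivable (f \o g) x v by apply/derivable1P/derivable1_diffP.
have d1' : derivable (f \o g) (0 *: v + x) v by rewrite scale0r add0r.
apply: DeriveDef => //; have [_] := is_derive_line d1'.
rewrite scale0r add0r => <-; rewrite deriveE //.
have -> : (fun s : R => (f \o g) (s *: v + x)) = f \o (fun s : R => g (s *: v + x)).
  by [].
have eG2 : 'd (fun s : R => g (s *: v + x)) 0 1 = 'D_v g x.
  by rewrite -deriveE // eG scale0r add0r.
rewrite diff_comp //; move: eG2; rewrite /= => ->.
by rewrite scale0r add0r (deriveE _ df).
Qed.

Lemma is_derive_scaler V W (r : V -> R) (f : V -> W) (x v : V) :
  derivable r x v -> derivable f x v ->
  is_derive x v (fun y => r y *: f y) ('D_v r x *: f x + r x *: 'D_v f x).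
Proof.
move=> dr df.
have H : h^-1 *: (r (h *: v + x) *: f (h *: v + x) - r x *: f x) @[h --> 0^'] -->
    'D_v r x *: f x + r x *: 'D_v f x.
  have -> : (fun h : R => h^-1 *: (r (h *: v + x) *: f (h *: v + x) - r x *: f x)) =
     (fun h : R => (h^-1 *: (r (h *: v + x) - r x)) *: f (h *: v + x) +
       r x *: (h^-1 *: (f (h *: v + x) - f x))).
    apply/funext => h; rewrite !scalerA (mulrC (r x)) -scalerA -scalerA -scalerDr.
    by congr (_ *: _); rewrite scalerBl scalerBr addrA subrK.
  apply: cvgD; last by apply: cvgZl_tmp; exact: df.
  apply: cvgZ; first exact: dr.
  have df0 : derivable f (0 *: v + x) v by rewrite scale0r add0r.
  have [/derivable1_diffP/differentiable_continuous/continuous_withinNx + _] :=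
    is_derive_line df0.
  by rewrite scale0r add0r.
by apply: DeriveDef; [apply/cvg_ex; eexists; exact: H|exact: cvg_lim H].
Qed.

Lemma Ck_cont k (V W : normedModType R) (U : set V) (f : V -> W) x : Ck k U f -> U x ->
  {for x, continuous f}.
Proof. by case: k => [|k] [+ _] => /[apply]. Qed.

Lemma Ck_pred k V W (U : set V) (f : V -> W) : Ck k.+1 U f -> Ck k U f.
Proof.
elim: k f => [|k IH] f [cf df]; first by split.
by split=> // v; have [dfv Cfv] := df v; split=> //; exact: IH.
Qed.

(** [Ck] is a conjunction of conditions at single points of the set, so [U'] can be any set around
    the point. *)
Lemma Ck_local k V W (U : set V) (f : V -> W) :
  (forall x, U x -> exists2 U', U' x & Ck k U' f) -> Ck k U f.
Proof.
elim: k f => [|k IH] f H.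
  by split=> // x /H[U' U'x [cf _]]; exact: cf.
split=> [x /H[U' U'x [cf _]]|v]; first exact: cf.
split=> [x /H[U' U'x [_ /(_ v)[+ _]]]|]; first by apply.
by apply: IH => x /H[U' U'x [_ /(_ v)[_ ?]]]; exists U'.
Qed.

Lemma Ck_sub k V W (U U' : set V) (f : V -> W) : U `<=` U' -> Ck k U' f -> Ck k U f.
Proof. by move=> UU' H; apply: Ck_local => x /UU' U'x; exists U'. Qed.

Lemma Ck_eq k V W (U : set V) (f g : V -> W) : open U ->
  (forall x, U x -> f x = g x) -> Ck k U f -> Ck k U g.
Proof.
move=> oU.
have nfg (f' g' : V -> W) : (forall x, U x -> f' x = g' x) ->
    forall x, U x -> \forall y \near x, f' y = g' y.
  move=> fg x Ux; apply: filterS (open_nbhs_nbhs (conj oU Ux)) => y; exact: fg.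
elim: k f g => [|k IH] f g fg.
  by move=> [cf _]; split=> // x Ux; apply: near_eq_continuous (cf _ Ux); exact: nfg.
move=> [cf df]; split=> [x Ux|v].
  by apply: near_eq_continuous (cf _ Ux); exact: nfg.
have [dfv Cfv] := df v; split=> [x Ux|].
  by apply: near_eq_derivable (dfv _ Ux); exact: nfg.
by apply: IH Cfv => x Ux; apply: near_eq_derive; exact: nfg.
Qed.

Lemma Ck_cst k V W (U : set V) (c : W) : Ck k U (fun=> c).
Proof.
elim: k c => [|k IH] c; first by split=> // x _; exact: cvg_cst.
split=> [x _|v]; first exact: cvg_cst.
split=> [x _|]; first exact: derivable_cst.
have -> : (fun x => 'D_v (fun=> c) x) = (fun=> 0 : W); last exact: IH.
by apply/funext => x; exact: derive_cst.
Qed.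

Lemma Ck_linear k V V' W (U : set V) (f : V -> V') (L : {linear V' -> W}) : open U ->
  continuous L -> Ck k U f -> Ck k U (L \o f).
Proof.
move=> oU cL; elim: k f => [|k IH] f.
  move=> [cf _]; split=> // x Ux; apply: continuous_comp; first exact: cf.
  exact: cL.
move=> [cf df]; split=> [x Ux|v].
  by apply: continuous_comp; [exact: cf|exact: cL].
have [dfv Cfv] := df v; split=> [x Ux|].
  by have [] := is_derive_linear_comp cL (dfv x Ux).
apply: Ck_eq (IH _ Cfv) => // x Ux.
by have [_ /esym] := is_derive_linear_comp cL (dfv x Ux).
Qed.

Lemma Ck_id k V (U : set V) : Ck k U id.
Proof.
case: k => [|k]; first by split=> // x _; exact: cvg_id.
split=> [x _|v]; first exact: cvg_id.
split=> [x _|]; first exact: derivable_id.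
have -> : (fun x => 'D_v id x) = (fun=> v); last exact: Ck_cst.
by apply/funext => x; exact: derive_id.
Qed.

Lemma Ck_add k V W (U : set V) (f g : V -> W) : open U ->
  Ck k U f -> Ck k U g -> Ck k U (fun x => f x + g x).
Proof.
move=> oU; elim: k f g => [|k IH] f g.
  by move=> [cf _] [cg _]; split=> // x Ux; apply: continuousD; [exact: cf|exact: cg].
move=> [cf df] [cg dg]; split=> [x Ux|v].
  by apply: continuousD; [exact: cf|exact: cg].
have [dfv Cfv] := df v; have [dgv Cgv] := dg v; split=> [x Ux|].
  by apply: derivableD; [exact: dfv|exact: dgv].
apply: Ck_eq (IH _ _ Cfv Cgv) => // x Ux.
by rewrite -deriveD; [|exact: dfv|exact: dgv].
Qed.

Lemma Ck_sum k V W (U : set V) m (f : 'I_m -> V -> W) : open U ->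
  (forall i, Ck k U (f i)) -> Ck k U (fun x => \sum_i f i x).
Proof.
move=> oU Cf; have -> : (fun x => \sum_i f i x) = \sum_i f i.
  by apply/funext => x; rewrite fct_sumE.
elim/big_ind: _ => [|p q Cp Cq|i _]; [exact: Ck_cst|exact: Ck_add|exact: Cf].
Qed.

Lemma Ck_scaler k V W (U : set V) (r : V -> R) (f : V -> W) : open U ->
  Ck k U r -> Ck k U f -> Ck k U (fun x => r x *: f x).
Proof.
move=> oU; elim: k r f => [|k IH] r f.
  by move=> [cr _] [cf _]; split=> // x Ux; apply: cvgZ; [exact: cr|exact: cf].
move=> Cr Cf; have [cr dr] := Cr; have [cf df] := Cf; split=> [x Ux|v].
  by apply: cvgZ; [exact: cr|exact: cf].
have [drv Crv] := dr v; have [dfv Cfv] := df v; split=> [x Ux|].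
  by have [] := is_derive_scaler (drv x Ux) (dfv x Ux).
apply: Ck_eq (Ck_add oU (IH _ _ Crv (Ck_pred Cf)) (IH _ _ (Ck_pred Cr) Cfv)) => // x Ux.
by have [_ /esym] := is_derive_scaler (drv x Ux) (dfv x Ux).
Qed.

Lemma Ck_differentiable k V W (U : set V) (f : V -> W) x : fin_dim V -> fin_dim W ->
  open U -> U x -> Ck k.+1 U f -> differentiable f x.
Proof.
move=> fV fW oU Ux [cf df]; apply: (differentiable_partials fV fW oU Ux).
  by move=> v y Uy; have [+ _] := df v; apply.
by move=> v; have [_ Cv] := df v; exact: Ck_cont Cv Ux.
Qed.

(** The derivative of [f \o g] takes that of [f] in a direction that varies with the point.
    Expanding this direction in coordinates leaves derivatives of [f] along the fixed [e i], with
    coefficients [l i ('D_v g x)], to which the induction applies. *)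
Lemma Ck_comp k V V' W (U : set V) (U' : set V') (f : V' -> W) (g : V -> V') :
  fin_dim V' -> fin_dim W -> open U -> open U' -> (forall x, U x -> U' (g x)) ->
  Ck k U' f -> Ck k U g -> Ck k U (f \o g).
Proof.
move=> fV' fW oU oU' gU; elim: k f g gU => [|k IH] f g gU.
  move=> [cf _] [cg _]; split=> // x Ux; apply: continuous_comp; first exact: cg.
  exact/cf/gU.
move=> Cf Cg; have [cf df] := Cf; have [cg dg] := Cg; split=> [x Ux|v].
  by apply: continuous_comp; [exact: cg|exact/cf/gU].
have [dgv Cgv] := dg v.
have fg x : U x -> is_derive x v (f \o g) ('D_('D_v g x) f (g x)).
  move=> Ux; apply: is_derive_chain; last exact: dgv.
  exact: (Ck_differentiable fV' fW oU' (gU _ Ux) Cf).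
split=> [x Ux|]; first by have [] := fg x Ux.
have [m [e [l [cl el]]]] := fV'.
have C : Ck k U (fun x => \sum_i l i ('D_v g x) *: ('D_(e i) f \o g) x).
  apply: Ck_sum => // i; apply: Ck_scaler => //.
    exact: (Ck_linear oU (cl i) Cgv).
  by apply: IH => //; [have [] := df (e i)|exact: Ck_pred].
apply: Ck_eq C => // x Ux; have [_ ->] := fg x Ux.
have dfx := Ck_differentiable fV' fW oU' (gU _ Ux) Cf.
rewrite [RHS]deriveE // [in RHS](el ('D_v g x)) linear_sum.
by apply: eq_bigr => i _; rewrite linearZ_LR /= (deriveE _ dfx).
Qed.

End DifferentiabilityClasses.

(** * Smooth bump functions and steps on the line *)

Section SmoothSteps.
Context {R : realType}.

Lemma Ck_opp k (V W : normedModType R) (U : set V) (f : V -> W) : open U ->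
  Ck k U f -> Ck k U (fun x => - f x).
Proof.
move=> oU Cf; apply: Ck_eq (Ck_scaler oU (Ck_cst k U (-1 : R)) Cf) => // x _.
by rewrite scaleN1r.
Qed.

Lemma Ck_primitive k (W : normedModType R) (U : set R) (f g : R -> W) : open U ->
  (forall x, U x -> is_derive x 1 f (g x)) -> Ck k U g -> Ck k.+1 U f.
Proof.
move=> oU fg Cg; split=> [x Ux|v].
  apply/differentiable_continuous/derivable1_diffP.
  by have [] := fg x Ux.
have dv x : U x -> is_derive x v f (v *: g x).
  move=> Ux; have [d1 d2] := fg x Ux.
  by have := is_derive_scale v d1; rewrite d2 [v *: 1]mulr1.
split=> [x Ux|]; first by have [] := dv x Ux.
apply: Ck_eq (Ck_scaler oU (Ck_cst k U (v : R)) Cg) => // x Ux.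
by have [_ ->] := dv x Ux.
Qed.

(** The classical flat function exp(-1/x) with its companions x^-n exp(-1/x): differentiation maps
    the family into its linear span, so all of them are smooth by one induction on the order. *)
Definition flat (n : nat) (x : R) : R :=
  if 0 < x then x ^- n * expR (- x^-1) else 0.

Lemma flat_ge0 n x : 0 <= flat n x.
Proof.
by rewrite /flat; case: ifPn => // x0; rewrite mulr_ge0 ?expR_ge0 // invr_ge0 exprn_ge0 // ltW.
Qed.

Lemma flat_gt0 n x : 0 < x -> 0 < flat n x.
Proof. by move=> x0; rewrite /flat x0 mulr_gt0 ?expR_gt0 // invr_gt0 exprn_gt0. Qed.

(** exp(1/x) dominates the term of order n+1 of its series. *)
Lemma flat_le n x : 0 < x -> flat n x <= n.+1`!%:R * x.
Proof.
move=> x0; rewrite /flat x0 expRN.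
have u0 : 0 < x^-1 by rewrite invr_gt0.
have := expR_ge1Dxn n (ltW u0); set E := expR _ => H.
have E0 : 0 < E by exact: expR_gt0.
rewrite ler_pdivrMr // -exprVn; rewrite -ler_pdivrMl; last first.
  by rewrite mulr_gt0 // ltr0n fact_gt0.
apply: le_trans H; rewrite ler_wpDl // exprS invfM mulrC mulrA mulrC //.
by rewrite mulrA.
Qed.

Lemma is_derive_flat n (x : R) :
  is_derive x 1 (flat n) (- n%:R * flat n.+1 x + flat n.+2 x).
Proof.
have [x0|x0|->] := ltgtP x 0.
- have -> : - n%:R * flat n.+1 x + flat n.+2 x = 0.
    by rewrite /flat (lt_gtF x0) mulr0 addr0.
  apply: (@near_eq_is_derive R R R (cst 0)).
  near=> y; rewrite /flat lt_gtF //; near: y; exact: lt_nbhsl.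
- apply: (@near_eq_is_derive R R R (fun y : R => y^-1 ^+ n * expR (- y^-1))); first by
    near=> y; rewrite /flat ifT ?exprVn //; near: y; exact: lt_nbhsr.
  have xn0 : x != 0 by rewrite gt_eqF.
  have dV : is_derive x 1 (fun y : R => y^-1) (- x ^- 2).
    have := @derivableV R R id x 1 xn0 (@derivable_id _ _ _ _).
    move=> d; apply: DeriveDef; first exact: d.
    have := @deriveV R R id x 1 xn0 (@derivable_id _ _ _ _).
    by rewrite derive_id /= [_ *: _]mulr1.
  have d := is_deriveM (is_deriveX n dV)
    (is_derive1_comp (is_derive_expR _) (is_deriveN dV)).
  have pw (y : R) : (([eta GRing.inv] : R -> R) ^+ n) y = y^-1 ^+ n.
    by elim: n {d} => [|k IH] //; rewrite !exprS -IH.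
  have -> : (fun y : R => y^-1 ^+ n * expR (- y^-1)) =
      ([eta GRing.inv] : R -> R) ^+ n * (expR \o - ([eta GRing.inv] : R -> R)).
    by apply/funext => y; rewrite -pw.
  apply: (is_derive_eq d); rewrite pw /flat x0 /= -!exprVn.
  set u := x^-1; set E := expR (- u).
  rewrite /GRing.scale /=; case: n {d pw} => [|k] /=.
    by rewrite !expr0 expr1; ring.
  by rewrite !exprS; ring.
- have -> : - n%:R * flat n.+1 0 + flat n.+2 0 = 0 :> R.
    by rewrite /flat ltxx mulr0 addr0.
  have H : h^-1 *: (flat n (h *: 1 + 0) - flat n 0) @[h --> (0 : R)^'] --> (0 : R).
    apply/cvgr0Pnorm_le => eps eps0; near=> h.
    have -> : h *: 1 + 0 = h :> R by rewrite addr0 [_ *: _]mulr1.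
    rewrite {2}/flat ltxx subr0 /GRing.scale /=.
    have [h0|h0] := ltP 0 h; last first.
      by rewrite /flat ltNge h0 mulr0 normr0 ltW.
    (* The difference quotient at 0 is the next function of the family, and [flat_le] makes it tend
       to 0. *)
    have -> : h^-1 * flat n h = flat n.+1 h.
      by rewrite /flat h0 exprS invfM mulrA.
    rewrite ger0_norm ?flat_ge0 // (le_trans (flat_le _ h0)) //.
    rewrite mulrC -ler_pdivlMr ?ltr0n ?fact_gt0 // -[h]gtr0_norm //.
    near: h; apply: dnbhs0_le; rewrite divr_gt0 // ltr0n fact_gt0 //.
  by apply: DeriveDef; [apply/cvg_ex; exists 0; exact: H|exact: cvg_lim H].
Unshelve. all: by end_near. Qed.

Lemma smooth_flat n : smooth_on [set: R] (flat n).
Proof.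
move=> k; elim: k n => [|k IH] n.
  split=> // x _; apply/differentiable_continuous/derivable1_diffP.
  by have [] := is_derive_flat n x.
apply: (Ck_primitive openT (fun x _ => is_derive_flat n x)).
by apply: Ck_add (openT) (Ck_scaler openT (Ck_cst _ _ _) (IH _)) (IH _).
Qed.

(** The integral starts at -1, inside the half-line where [h] vanishes. To the right of -1 the
    fundamental theorem applies; elsewhere the integral is locally 0. *)
Lemma exists_primitive (h : R -> R) : continuous h -> (forall x : R, x <= 0 -> h x = 0) ->
  exists2 H : R -> R, forall x : R, is_derive x (1 : R) H (h x) & forall x : R, x <= 0 -> H x = 0.
Proof.
move=> ch h0; pose H x := \int[lebesgue_measure]_(t in `[-1, x]) h t.
have H0 x : x <= 0 -> H x = 0.
  move=> x0; rewrite /H (@eq_Rintegral _ _ _ _ _ (fun=> 0)).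
    by rewrite /Rintegral integral0.
  by move=> t; rewrite inE /= in_itv /= => /andP[_ tx]; apply: h0; lra.
exists H => // x.
have [x1|x1] := ltP (-1) x.
  have xx1 : x < x + 1 by rewrite ltrDl.
  have [|d1 d2] := @continuous_FTC1_closed R h (-1) x (x + 1) xx1 _ x1 (ch x).
    apply: continuous_compact_integrable; first exact: segment_compact.
    by apply: continuous_subspaceT.
  by apply: DeriveDef d1 _; rewrite -derive1E; exact: d2.
rewrite h0; last by lra.
apply: (@near_eq_is_derive R R R (cst 0)).
by near=> y; rewrite H0 // ltW //; near: y; apply: lt_nbhsl; lra.
Unshelve. all: by end_near. Qed.

Lemma mvt_le (f df : R -> R) (m p q : R) : p <= q ->
  (forall x : R, is_derive x (1 : R) f (df x)) ->
  (forall x, p < x < q -> m <= df x) -> m * (q - p) <= f q - f p.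
Proof.
rewrite le_eqVlt => /predU1P[->|pq] fd mdf; first by rewrite !subrr mulr0.
have [|c cpq ->] := @MVT R f df p q pq (fun x _ => fd x).
  by apply: derivable_within_continuous => x _; have [] := fd x.
by apply: ler_wpM2r; [rewrite subr_ge0 ltW|apply: mdf; move: cpq; rewrite in_itv].
Qed.

Lemma mvt_ge (f df : R -> R) (m p q : R) : p <= q ->
  (forall x : R, is_derive x (1 : R) f (df x)) ->
  (forall x, p < x < q -> df x <= m) -> f q - f p <= m * (q - p).
Proof.
move=> pq fd mdf.
have := @mvt_le (fun x => - f x) (fun x => - df x) (- m) p q pq.
rewrite mulNr => H; suff : - (m * (q - p)) <= - f q - - f p by lra.
by apply: H => x xpq; rewrite lerN2 mdf.
Qed.

Lemma smooth_on_cont (f : R -> R) : smooth_on setT f -> continuous f.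
Proof. by move=> /(_ 0%N)[cf _] x; exact: cf. Qed.

(** The step is the primitive of the bump divided by its total mass, which is at least
    [m * (q - p)]; this is the source of the bound on the slope. *)
Lemma step_of_bump (h : R -> R) (p q m : R) : smooth_on setT h ->
  (forall x : R, 0 <= h x) -> (forall x : R, x <= 0 -> h x = 0) ->
  (forall x : R, 1 <= x -> h x = 0) ->
  0 <= p -> p < q -> q <= 1 -> 0 < m -> (forall x, p < x < q -> m <= h x) ->
  exists s ds : R -> R,
    [/\ smooth_on setT s, forall x : R, is_derive x (1 : R) s (ds x),
        forall x : R, x <= 0 -> s x = 0, forall x : R, 1 <= x -> s x = 1 &
        forall x : R, 0 <= ds x <= h x / (m * (q - p))].
Proof.
move=> sh h0 hl hr p0 pq q1 m0 hm.
have [H dH Hl] := exists_primitive (smooth_on_cont sh) hl.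
have mono x y : x <= y -> H x <= H y.
  by move=> /mvt_le/(_ dH (fun z _ => h0 z)); rewrite mul0r subr_ge0.
pose c := H 1.
have cge : m * (q - p) <= c.
  apply: (le_trans (mvt_le (ltW pq) dH hm)).
  have := mono _ _ q1; have := mono _ _ p0; rewrite Hl // /c; lra.
have mqp : 0 < m * (q - p) by rewrite mulr_gt0 // subr_gt0.
have c0 : 0 < c by lra.
exists (fun x => c^-1 * H x), (fun x => c^-1 * h x); split.
- move=> k; apply: (@Ck_scaler _ k R R _ (fun=> c^-1)); [exact: openT|exact: Ck_cst|].
  by apply: Ck_pred; apply: (Ck_primitive openT (fun x _ => dH x)).
- by move=> x; exact: is_deriveZ.
- by move=> x /Hl ->; rewrite mulr0.
- move=> x x1; have -> : H x = c; last by rewrite mulVf // gt_eqF.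
  apply: le_anti; rewrite (mono 1 x x1) andbT -subr_le0.
  apply: (le_trans (@mvt_ge H h 0 1 x x1 dH _)); last by rewrite mul0r.
  by move=> z /andP[z1 _]; rewrite hr // ltW.
- move=> x; apply/andP; split; first by rewrite mulr_ge0 // invr_ge0 ltW.
  by rewrite mulrC ler_wpM2l // lef_pV2.
Qed.

Lemma exists_smooth_step0 : exists s ds : R -> R,
  [/\ smooth_on setT s, forall x : R, is_derive x (1 : R) s (ds x),
    forall x : R, x <= 0 -> s x = 0, forall x : R, 1 <= x -> s x = 1 & forall x : R, 0 <= ds x].
Proof.
have e0 : 0 < expR (- 4) :> R by exact: expR_gt0.
have flat_ge x : 4^-1 < x -> expR (- 4) <= flat 0 x.
  move=> x4; have x0 : 0 < x by apply: lt_trans x4; rewrite invr_gt0.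
  rewrite /flat x0 expr0 invr1 mul1r ler_expR lerN2 -[leRHS]invrK lef_pV2 ?ltW //.
  by rewrite posrE invr_gt0.
(* On [1/4, 3/4] both factors are at least exp(-4). *)
have [||||||||| s [ds [? ? ? ? H]]] := @step_of_bump (fun x => flat 0 x * flat 0 (1 - x))
    (4^-1) (1 - 4^-1) (expR (-4) * expR (-4)).
- move=> k; apply: (@Ck_scaler _ k R R _ (flat 0)); [exact: openT|exact: smooth_flat|].
  apply: (@Ck_comp _ _ R R R setT setT (flat 0) (fun x => 1 - x)) => //;
    try exact: openT; try exact: fin_dim_real; first exact: smooth_flat.
  by apply: Ck_add; [exact: openT|exact: Ck_cst|exact/Ck_opp/Ck_id/openT].
- by move=> x; rewrite mulr_ge0 ?flat_ge0.
- by move=> x x0; rewrite /flat ltNge x0 /= mul0r.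
- by move=> x x1; rewrite /flat [0 < 1 - x]ltNge subr_le0 x1 /= mulr0.
- by rewrite invr_ge0.
- lra.
- lra.
- by rewrite mulr_gt0.
- by move=> x /andP[xl xr]; apply: ler_pM; rewrite ?(ltW e0) //; apply: flat_ge; lra.
by exists s, ds; split=> // x; have /andP[] := H x.
Qed.
End SmoothSteps.

(** * Compactness and smooth changes of time *)

Section Reparametrization.
Context {R : realType}.

(** A Lebesgue number argument in general form: thresholds that work near each point are reduced to
    a common one, as [P] survives shrinking the threshold. Most uniform statements below are
    instances. *)
Lemma compact_uniform (T : topologicalType) (K : set T) (P : R -> T -> Prop) :
  compact K -> (forall d d' y, 0 < d' -> d' <= d -> P d y -> P d' y) ->
  (forall x, K x -> exists2 d, 0 < d & \forall y \near x, P d y) ->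
  exists2 d, 0 < d & forall y, K y -> P d y.
Proof.
move=> /compact_near_coveringP cK mP locP.
have /nbhs_right0P/nbhs_ballP[d /= d0 Pd] : \forall d \near (0 : R)^'+, K `<=` P d.
  apply: cK => x Kx; have [d d0 Pd] := locP x Kx.
  exists ([set y | P d y], [set e | 0 < e <= d]) => /=.
    split=> //; near=> e; apply/andP; split; near: e; first exact: nbhs_right_gt.
    exact: nbhs_right_le.
  by move=> [y e] /= [Pdy /andP[e0 ed]]; apply: mP Pdy.
have d20 : 0 < d / 2 by rewrite divr_gt0.
exists (d / 2) => //; rewrite -[d / 2]add0r; apply: Pd => //.
by rewrite -ball_normE /= sub0r normrN gtr0_norm // ltr_pdivrMr // ltr_pMr // ltr1n.
Unshelve. all: by end_near. Qed.

(** [ds] also vanishes at [a] and [b], so that among steps over consecutive intervals at most one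
    moves at any time. *)
Definition smooth_step (a b : R) (s ds : R -> R) :=
  [/\ smooth_on setT s, forall x : R, is_derive x (1 : R) s (ds x),
    forall x, x <= a -> s x = 0, forall x, b <= x -> s x = 1 &
    forall x, 0 <= ds x /\ (~ a < x < b -> ds x = 0)].

Lemma smooth_affine (f : R -> R) (c e : R) : smooth_on setT f ->
  smooth_on setT (fun x => f (c * x + e)).
Proof.
move=> sf k; apply: (@Ck_comp _ _ R R R setT setT f (fun x => c * x + e)) => //;
  try exact: openT; try exact: fin_dim_real.
apply: Ck_add; [exact: openT| |exact: Ck_cst].
by apply: (@Ck_scaler _ _ R R _ (cst c)); [exact: openT|exact: Ck_cst|exact: Ck_id].
Qed.

Lemma is_derive_affine (f df : R -> R) (c e x : R) :
  (forall x : R, is_derive x (1 : R) f (df x)) ->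
  is_derive x (1 : R) (fun x : R => f (c * x + e)) (c * df (c * x + e)).
Proof.
move=> fd; rewrite mulrC.
have H : is_derive x (1 : R) (fun x : R => c * x + e) c.
  apply: is_derive_eq; rewrite addr0 /GRing.scale /= mulr1 //.
exact: (@is_derive1_comp R f (fun y : R => c * y + e) x _ _ (fd (c * x + e)) H).
Qed.

Lemma smooth_step_affine (a b c e : R) (s ds : R -> R) : 0 < c ->
  smooth_step a b s ds ->
  smooth_step ((a - e) / c) ((b - e) / c) (fun x => s (c * x + e))
    (fun x => c * ds (c * x + e)).
Proof.
move=> c0 [s1 s2 s3 s4 s5]; split.
- exact: smooth_affine.
- by move=> x; exact: is_derive_affine.
- by move=> x; rewrite ler_pdivlMr // lerBrDr mulrC => /s3.
- by move=> x; rewrite ler_pdivrMr // lerBlDr mulrC => /s4.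
- move=> x; have [h1 h2] := s5 (c * x + e); split; first by rewrite mulr_ge0 // ltW.
  move=> h; rewrite h2 ?mulr0 // => h'; apply: h.
  by rewrite ltr_pdivrMr // ltr_pdivlMr // ltrBlDr ltrBrDr mulrC.
Qed.

Lemma smooth_step_ndecr (a b : R) s ds x y : smooth_step a b s ds -> x <= y -> s x <= s y.
Proof.
move=> [_ d _ _ h] xy; have := mvt_le xy d (fun z _ => (h z).1).
by rewrite mul0r subr_ge0.
Qed.

Lemma smooth_step_itv (a b : R) s ds x : smooth_step a b s ds -> 0 <= s x <= 1.
Proof.
move=> st; have [_ _ l r _] := st.
apply/andP; split.
  rewrite -[leLHS](l (Num.min x a)) ?ge_min ?lexx ?orbT //.
  by rewrite (smooth_step_ndecr st) // ge_min lexx.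
rewrite -[leRHS](r (Num.max x b)) ?le_max ?lexx ?orbT //.
by rewrite (smooth_step_ndecr st) // le_max lexx.
Qed.

(** The slope is nearly optimal because the bump is: a product of two steeper steps, it equals 1
    except within [th] of the ends of [0,1] and never exceeds 1. *)
Lemma exists_smooth_step (a b eta : R) : a < b -> 0 < eta ->
  exists s ds, smooth_step a b s ds /\ forall x, ds x <= (1 + eta) / (b - a).
Proof.
wlog [-> ->] : a b / a = 0 /\ b = 1.
  move=> hw ab eta0; have [s [ds [st dl]]] := hw 0 1 (conj erefl erefl) ltr01 eta0.
  have c0 : 0 < (b - a)^-1 by rewrite invr_gt0 subr_gt0.
  exists (fun x => s ((b - a)^-1 * x + - a / (b - a))).
  exists (fun x => (b - a)^-1 * ds ((b - a)^-1 * x + - a / (b - a))); split.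
    have := smooth_step_affine (- a / (b - a)) c0 st.
    have ba : b - a != 0 by rewrite subr_eq0 gt_eqF.
    have -> : (0 - - a / (b - a)) / (b - a)^-1 = a by field.
    by have -> : (1 - - a / (b - a)) / (b - a)^-1 = b by field.
  move=> x; rewrite mulrC ler_wpM2r ?(ltW c0) //.
  by have := dl ((b - a)^-1 * x + - a / (b - a)); rewrite subr0 divr1.
move=> _ eta0; rewrite subr0 divr1.
have [s0 [ds0 [ss ds l r ge0]]] := @exists_smooth_step0 R.
(* Chosen so that the mass, at least [1 - 2 * th], satisfies [1 <= (1 + eta) * (1 - 2 * th)]. *)
pose th : R := eta / (4 * (1 + eta)).
have th0 : 0 < th by rewrite divr_gt0 // mulr_gt0 // addr_gt0.
have th4 : th * (4 * (1 + eta)) = eta by rewrite divfK // gt_eqF // mulr_gt0 // addr_gt0.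
have th1 : th < 4^-1 by nra.
have mono x y : x <= y -> s0 x <= s0 y.
  by move=> xy; have := mvt_le xy ds (fun z _ => ge0 z); rewrite mul0r subr_ge0.
have s0p x : 0 <= s0 x.
  by rewrite -[leLHS](l (Num.min x 0)) ?mono ?ge_min ?lexx ?orbT.
have s0l x : s0 x <= 1.
  by rewrite -[leRHS](r (Num.max x 1)) ?mono ?le_max ?lexx ?orbT.
pose h x := s0 (th^-1 * x + 0) * s0 (- th^-1 * x + th^-1).
have hl x : h x <= 1 by rewrite -[leRHS]mul1r /h ler_pM.
have [||||||||| s [ds' [? ? sl sr H]]] := @step_of_bump R h th (1 - th) 1.
- by move=> k; apply: (@Ck_scaler _ k R R); [exact: openT| |]; exact: smooth_affine.
- by move=> x; rewrite mulr_ge0.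
- by move=> x x0; rewrite /h l ?mul0r // addr0 pmulr_rle0 // invr_gt0.
- move=> x x1; rewrite /h [X in _ * X]l ?mulr0 // mulNr addrC subr_le0.
  by rewrite ler_peMr // invr_ge0 ltW.
- exact: ltW.
- lra.
- lra.
- exact: ltr01.
- move=> x /andP[xl xr]; rewrite /h !r ?mul1r // ?addr0.
    have -> : - th^-1 * x + th^-1 = (1 - x) / th by ring.
    by rewrite ler_pdivlMr // mul1r; lra.
  by rewrite mulrC ler_pdivlMr // mul1r ltW.
have hK x : ds' x <= 1 + eta.
  have /andP[_] := H x; rewrite mul1r => /le_trans; apply.
  rewrite ler_pdivrMr; last by lra.
  by apply: (le_trans (hl x)); nra.
exists s, ds'; split=> //; split=> // x; have /andP[d0 dl] := H x; split=> //.
move=> nx; apply: le_anti; rewrite d0 andbT (le_trans dl) // pmulr_lle0.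
  have [x0|x0] := leP x 0; first by rewrite /h l ?mul0r // addr0 pmulr_rle0 // invr_gt0.
  have [x1|x1] := leP 1 x; last by case: nx; rewrite x0.
  rewrite /h [X in _ * X]l ?mulr0 // mulNr addrC subr_le0.
  by rewrite ler_peMr // invr_ge0 ltW.
rewrite invr_gt0; lra.
Qed.

(* Time is spent on each of [m] equal pieces of the range in proportion to the
   size of [k] there, so that [dz t * k (z t)] is nearly constant. *)
Lemma exists_time_change_unnormalized (k K : R -> R) (h e1 eta : R) (m : nat) :
  0 < h -> 0 < e1 -> 0 < eta -> (forall x, 0 <= k x) ->
  (forall x : R, is_derive x (1 : R) K (k x)) ->
  (forall x y, `|x - y| <= h -> `|k x - k y| <= e1) ->
  exists (T : R) (z dz : R -> R),
    [/\ [/\ 0 <= T, m%:R * h * e1 <= T & T <= K (m%:R * h) - K 0 + 3 * e1 * (m%:R * h)],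
        smooth_on setT z, forall x : R, is_derive x (1 : R) z (dz x),
        (forall t, t <= 0 -> z t = 0) /\ (forall t, T <= t -> z t = m%:R * h) &
        forall t, [/\ 0 <= dz t, (~ 0 < t < T -> dz t = 0) & dz t * k (z t) <= 1 + eta]].
Proof.
move=> h0 e10 eta0 k0 dK uk; elim: m => [|m [T [z [dz [[T0 Tl Tu] sz z1 [z2 z2'] z3]]]]].
  exists 0, (cst 0), (cst 0); split.
  - by rewrite !mul0r subrr mulr0 addr0.
  - by move=> j; exact: Ck_cst.
  - by move=> x; exact: is_derive_cst.
  - by split=> // t _; rewrite mul0r.
  - by move=> t; split=> //=; rewrite mul0r addr_ge0 // ltW.
(* [w] is the time granted to the piece from [p] to [p + h]. There [k] stays below [k p + e1], which
   bounds the product; and the integral of [k] over the piece is at least [h * (k p - e1)], so [w]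
   exceeds it by at most [3 * e1 * h]. *)
pose p := m%:R * h; pose w := h * (k p + 2 * e1).
have w0 : 0 < w by rewrite mulr_gt0 // ltr_wpDl // mulr_gt0.
have [|s [ds [st dsl]]] := @exists_smooth_step T (T + w) eta _ eta0.
  by rewrite ltrDl.
have [s1 s2 s3 s4 s5] := st.
have mh : m.+1%:R * h = p + h by rewrite -natr1 mulrDl mul1r.
exists (T + w), (fun t => z t + h * s t), (fun t => dz t + h * ds t); split.
- rewrite mh; split; first by rewrite addr_ge0 // ltW.
    by rewrite /w mulrDl; apply: lerD => //; rewrite ler_wpM2l ?ltW //; have := k0 p; lra.
  have : (k p - e1) * (p + h - p) <= K (p + h) - K p.
    apply: mvt_le dK _ => [|x /andP[xl xr]]; first by rewrite lerDl ltW.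
    have := uk p x; rewrite distrC ler_norml ler_norml.
    have -> : - h <= x - p <= h by apply/andP; split; lra.
    by move=> /(_ isT) /andP[]; lra.
  move: Tu; rewrite -/p /w; nra.
- move=> j; apply: Ck_add; [exact: openT|exact: sz|].
  by apply: (@Ck_scaler _ _ R R _ (cst h)); [exact: openT|exact: Ck_cst|exact: s1].
- by move=> x; apply: is_deriveD => //; exact: is_deriveZ.
- split=> t ht.
    by rewrite z2 // s3 ?mulr0 ?addr0 // (le_trans ht).
  by rewrite z2' ?s4 ?mulr1 ?mh // (le_trans _ ht) // lerDl ltW.
- move=> t; have [a1 a2 a3] := z3 t; have [b1 b2] := s5 t; split.
  + by rewrite addr_ge0 // mulr_ge0 // ltW.
  + move=> ht; rewrite a2 ?b2 ?mulr0 ?addr0 // => /andP[t1 t2]; apply: ht.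
      by rewrite t2 andbT (le_lt_trans T0).
    by rewrite t1 (lt_trans t2) // ltrDl.
  (* Up to [T] the new step rests at 0, afterwards the old function rests at [p]: only one of the
     two derivatives is nonzero. *)
  + have [tT|Tt] := leP t T.
      rewrite s3 // b2; last by rewrite ltNge tT.
      by rewrite !mulr0 !addr0.
    rewrite z2' ?(ltW Tt) // a2 ?add0r; last by rewrite (lt_gtF Tt) andbF.
    have /andP[st0 st1] := smooth_step_itv t st.
    have : `|k (p + h * s t) - k p| <= e1.
      apply: uk; rewrite addrAC subrr add0r ger0_norm ?mulr_ge0 ?(ltW h0) //.
      by rewrite ger_pMr.
    rewrite ler_norml => /andP[_ ub].
    have dsl' : ds t * w <= 1 + eta.
      by rewrite -ler_pdivlMr // (le_trans (dsl t)) // addrAC subrr add0r.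
    apply: le_trans dsl'; rewrite mulrAC mulrC ler_wpM2l // /w.
    by rewrite ler_wpM2l ?(ltW h0) // -/p; lra.
Qed.

(** A constant product [dz t * k (z t)] would require inverting the primitive of [k], whose inverse
    need not be smooth nor exist where [k] vanishes; the loss [eps] buys smoothness. *)
Lemma exists_time_change (k K : R -> R) (a b eps : R) :
  a < b -> 0 < eps -> (forall x, 0 <= k x) ->
  (forall x : R, is_derive x (1 : R) K (k x)) ->
  (forall e, 0 < e -> exists2 h, 0 < h & forall x y, `|x - y| <= h -> `|k x - k y| <= e) ->
  exists z dz : R -> R, smooth_step a b z dz /\
    forall t, dz t * k (z t) <= (K 1 - K 0 + eps) / (b - a).
Proof.
move=> ab eps0 k0 dK uk.
(* With these values the total time [T] is at most [I + 3 * e1 = I + eps / 2], and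
   [(I + eps / 2) * (1 + eta) = I + eps]. *)
pose I := K 1 - K 0; pose e1 := eps / 6; pose eta := (eps / 2) / (I + eps / 2).
have I0 : 0 <= I.
  by have := mvt_le ler01 dK (fun z _ => k0 z); rewrite mul0r.
have e10 : 0 < e1 by rewrite divr_gt0.
have I2 : 0 < I + eps / 2 by rewrite ltr_wpDl // divr_gt0.
have eta0 : 0 < eta by rewrite !divr_gt0.
have etaE : eta * (I + eps / 2) = eps / 2 by rewrite divfK // gt_eqF.
have [h0 h00 uk0] := uk _ e10.
pose m := (Num.truncn h0^-1).+1.
have m0 : 0 < m%:R :> R by rewrite ltr0n.
have mh : m%:R^-1 <= h0.
  by rewrite -[leRHS]invrK lef_pV2 ?posrE ?invr_gt0 // ltW // truncnS_gt.
have [|x y xy|] := @exists_time_change_unnormalized k K m%:R^-1 e1 eta m _ e10 eta0 k0 dK.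
- by rewrite invr_gt0.
- by apply: uk0; apply: le_trans mh.
rewrite divff ?gt_eqF // => T [z [dz [[T0 Tl Tu] sz z1 [z2 z2'] z3]]].
have st : smooth_step 0 T z dz by split=> // t; have [] := z3 t.
have Tp : 0 < T by rewrite (lt_le_trans e10) // -[leLHS]mul1r.
have ba : 0 < b - a by rewrite subr_gt0.
pose c := T / (b - a).
have c0 : 0 < c by rewrite divr_gt0.
exists (fun t => z (c * t + - (c * a))), (fun t => c * dz (c * t + - (c * a))); split.
  have := smooth_step_affine (- (c * a)) c0 st.
  have cn : c != 0 by rewrite gt_eqF.
  have ban : b - a != 0 by rewrite gt_eqF.
  have -> : (0 - - (c * a)) / c = a by field.
  have -> : (T - - (c * a)) / c = b; last by [].
  have {1}-> : T = c * (b - a) by rewrite divfK.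
  by field.
move=> t; have [_ _ H] := z3 (c * t + - (c * a)).
rewrite -mulrA; apply: (@le_trans _ _ (c * (1 + eta))).
  by rewrite ler_wpM2l // ltW.
rewrite /c mulrAC ler_wpM2r // ?invr_ge0 ?(ltW ba) // -/I.
have : T <= I + eps / 2 by move: Tu; rewrite -/I /e1; lra.
by move=> TI; have : T * (1 + eta) <= (I + eps / 2) * (1 + eta); [rewrite ler_wpM2r // addr_ge0 // ltW|nra].
Qed.
End Reparametrization.

(** * Iterated integrals of continuous functions with compact support *)

Section IteratedIntegral.
Context {R : realType}.

Lemma continuous_atP (V W : normedModType R) (f : V -> W) (x : V) :
  {for x, continuous f} <->
  forall e, 0 < e -> exists2 d, 0 < d & forall y, `|y - x| < d -> `|f y - f x| < e.
Proof.
split=> [cf e e0|H].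
  have /cvgrPdist_lt/(_ e e0)/nbhs_ballP[d /= d0 Hd] := cf.
  by exists d => // y yx; rewrite distrC; apply: Hd; rewrite -ball_normE /= distrC.
apply/cvgrPdist_lt => e e0; have [d d0 Hd] := H e e0.
apply/nbhs_ballP; exists d => // y; rewrite -ball_normE /= distrC => yx.
by rewrite distrC; exact: Hd.
Qed.

Lemma rV_norm_le k (v : 'rV[R]_k) (B : R) : 0 <= B ->
  (`|v| <= B) <-> forall i, `|v 0 i| <= B.
Proof.
move=> B0; rewrite [X in X <= B]/Num.norm /= mx_normrE; split=> [vB i|H].
  apply: le_trans vB; apply/bigmax_geP; right; exists (0, i) => //.
by apply: bigmax_le => // -[i j] _ /=; rewrite ord1.
Qed.

Local Notation cons t v := (row_mx (const_mx t : 'rV[_]_1) v).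

Lemma cons_norm_le k (t : R) (v : 'rV[R]_k) (B : R) : 0 <= B ->
  (`|cons t v : 'rV_(k.+1)| <= B) <-> (`|t| <= B /\ `|v| <= B).
Proof.
move=> B0; split=> [/(rV_norm_le _ B0) H|[tB /(rV_norm_le _ B0) vB]].
  split; first by have := H (lshift k (0 : 'I_1)); rewrite (@row_mxEl _ _ 1) mxE.
  by apply/(rV_norm_le _ B0) => i; have := H (rshift 1 i); rewrite (@row_mxEr _ _ 1).
apply/(rV_norm_le _ B0) => i; rewrite -(@splitK 1 k i); case: (@fintype.split 1 k i) => j /=.
  by rewrite (@row_mxEl _ _ 1) mxE.
by rewrite (@row_mxEr _ _ 1).
Qed.

Lemma cons_sub k (s t : R) (v w : 'rV[R]_k) :
  (cons s v : 'rV_(k.+1)) - cons t w = cons (s - t) (v - w).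
Proof.
rewrite (@opp_row_mx _ 1 1 k) (@add_row_mx _ 1 1 k).
by have -> : const_mx s - const_mx t = const_mx (s - t) :> 'M[R]_1
  by apply/matrixP => i j; rewrite !mxE.
Qed.

Definition compactly_supported k (B : R) (f : 'rV[R]_k -> R) :=
  continuous f /\ forall v, f v != 0 -> `|v| <= B.

Lemma slice_compactly_supported k B (f : 'rV[R]_k.+1 -> R) t : 0 <= B ->
  compactly_supported B f -> compactly_supported B (fun v : 'rV_k => f (cons t v)).
Proof.
move=> B0 [cf fB]; split=> [|v /fB/(cons_norm_le _ _ B0)[]//].
suff H (v : 'rV[R]_k) : {for v, continuous (fun w => f (cons t w))} by exact: H.
apply/continuous_atP => e e0; have [d d0 H] := (continuous_atP _ _).1 (cf (cons t v)) e e0.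
exists (d / 2); first exact: divr_gt0.
move=> w wv; apply: H; rewrite cons_sub.
apply: (@le_lt_trans _ _ (d / 2)); last by rewrite ltr_pdivrMr // ltr_pMr // ltr1n.
by apply/cons_norm_le; rewrite ?divr_ge0 ?(ltW d0) // subrr normr0 (ltW wv) divr_ge0 // ltW.
Qed.

(** Uniform continuity holds over the compact ball of radius [B], and outside it both slices
    vanish. *)
Lemma slice_uniform k B (f : 'rV[R]_k.+1 -> R) t e : 0 <= B -> 0 < e ->
  compactly_supported B f -> exists2 d, 0 < d & forall s, `|s - t| < d ->
    forall v : 'rV_k, `|f (cons s v) - f (cons t v)| <= e.
Proof.
move=> B0 e0 [cf fB].
have cK : compact [set v : 'rV[R]_k | `|v| <= B].
  apply: bounded_closed_compact.
    by exists B; split=> [|x Bx v /le_trans]; [exact: num_real|apply; exact: ltW].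
  have -> : [set v : 'rV[R]_k | `|v| <= B] = (fun v => `|v|) @^-1` [set x | x <= B] by [].
  by apply: closed_comp => [v _|]; [exact: norm_continuous|exact: closed_le].
have [||d d0 H] := @compact_uniform R _ _ (fun d v => forall s, `|s - t| < d ->
    `|f (cons s v) - f (cons t v)| <= e) cK.
- by move=> d d' y _ dd' H s sd; apply: H; exact: lt_le_trans dd'.
- move=> v _; have e20 : 0 < e / 2 by rewrite divr_gt0.
  have [r r0 H] := (continuous_atP _ _).1 (cf (cons t v)) _ e20.
  have r20 : 0 < r / 2 by rewrite divr_gt0.
  have rr : r / 2 < r by rewrite ltr_pdivrMr // ltr_pMr // ltr1n.
  exists (r / 2) => //; apply/nbhs_ballP; exists (r / 2) => // w.
  rewrite -ball_normE /= distrC => wv s st.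
  have G s' : `|s' - t| <= r / 2 -> `|f (cons s' w) - f (cons t v)| < e / 2.
    move=> s't; apply: H; apply: le_lt_trans rr.
    rewrite cons_sub; apply/cons_norm_le; first exact: ltW.
    by split=> //; exact: ltW.
  rewrite -(subrK (f (cons t v)) (f (cons s w))) -addrA (splitr e).
  apply: (le_trans (ler_normD _ _)); apply: lerD.
    by rewrite ltW // G // ltW.
  by rewrite distrC ltW // G // subrr normr0 ltW.
- exists d => // s sd v; have [vB|vB] := leP `|v| B; first exact: H.
  have z u : f (cons u v) = 0.
    apply/eqP; apply: contraPT vB => /fB/(cons_norm_le _ _ B0)[_].
    by rewrite leNgt => /negP.
  by rewrite !z subrr normr0 ltW.
Qed.

Lemma support_zero k (B : R) : compactly_supported B (fun _ : 'rV[R]_k => 0 : R).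
Proof.
split=> [|v]; last by rewrite eqxx.
suff H (v : 'rV[R]_k) : {for v, continuous (fun=> 0 : R)} by exact: H.
by apply/continuous_atP => e e0; exists 1 => // y _; rewrite subrr normr0.
Qed.

Lemma support_add k B (f g : 'rV[R]_k -> R) : compactly_supported B f ->
  compactly_supported B g -> compactly_supported B (fun v => f v + g v).
Proof.
move=> [cf fB] [cg gB]; split=> [|v].
  suff H (v : 'rV[R]_k) : {for v, continuous (fun v => f v + g v)} by exact: H.
  by apply: continuousD; [exact: cf|exact: cg].
have [->|/fB//] := eqVneq (f v) 0; rewrite add0r; exact: gB.
Qed.

Lemma support_scale k B a (f : 'rV[R]_k -> R) : compactly_supported B f ->
  compactly_supported B (fun v => a * f v).
Proof.
move=> [cf fB]; split=> [|v].
  suff H (v : 'rV[R]_k) : {for v, continuous (fun v => a * f v)} by exact: H.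
  by apply: (@cvgM _ _ (nbhs v)); [exact: cvg_cst|exact: (cf v)].
by rewrite mulf_eq0 negb_or => /andP[_ /fB].
Qed.

(** The properties are proved together, since additivity, homogeneity and the bound in dimension [k]
    make the integral over a slice continuous in its first coordinate. It is therefore integrable
    over [-B, B], outside which it is 0, and the rules for one-dimensional integrals apply. *)
Lemma iterated_integral_theory k (B : R) : 0 <= B ->
  [/\ forall f g : 'rV[R]_k -> R, compactly_supported B f -> compactly_supported B g ->
        iterated_integral (fun v => f v + g v) = iterated_integral f + iterated_integral g,
      forall a (f : 'rV[R]_k -> R), compactly_supported B f ->
        iterated_integral (fun v => a * f v) = a * iterated_integral f,
      forall f : 'rV[R]_k -> R, (forall v, 0 <= f v) -> 0 <= iterated_integral f &
      forall (f : 'rV[R]_k -> R) (M : R), compactly_supported B f ->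
        (forall v, `|f v| <= M) -> `|iterated_integral f| <= (2 * B) ^+ k * M].
Proof.
move=> B0; elim: k => [|k [IHD IHZ IHP IHB]].
  by split=> //= f M _ H; rewrite expr0 mul1r.
pose G (f : 'rV[R]_k.+1 -> R) (t : R) := iterated_integral (fun v : 'rV_k => f (cons t v)).
have Gc f : compactly_supported B f -> continuous (G f).
  move=> Cf t; apply/cvgrPdist_le => e e0.
  pose D := (2 * B) ^+ k + 1.
  have D0 : 0 < D by rewrite ltr_wpDl // exprn_ge0 // mulr_ge0.
  have [|d d0 H] := @slice_uniform k B f t (e / D) B0 _ Cf; first exact: divr_gt0.
  near=> s; have st : `|s - t| < d.
    near: s; apply: cvgr_distC_lt => //; exact: cvg_id.
  have -> : G f t - G f s = iterated_integral (fun v : 'rV_k => f (cons t v) + -1 * f (cons s v)).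
    rewrite IHD; [|exact: slice_compactly_supported|].
      by rewrite IHZ ?mulN1r //; exact: slice_compactly_supported.
    exact/support_scale/slice_compactly_supported.
  apply: (le_trans (IHB _ (e / D) _ _)).
  - apply: support_add; first exact: slice_compactly_supported.
    exact/support_scale/slice_compactly_supported.
  - by move=> v; rewrite mulN1r distrC H.
  - by rewrite mulrA ler_pdivrMr // mulrC ler_wpM2l ?(ltW e0) // /D lerDl.
have Gz f t : compactly_supported B f -> B < `|t| -> G f t = 0.
  move=> [_ fB] Bt; have -> : G f t = iterated_integral (fun v : 'rV[R]_k => 0 : R).
    congr iterated_integral; apply/funext => v; apply/eqP.
    apply: contraPT Bt => /fB/(cons_norm_le _ _ B0)[tB _].
    by apply/negP; rewrite -leNgt.
  apply/eqP; rewrite -normr_le0; apply: (le_trans (IHB _ 0 _ _)).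
  - exact: support_zero.
  - by move=> v; rewrite normr0.
  - by rewrite mulr0.
have GI f : compactly_supported B f -> iterated_integral f =
    \int[lebesgue_measure]_(t in `[- B, B]) G f t.
  move=> Cf; rewrite [RHS]Rintegral_mkcond /=; apply: eq_Rintegral => t _.
  rewrite patchE; case: ifPn => //; rewrite notin_setE /= in_itv /= -ler_norml => /negP.
  by rewrite -ltNge; exact: Gz.
have Gi f : compactly_supported B f ->
    lebesgue_measure.-integrable `[- B, B] (EFin \o G f).
  move=> Cf; apply: continuous_compact_integrable; first exact: segment_compact.
  exact/continuous_subspaceT/Gc.
have mB : measurable (`[- B, B]%classic : set (measurableTypeR R)) by exact: measurable_itv.
split=> [f g Cf Cg|a f Cf|f f0|f M Cf fM].
- rewrite !GI //; last exact: support_add.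
  rewrite -RintegralD //; try exact: Gi.
  by apply: eq_Rintegral => t _; rewrite /G IHD //; exact: slice_compactly_supported.
- rewrite !GI //; last exact: support_scale.
  rewrite -RintegralZl //; try exact: Gi.
  by apply: eq_Rintegral => t _; rewrite /G IHZ //; exact: slice_compactly_supported.
- by apply: Rintegral_ge0 => t _; exact: IHP.
- rewrite GI //; apply: (le_trans (le_normr_Rintegral _ (Gi _ Cf))) => //.
  have cM (c : R) : lebesgue_measure.-integrable `[- B, B] (EFin \o (fun=> c)).
    apply: continuous_compact_integrable; first exact: segment_compact.
    by apply: continuous_subspaceT => x; exact: cvg_cst.
  apply: (@le_trans _ _ (\int[lebesgue_measure]_(t in `[- B, B]) ((2 * B) ^+ k * M))).
    apply: le_Rintegral => //; last first.
      by move=> t _; apply: IHB => //; exact: slice_compactly_supported.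
    apply: continuous_compact_integrable; first exact: segment_compact.
    by apply: continuous_subspaceT => x; apply: continuous_comp; [exact: Gc|exact: norm_continuous].
  rewrite Rintegral_cst //= lebesgue_measure_itv /= lte_fin.
  case: ifPn => [_|]; first by rewrite /= exprS; lra.
  rewrite -leNgt => BB; have -> : B = 0 by lra.
  by rewrite /= !mulr0 expr0n /= mul0r.
Unshelve. all: by end_near. Qed.
End IteratedIntegral.

(** * The mean against the contact volume and the norm of functions on [M] *)

Section CkAlgebra.
Context {R : realType}.

Lemma Ck_coord (V : normedModType R) k (p : nat) (U : set V) (f : V -> 'rV[R]_p) i : open U ->
  Ck k U f -> Ck k U (fun x => f x 0 i).
Proof.
have lc : linear ((fun x : 'rV[R]_p => x 0 i) : 'rV[R]_p -> R^o).
  by move=> a u v; rewrite !mxE.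
pose L : {linear 'rV[R]_p -> R^o} :=
  HB.pack (fun x : 'rV[R]_p => x 0 i) (GRing.isLinear.Build _ _ _ _ _ lc).
have cL : continuous L by exact: coord_continuous.
by move=> oU Cf; exact: (Ck_linear oU cL Cf).
Qed.

Lemma Ck_mul (V : normedModType R) k (U : set V) (f h : V -> R) : open U ->
  Ck k U f -> Ck k U h -> Ck k U (fun x => f x * h x).
Proof. exact: Ck_scaler. Qed.

Lemma Ck_bigsum (V W : normedModType R) (I : eqType) (r : seq I) k (U : set V) (f : I -> V -> W) : open U ->
  (forall i, Ck k U (f i)) -> Ck k U (fun x => \sum_(i <- r) f i x).
Proof.
move=> oU Cf; elim: r => [|a r IH].
  by apply: Ck_eq (Ck_cst k U 0) => // x _; rewrite big_nil.
by apply: Ck_eq (Ck_add oU (Cf a) IH) => // x _; rewrite big_cons.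
Qed.

Lemma Ck_bigprod (V : normedModType R) (I : eqType) (r : seq I) k (U : set V) (f : I -> V -> R) : open U ->
  (forall i, Ck k U (f i)) -> Ck k U (fun x => \prod_(i <- r) f i x).
Proof.
move=> oU Cf; elim: r => [|a r IH].
  by apply: Ck_eq (Ck_cst k U (1 : R)) => // x _; rewrite big_nil.
by apply: Ck_eq (Ck_mul oU (Cf a) IH) => // x _; rewrite big_cons.
Qed.

End CkAlgebra.

Section Charts.
Context {R : realType} {d : nat} {M : topologicalType}.
Local Notation E := 'rV[R]_d.+1.
Local Notation chart := (chart R d M).

Lemma cinv_cont (c : chart) y : img c y -> {for y, continuous (cinv c)}.
Proof.
move=> iy; have := @cinv_continuous _ _ _ c.
rewrite (continuous_open_subspace _ (@img_open _ _ _ c)).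
by move/(_ y); apply; rewrite inE.
Qed.

Lemma coord_cont (c : chart) x : dom c x -> {for x, continuous (c : M -> E)}.
Proof.
move=> iy; have := @Defs.coord_continuous _ _ _ c.
rewrite (continuous_open_subspace _ (@dom_open _ _ _ c)).
by move/(_ x); apply; rewrite inE.
Qed.

Lemma cinvK (c : chart) y : img c y -> c (cinv c y) = y.
Proof. by move=> [x dx <-]; rewrite coordK. Qed.

Lemma cinv_dom (c : chart) y : img c y -> dom c (cinv c y).
Proof. by move=> [x dx <-]; rewrite coordK. Qed.

Lemma coord_img (c : chart) x : dom c x -> img c (c x).
Proof. by move=> dx; exists x. Qed.

Lemma open_img (c : chart) : open (img c).
Proof. exact: img_open. Qed.

End Charts.

Section Mean.
Context {R : realType} {n : nat} {M : topologicalType}.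
Local Notation E := 'rV[R]_((n.*2).+1).
Local Notation chart := (chart R n.*2 M).
Context (A : set chart) (alpha : chart -> E -> E).
Hypothesis hM : closed_connected_manifold A.
Hypothesis halpha : contact_form A alpha.

Lemma smooth_volume_coef c k : A c -> Ck k (img c) (volume_coef alpha c).
Proof.
move=> Ac; have oU : open (img c) := @img_open _ _ _ c; have sa := halpha.1.1 c Ac.
have Ca j k' : Ck k' (img c) (fun y => alpha c y 0 j).
  exact: (Ck_coord _ oU (sa k')).
have Cd i j : Ck k (img c) (fun y => dform alpha c y i j).
  have Cp i' j' : Ck k (img c) (fun y => partial i' (fun z => alpha c z 0 j') y).
    exact: ((Ca j' k.+1).2 _).2.
  by apply: Ck_add => //; apply: Ck_opp.
rewrite /volume_coef; apply: Ck_mul => //; first exact: Ck_cst.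
apply: Ck_bigsum => // s; apply: Ck_mul => //; first apply: Ck_mul => //.
  exact: Ck_cst.
exact: Ck_bigprod.
Qed.

Definition nu_integrand (p : chart * (M -> R)) (f : M -> R) (y : E) : R :=
  if y \in img p.1
  then p.2 (cinv p.1 y) * f (cinv p.1 y) * `|volume_coef alpha p.1 y| else 0.

(** Support is controlled by the partition function [p.2], so one radius serves all [f]. Its support
    is compact inside the chart domain, which makes the extension by 0 outside the chart image
    continuous. *)
Lemma nu_integrand_support (p : chart * (M -> R)) : A p.1 -> smooth_function A p.2 ->
  closure [set x | p.2 x != 0] `<=` dom p.1 ->
  exists2 B : R, 0 <= B & forall f, continuous f -> compactly_supported B (nu_integrand p f).
Proof.
move=> Ap sp sd; have [_ cM HM _ _] := hM.
pose K := p.1 @` closure [set x | p.2 x != 0].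
have cK : compact K.
  apply: continuous_compact.
    by apply: continuous_subspaceW sd _; exact: Defs.coord_continuous.
  apply: (subclosed_compact _ cM) => //; exact: closed_closure.
have clK : closed K by apply: compact_closed cK; exact: norm_hausdorff.
have [B0 [_ HB]] := compact_bounded cK.
have KB y : K y -> `|y| <= `|B0| + 1.
  by apply: HB; rewrite (le_lt_trans (ler_norm B0)) // ltrDl.
exists (`|B0| + 1) => [|f cf]; first by rewrite addr_ge0.
have nK y : ~ K y -> nu_integrand p f y = 0.
  rewrite /nu_integrand; case: ifPn => // /set_mem iy nKy.
  have [->|nz] := eqVneq (p.2 (cinv p.1 y)) 0; first by rewrite !mul0r.
  case: nKy; exists (cinv p.1 y); last by rewrite cinvK.
  exact: subset_closure.
split=> [|y]; last first.
  by move=> nz; apply: KB; apply: contrapT => /nK e; rewrite e eqxx in nz.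
suff H (y : E) : {for y, continuous (nu_integrand p f)} by exact: H.
have [iy|niy] := pselect (img p.1 y).
  apply: (@near_eq_continuous _ _
    (fun y => p.2 (cinv p.1 y) * f (cinv p.1 y) * `|volume_coef alpha p.1 y|)).
    apply: filterS (open_nbhs_nbhs (conj (@img_open _ _ _ p.1) iy)) => z iz.
    by rewrite /nu_integrand mem_set.
  apply: continuousM; first apply: continuousM.
  - exact: (Ck_cont (sp _ Ap 0%N) iy).
  - by apply: continuous_comp; [exact: cinv_cont|exact: cf].
  - apply: continuous_comp; last exact: norm_continuous.
    exact: (Ck_cont (smooth_volume_coef 0 Ap) iy).
apply: (@near_eq_continuous _ _ (cst 0)); last exact: cst_continuous.
have oK : open_nbhs y (~` K).
  split; first exact: closed_openC.
  by move=> -[x /sd dx e]; apply: niy; rewrite -e; exact: coord_img.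
by apply: filterS (open_nbhs_nbhs oK) => z /nK ->.
Qed.

Lemma nu_integralE f : nu_integral A alpha f =
  \sum_(p <- chosen_partition A) iterated_integral (nu_integrand p f).
Proof. by []. Qed.

(** In the default case of [xget] the list is empty and the claim is vacuous. *)
Lemma chosen_partitionP p : p \in chosen_partition A ->
  [/\ A p.1, smooth_function A p.2, forall x, 0 <= p.2 x
       & closure [set x | p.2 x != 0] `<=` dom p.1].
Proof. by rewrite /chosen_partition; case: xgetP => // s _ [+ _]; apply. Qed.

Lemma nu_integral_linear a (f h : M -> R) : continuous f -> continuous h ->
  nu_integral A alpha (fun x => f x + a * h x) =
  nu_integral A alpha f + a * nu_integral A alpha h.
Proof.
move=> cf ch; rewrite !nu_integralE mulr_sumr -big_split.
rewrite !big_seq; apply: eq_bigr => p /chosen_partitionP[Ap sp _ sd].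
have [B B0 HB] := nu_integrand_support Ap sp sd.
have [hD hZ _ _] := @iterated_integral_theory R n.*2.+1 B B0.
rewrite -[RHS]/(_ + _) -hZ; last exact: HB.
rewrite -hD; [|exact: HB|by apply: support_scale; exact: HB].
congr iterated_integral; apply/funext => y; rewrite /nu_integrand.
by case: ifPn => _; [ring|rewrite mulr0 addr0].
Qed.

Lemma nu_integral_ge0 f : (forall x, 0 <= f x) -> 0 <= nu_integral A alpha f.
Proof.
move=> f0; rewrite nu_integralE big_seq sumr_ge0 // => p /chosen_partitionP[Ap sp p0 sd].
have [_ _ hP _] := @iterated_integral_theory R n.*2.+1 0 (lexx 0).
apply: hP => y; rewrite /nu_integrand; case: ifPn => // _.
by rewrite !mulr_ge0.
Qed.

Lemma mean_linear a (f h : M -> R) : continuous f -> continuous h ->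
  mean A alpha (fun x => f x + a * h x) = mean A alpha f + a * mean A alpha h.
Proof. by move=> cf ch; rewrite /mean nu_integral_linear //; ring. Qed.

Lemma mean_ge0 f : (forall x, 0 <= f x) -> 0 <= mean A alpha f.
Proof. by move=> f0; rewrite mulr_ge0 ?invr_ge0 ?nu_integral_ge0. Qed.

Lemma mean_le (f h : M -> R) : continuous f -> continuous h ->
  (forall x, f x <= h x) -> mean A alpha f <= mean A alpha h.
Proof.
move=> cf ch fh; rewrite -subr_ge0.
have -> : mean A alpha h - mean A alpha f = mean A alpha (fun x => h x + -1 * f x).
  by rewrite mean_linear // mulN1r.
by apply: mean_ge0 => x; rewrite mulN1r subr_ge0.
Qed.

Lemma mean_cst c : mean A alpha (fun=> c) = c * mean A alpha (fun=> 1).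
Proof.
have := @mean_linear (c - 1) (fun=> 1) (fun=> 1) (fun x => cvg_cst _) (fun x => cvg_cst _).
have -> : (fun _ : M => 1 + (c - 1) * 1) = (fun=> c) by apply/funext => x; ring.
by move=> ->; ring.
Qed.

(** The inverse of 0 is 0: if the total volume is 0, every mean is 0. The estimates of the mean hold
    in either case. *)
Lemma mean1 : mean A alpha (fun=> 1) = 1 \/ forall f, mean A alpha f = 0.
Proof.
rewrite /mean; have [->|nz] := eqVneq (nu_integral A alpha (fun=> 1)) 0.
  by right => f; rewrite invr0 mul0r.
by left; rewrite mulVf.
Qed.

Lemma mean_bound (f : M -> R) (B : R) : continuous f -> (forall x, `|f x| <= B) ->
  `|mean A alpha f| <= B.
Proof.
move=> cf fB; have [_ _ _ _ [x0 _]] := hM.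
have B0 : 0 <= B by exact: le_trans (fB x0).
have cc c : continuous (fun _ : M => c : R) by move=> x; exact: cvg_cst.
have [m1|->] := mean1; last by rewrite normr0.
rewrite ler_norml -[X in - X <= _]mulr1 -[X in _ <= _ <= X]mulr1 -m1 -mulNr -!mean_cst.
by rewrite !mean_le // => x; have := fB x; rewrite ler_norml => /andP[].
Qed.

End Mean.

Section HamiltonianNorm.
Context {R : realType} {n : nat} {M : topologicalType}.
Local Notation E := 'rV[R]_((n.*2).+1).
Local Notation chart := (chart R n.*2 M).
Context (A : set chart) (alpha : chart -> E -> E).
Hypothesis hM : closed_connected_manifold A.
Hypothesis halpha : contact_form A alpha.
Implicit Types (f h : M -> R).

Lemma continuous_bounded f : continuous f -> exists B : R, forall x, `|f x| <= B.
Proof.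
have [_ cM _ _ [x0 _]] := hM.
move=> cf; have [|||c _ H] := @compact_EVT_max M R (fun x => `|f x|) setT.
- by exists x0.
- exact: cM.
- by apply: continuous_subspaceT => x; apply: continuous_comp;
    [exact: cf|exact: norm_continuous].
- by exists `|f c| => x; apply: H; rewrite inE.
Qed.

Lemma osc_ub f x y : continuous f -> f x - f y <= sup (range f) - inf (range f).
Proof.
move=> cf; have [B HB] := continuous_bounded cf.
apply: lerB.
  apply: ub_le_sup; last by exists x.
  by exists B => _ [z _ <-]; apply: le_trans (HB z); exact: ler_norm.
apply: ge_inf; last by exists y.
exists (- B) => _ [z _ <-].
by have := HB z; rewrite ler_norml => /andP[].
Qed.

Lemma osc_le f D : continuous f -> (forall x y, f x - f y <= D) ->
  sup (range f) - inf (range f) <= D.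
Proof.
have [_ _ _ _ [x0 _]] := hM.
move=> cf H; rewrite lerBlDr.
apply: ge_sup; first by exists (f x0), x0.
move=> _ [x _ <-]; rewrite -lerBlDl.
apply: lb_le_inf; first by exists (f x0), x0.
by move=> _ [y _ <-]; have := H x y; lra.
Qed.

Lemma hnorm_diff f x y : continuous f -> f x - f y <= hnorm A alpha f.
Proof. by move=> cf; rewrite ler_wpDr // osc_ub. Qed.

Lemma hnorm_ge0 f : continuous f -> 0 <= hnorm A alpha f.
Proof.
have [_ _ _ _ [x0 _]] := hM.
by move=> cf; have := hnorm_diff x0 x0 cf; rewrite subrr.
Qed.

Lemma continuous_lincomb a f h : continuous f -> continuous h ->
  continuous (fun x => f x + a * h x).
Proof.
move=> cf ch x; apply: (@cvgD R R _ (nbhs x)); first exact: cf.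
by apply: (@cvgM R _ (nbhs x)); [exact: cvg_cst|exact: ch].
Qed.

Lemma hnorm_lincomb a f h : continuous f -> continuous h ->
  hnorm A alpha (fun x => f x + a * h x) <=
  hnorm A alpha f + `|a| * hnorm A alpha h.
Proof.
move=> cf ch; rewrite /hnorm mean_linear // mulrDr addrACA; apply: lerD; last first.
  by apply: (le_trans (ler_normD _ _)); rewrite (normrM a).
apply: osc_le; first exact: continuous_lincomb.
move=> x y; have -> : f x + a * h x - (f y + a * h y) = (f x - f y) + a * (h x - h y) by ring.
apply: lerD; first exact: osc_ub.
apply: (le_trans (ler_norm _)); rewrite normrM ler_wpM2l // ler_norml osc_ub // andbT.
by rewrite lerNl opprB osc_ub.
Qed.

Lemma hnorm0 : hnorm A alpha (fun=> 0) = 0.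
Proof.
have c0 : continuous (fun _ : M => 0 : R) by move=> x; exact: cvg_cst.
apply: le_anti; rewrite hnorm_ge0 // andbT /hnorm (mean_cst hM halpha) mul0r normr0 addr0.
by apply: osc_le => // x y; rewrite subrr.
Qed.

Lemma hnormZ a f : continuous f -> hnorm A alpha (fun x => a * f x) <= `|a| * hnorm A alpha f.
Proof.
move=> cf; have c0 : continuous (fun _ : M => 0 : R) by move=> x; exact: cvg_cst.
have := hnorm_lincomb a c0 cf; rewrite hnorm0 add0r.
by under eq_fun do rewrite add0r.
Qed.

Lemma hnorm_sub f h : continuous f -> continuous h ->
  hnorm A alpha (fun x => f x - h x) <= hnorm A alpha f + hnorm A alpha h.
Proof.
move=> cf ch; have := hnorm_lincomb (-1) cf ch; rewrite normrN1 mul1r.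
by under eq_fun do rewrite mulN1r.
Qed.

Lemma hnorm_le_bound f B : continuous f -> (forall x, `|f x| <= B) ->
  hnorm A alpha f <= 3 * B.
Proof.
move=> cf fB; have H : sup (range f) - inf (range f) <= 2 * B.
  apply: osc_le => // x y; have := fB x; have := fB y; rewrite !ler_norml.
  by move=> /andP[? ?] /andP[? ?]; lra.
have := mean_bound hM halpha cf fB; rewrite /hnorm; lra.
Qed.

(* The mean of [f \o phi] is not compared with that of [f] by invariance of the
   volume: |f| is bounded by the norm of [f], whence the factor 2. *)
Lemma hnorm_comp f (phi : M -> M) : continuous f -> continuous phi ->
  hnorm A alpha (f \o phi) <= 2 * hnorm A alpha f.
Proof.
move=> cf cphi; have cfp : continuous (f \o phi).
  by move=> x; apply: continuous_comp; [exact: cphi|exact: cf].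
have O : sup (range (f \o phi)) - inf (range (f \o phi)) <= sup (range f) - inf (range f).
  by apply: osc_le => // x y; exact: (osc_ub (phi x) (phi y) cf).
have [m1|m0] := mean1 A alpha; last first.
  by move: O (hnorm_ge0 cf); rewrite /hnorm !m0 normr0; lra.
have fb x : `|f x| <= hnorm A alpha f.
  rewrite -(subrK (mean A alpha f) (f x)) (le_trans (ler_normD _ _)) // lerD2r.
  have cc : continuous (fun _ : M => f x) by move=> y; exact: cvg_cst.
  have -> : f x - mean A alpha f = mean A alpha (fun y => f x + -1 * f y).
    by rewrite mean_linear // mulN1r (mean_cst hM halpha) m1 mulr1.
  apply: (mean_bound hM halpha); first exact: continuous_lincomb.
  by move=> y; rewrite mulN1r ler_norml osc_ub // andbT lerNl opprB osc_ub.
have := mean_bound hM halpha cfp (fun x => fb (phi x)).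
have : 0 <= `|mean A alpha f| by [].
by move: O; rewrite /hnorm; lra.
Qed.

End HamiltonianNorm.

(** * Piecewise smooth paths and the Riemannian distance *)

Section RiemannianDistance.
Context {R : realType} {d : nat} {M : topologicalType}.
Local Notation E := 'rV[R]_d.+1.
Local Notation chart := (chart R d M).
Context (A : set chart) (g : chart -> E -> 'M[R]_d.+1).
Hypothesis hM : closed_connected_manifold A.
Hypothesis hg : riemannian_metric A g.

Lemma open_overlap (c c' : chart) : open (c @` (dom c `&` dom c')).
Proof.
have -> : c @` (dom c `&` dom c') = img c `&` cinv c @^-1` dom c'.
  apply/seteqP; split=> [_ [x [dx dx'] <-]|y [iy dy]].
    by split; [exact: coord_img|rewrite /= coordK].
  exists (cinv c y); last exact: cinvK.
  by split=> //; exact: cinv_dom.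
rewrite openE => y [iy dy]; apply: (@filterI _ (nbhs y)).
  by apply: open_nbhs_nbhs; split=> //; exact: open_img.
by apply: (cinv_cont iy); apply: open_nbhs_nbhs; split=> //; exact: dom_open.
Qed.

Lemma overlapP (c c' : chart) y : (c @` (dom c `&` dom c')) y <-> img c y /\ dom c' (cinv c y).
Proof.
split=> [[x [dx dx'] <-]|[iy dy]]; first by split; [exact: coord_img|rewrite coordK].
by exists (cinv c y); [split=> //; exact: cinv_dom|exact: cinvK].
Qed.

Definition quad (G : 'M[R]_d.+1) (v : E) : R := (v *m G *m v^T) 0 0.

Lemma quadE G v : quad G v = \sum_j \sum_i v 0 i * G i j * v 0 j.
Proof.
rewrite /quad mxE; apply: eq_bigr => j _; rewrite !mxE mulr_suml.
by apply: eq_bigr => i _.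
Qed.

Lemma continuous_big_sum (T : topologicalType) (I : finType) (f : I -> T -> R) (x : T) :
  (forall i, {for x, continuous (f i)}) -> {for x, continuous (fun t => \sum_i f i t)}.
Proof.
move=> cf; have -> : (fun t => \sum_i f i t) = \sum_i f i.
  by apply/funext => t; rewrite fct_sumE.
elim/big_ind: _ => [|p q cp cq|i _]; [exact: cst_continuous| |exact: cf].
exact: (@cvgD R R _ (nbhs x)).
Qed.

Lemma continuous_quad (T : topologicalType) (a : T -> E) (G : T -> 'M[R]_d.+1) (x : T) :
  {for x, continuous a} -> {for x, continuous G} ->
  {for x, continuous (fun t => quad (G t) (a t))}.
Proof.
move=> ca cG; have -> : (fun t => quad (G t) (a t)) =
    (fun t => \sum_j \sum_i a t 0 i * G t i j * a t 0 j).
  by apply/funext => t; rewrite quadE.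
have cai i : {for x, continuous (fun t => a t 0 i)}.
  by apply: (@continuous_comp _ _ _ a (fun v : E => v 0 i)) => //; exact: coord_continuous.
apply: continuous_big_sum => j; apply: continuous_big_sum => i.
apply: (@cvgM R _ (nbhs x)); last exact: cai.
apply: (@cvgM R _ (nbhs x)); first exact: cai.
by apply: (@continuous_comp _ _ _ G (fun v : 'M[R]_d.+1 => v i j)) => //; exact: coord_continuous.
Qed.

Lemma mx_entry_le m k (B : 'M[R]_(m, k)) i j : `|B i j| <= `|B|.
Proof.
rewrite [leRHS]/Num.norm /= mx_normrE; apply/bigmax_geP; right; by exists (i, j).
Qed.

Lemma quad_le G v : quad G v <= (d.+1%:R ^+ 2 * `|G|) * `|v| ^+ 2.
Proof.
rewrite quadE; apply: (@le_trans _ _ (\sum_(j < d.+1) \sum_(i < d.+1) (`|G| * `|v| ^+ 2))).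
  apply: ler_sum => j _; apply: ler_sum => i _.
  apply: (le_trans (ler_norm _)); rewrite !normrM expr2 mulrA.
  rewrite ler_pM ?mulr_ge0 ?mx_entry_le // mulrC ler_pM ?mx_entry_le //.
set X := `|G| * _; rewrite !sumr_const !card_ord -[X *+ _]mulr_natl -[(_ * X) *+ _]mulr_natl.
by rewrite /X [d.+1%:R ^+ 2]expr2 !mulrA.
Qed.

Lemma length_ge0 x y l : piecewise_length A g x y l -> 0 <= l.
Proof.
elim=> // gamma y' l0 l1 _ [speed [Hs ->]] _ l10; rewrite addr_ge0 //.
apply: Rintegral_ge0 => t; rewrite /= in_itv /= => t01.
have [[cover _] _ _ _ _] := hM; have [c cx] := cover (gamma t).
by rewrite (Hs t c t01 cx) sqrtr_ge0.
Qed.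

Lemma piecewise_cat x y z l l' : piecewise_length A g x y l ->
  piecewise_length A g y z l' -> piecewise_length A g x z (l + l').
Proof.
elim=> [w|gamma y' l0 l1 sg cl _ IH] H; first by rewrite add0r.
by rewrite -addrA; apply: piecewise_cons => //; exact: IH.
Qed.

Lemma chart_at x : exists c, at_chart A c x.
Proof. by have [[cover _] _ _ _ _] := hM; exact: cover. Qed.

Lemma transition_smooth c c' : A c -> A c' ->
  smooth_on (c @` (dom c `&` dom c')) (transition c c').
Proof. by have [[_ h] _ _ _ _] := hM; exact: h. Qed.

(** The path is straight in the chart [c], where its speed is computed. Invariance of the metric
    under transitions gives the same speed in every other chart that the path meets. *)
Lemma segment_length (c : chart) (y0 y1 : E) (C : R) : A c -> 0 <= C ->
  (forall t, 0 <= t <= 1 -> img c (y0 + t *: (y1 - y0)) /\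
     quad (g c (y0 + t *: (y1 - y0))) (y1 - y0) <= C ^+ 2) ->
  exists2 l, piecewise_length A g (cinv c y0) (cinv c y1) l & l <= C.
Proof.
move=> Ac C0 H; pose v := y1 - y0; pose L (t : R) := y0 + t *: v.
pose sp t := Num.sqrt (quad (g c (L t)) v).
have sL (U : set R) k : open U -> Ck k U L.
  move=> oU; apply: Ck_add => //; first exact: Ck_cst.
  by apply: Ck_scaler => //; [exact: Ck_id|exact: Ck_cst].
have cL : continuous L.
  by move=> t; exact: (Ck_cont (sL setT 0%N openT)).
have oI B : open B -> open (L @^-1` B) by move/continuousP: cL; apply.
have csp t : 0 <= t <= 1 -> {for t, continuous sp}.
  move=> /H[it _]; apply: continuous_comp; last exact: sqrt_continuous.
  apply: continuous_quad; first exact: cst_continuous.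
  apply: continuous_comp; first exact: cL.
  have [sg _ _ _] := hg; exact: (Ck_cont (sg c Ac 0%N) it).
pose gamma t := cinv c (L t).
have g0 : gamma 0 = cinv c y0 by rewrite /gamma /L scale0r addr0.
have g1 : gamma 1 = cinv c y1 by rewrite /gamma /L scale1r /v addrC subrK.
exists (\int[lebesgue_measure]_(t in `]0, 1[) sp t + 0); last first.
  rewrite addr0 /Rintegral -[leRHS]/(fine C%:E).
  have isp : lebesgue_measure.-integrable (`]0, 1[%classic : set (measurableTypeR R)) (EFin \o sp).
    apply: (integrableS _ _ _ (@continuous_compact_integrable R sp `[0, 1] _ _)).
    - exact: measurable_itv.
    - exact: measurable_itv.
    - by apply: subset_itv; rewrite bnd_simp.
    - exact: segment_compact.
    - by apply: continuous_in_subspaceT => t; rewrite inE /= in_itv /= => /csp.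
  have iC : lebesgue_measure.-integrable (`]0, 1[%classic : set (measurableTypeR R)) (EFin \o (cst C)).
    apply: (integrableS _ _ _ (@continuous_compact_integrable R (cst C) `[0, 1] _ _)).
    - exact: measurable_itv.
    - exact: measurable_itv.
    - by apply: subset_itv; rewrite bnd_simp.
    - exact: segment_compact.
    - by apply: continuous_subspaceT => t; exact: cvg_cst.
  have := @le_Rintegral _ _ _ lebesgue_measure `]0, 1[%classic sp (cst C) (measurable_itv _) isp iC.
  rewrite Rintegral_cst //= lebesgue_measure_itv /= lte01 oppr0 adde0 /= mulr1; apply.
  move=> t; rewrite in_itv /= => /andP[t0 t1].
  have [|_] := H t; first by rewrite !ltW.
  by move=> /ler_wsqrtr/le_trans; apply; rewrite sqrtr_sqr ger0_norm.
rewrite -g0 -g1; apply: piecewise_cons; last exact: piecewise_nil.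
  split.
    apply: continuous_in_subspaceT => t; rewrite inE /= in_itv /= => /H[it _].
    by apply: continuous_comp; [exact: cL|exact: cinv_cont].
  move=> c' Ac' t [/= t01 dt].
  exists (L @^-1` (c @` (dom c `&` dom c'))), (transition c c' \o L).
  have [|it _] := H t; first by move: t01; rewrite in_itv.
  split.
  - exact/oI/open_overlap.
  - by apply/overlapP.
  - move=> k; apply: (@Ck_comp _ _ _ _ _ _ (c @` (dom c `&` dom c'))) => //.
    + exact: fin_dim_rV.
    + exact: fin_dim_rV.
    + exact/oI/open_overlap.
    + exact: open_overlap.
    + exact: transition_smooth.
    + exact/sL/oI/open_overlap.
  - by [].
exists sp; split=> // t c' t01 [Ac' dt] v'.
have [|it _] := H t; first by case/andP: t01 => /ltW -> /ltW ->.
have dv : v' = 'D_v (transition c c') (L t).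
  have dL : is_derive t 1 L v.
    have d0 : is_derive t 1 (fun s : R => s *: v) v.
      have := is_derive_scaler (@derivable_id R R t 1) (@derivable_cst R R E v t 1).
      rewrite derive_id derive_cst scaler0 addr0 scale1r; exact.
    by have := is_deriveD (@is_derive_cst R R E y0 t 1) d0; rewrite add0r.
  have [d1 e1] := dL.
  have := @is_derive_chain R R E E (transition c c') L t 1 _ d1.
  rewrite e1 => H2; have [|_ H3] := H2; last exact: H3.
  apply: (@Ck_differentiable _ 0 _ _ (c @` (dom c `&` dom c'))).
  - exact: fin_dim_rV.
  - exact: fin_dim_rV.
  - exact: open_overlap.
  - by apply/overlapP.
  - exact: transition_smooth.
rewrite /sp /quad; congr Num.sqrt; rewrite dv.
have [_ _ _ h4] := hg.
have ci : c (gamma t) = L t by rewrite /gamma cinvK.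
have := h4 c c' (gamma t) _ _ v v; rewrite ci => ->.
- by [].
- by split=> //; exact: cinv_dom.
- by split.
Qed.

Lemma open_norm_ball (V : normedModType R) (U : set V) (x : V) : open U -> U x ->
  exists2 r, 0 < r & forall y, `|y - x| < r -> U y.
Proof.
move=> oU Ux; have /nbhs_ballP[r /= r0 H] := open_nbhs_nbhs (conj oU Ux).
by exists r => // y yx; apply: H; rewrite -ball_normE /= distrC.
Qed.

Lemma local_length (x : M) (e : R) : 0 < e -> exists2 U : set M, nbhs x U &
  forall y z, U y -> U z -> exists2 l, piecewise_length A g y z l & l < e.
Proof.
move=> e0; have [c [Ac dx]] := chart_at x.
have ix := coord_img dx.
have [sg _ _ _] := hg.
have [r1 r10 H1] := (continuous_atP _ _).1 (Ck_cont (sg c Ac 0%N) ix) 1 ltr01.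
have [r2 r20 H2] := open_norm_ball (@open_img _ _ _ c) ix.
(* [G] bounds the metric coefficients near [x], and [G <= (G + 1) ^+ 2] makes [K] a bound for the
   ratio of speed to the norm in the chart. Two points of the ball of radius [r] differ by at most
   [2 * r] in the chart, so the segment has length at most [e / 2]. *)
pose G := `|g c (c x)| + 1; pose K := d.+1%:R * (G + 1).
have G0 : 0 < G by rewrite ltr_wpDl.
have K0 : 0 < K by rewrite mulr_gt0 // addr_gt0.
pose r := Num.min (Num.min r1 r2) (e / (4 * K)).
have r0 : 0 < r by rewrite !lt_min r10 r20 divr_gt0 // mulr_gt0.
exists (dom c `&` c @^-1` ball (c x) r).
  apply: filterI; first by apply: open_nbhs_nbhs; split=> //; exact: dom_open.
  by apply: (coord_cont dx); exact: nbhsx_ballx.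
move=> y z [dy]; rewrite -ball_normE /= => yr [dz] zr.
have [|t t01|l pl lC] := @segment_length c (c y) (c z) (K * (2 * r)) Ac.
- by apply: mulr_ge0; [exact: ltW|apply: mulr_ge0; [by []|exact: ltW]].
- have tr : `|c x - (c y + t *: (c z - c y))| < r.
    have -> : c x - (c y + t *: (c z - c y)) = (1 - t) *: (c x - c y) + t *: (c x - c z).
      by rewrite !scalerBr !scalerBl !scale1r; apply/matrixP => i j; rewrite !mxE; ring.
    case/andP: t01 => t0 t1; apply: (le_lt_trans (ler_normD _ _)).
    rewrite !normrZ (ger0_norm t0) ger0_norm ?subr_ge0 //.
    have [->|t1'] := eqVneq t 1; first by rewrite subrr mul0r add0r mul1r.
    have -> : r = (1 - t) * r + t * r by ring.
    by rewrite ltr_leD // ?ltr_pM2l ?ler_wpM2l // ?(ltW zr) // subr_gt0 lt_neqAle t1'.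
  have tr1 : `|c y + t *: (c z - c y) - c x| < r1.
    by rewrite distrC (lt_le_trans tr) // !ge_min lexx.
  have it : img c (c y + t *: (c z - c y)).
    by apply: H2; rewrite distrC (lt_le_trans tr) // !ge_min lexx orbT.
  split=> //; apply: (le_trans (quad_le _ _)).
  have gG : `|g c (c y + t *: (c z - c y))| <= G.
    have := H1 _ tr1; rewrite /G -lerBlDl => /ltW; apply: le_trans.
    by rewrite (le_trans (ler_norm _)) // ler_dist_dist.
  have vr : `|c z - c y| <= 2 * r.
    have -> : c z - c y = (c x - c y) - (c x - c z) by apply/matrixP => i j; rewrite !mxE; ring.
    by rewrite (le_trans (ler_normB _ _)) // mulr_natl mulr2n lerD // ltW.
  rewrite [leRHS]exprMn; apply: ler_pM => //.
  + rewrite /K exprMn ler_wpM2l ?exprn_ge0 //; apply: (le_trans gG).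
    by rewrite expr2; nra.
  + by rewrite lerXn2r // ?nnegrE // mulr_ge0 // ltW.
exists l; first by move: pl; rewrite !coordK.
apply: (le_lt_trans lC).
have : r <= e / (4 * K) by rewrite !ge_min lexx orbT.
have K4 : 0 < 4 * K by exact: mulr_gt0.
rewrite ler_pdivlMr // => H; have Kr := mulr_gt0 K0 r0.
have -> : K * (2 * r) = 2 * (K * r) by ring.
have {}H : 4 * (K * r) <= e by apply: le_trans H; rewrite le_eqVlt; apply/orP; left; apply/eqP; ring.
move: H Kr; move: (K * r) => Q ? ?; lra.
Qed.

(** The set of points that can be reached from [x] is open and closed because nearby points are
    joined inside a chart. This makes the infimum in [rdist] one over a nonempty set. *)
Lemma path_exists (x y : M) : exists l, piecewise_length A g x y l.
Proof.
have [_ _ _ cM _] := hM.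
pose B := [set y | exists l, piecewise_length A g x y l].
have oB : open B.
  rewrite openE => z [l pl]; have [U Uz HU] := local_length z ltr01.
  apply: (filterS _ Uz) => w Uw; have [l' pl' _] := HU z w (nbhs_singleton Uz) Uw.
  by exists (l + l'); exact: piecewise_cat pl'.
have cB : closed B.
  move=> z clz; have [U Uz HU] := local_length z ltr01.
  have [w [[l pl] Uw]] := clz U Uz.
  have [l' pl' _] := HU w z Uw (nbhs_singleton Uz).
  by exists (l + l'); exact: piecewise_cat pl'.
suff BT : B = setT by have : B y by rewrite BT.
apply: cM.
- by exists x, 0; exact: piecewise_nil.
- by exists B => //; rewrite setTI.
- by exists B => //; rewrite setTI.
Qed.

Let lengths_lb x y : has_lbound [set l | piecewise_length A g x y l].
Proof. by exists 0 => l /length_ge0. Qed.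

Lemma rdist_le x y l : piecewise_length A g x y l -> rdist A g x y <= l.
Proof. by move=> pl; apply: ge_inf => //; exact: lengths_lb. Qed.

Lemma rdist_ge0 x y : 0 <= rdist A g x y.
Proof.
have [l pl] := path_exists x y; apply: lb_le_inf; first by exists l.
by move=> l' /length_ge0.
Qed.

Lemma rdist_path x y e : rdist A g x y < e ->
  exists2 l, piecewise_length A g x y l & l < e.
Proof.
have [l0 pl0] := path_exists x y.
move=> /inf_lt[|l pl le]; last by exists l.
by exists l0.
Qed.

Lemma rdistxx x : rdist A g x x = 0.
Proof. by apply: le_anti; rewrite rdist_ge0 rdist_le //; exact: piecewise_nil. Qed.

Lemma rdist_tri x y z : rdist A g x z <= rdist A g x y + rdist A g y z.
Proof.
apply/ler_addgt0Pr => e e0; have e20 : 0 < e / 2 by rewrite divr_gt0.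
have [|l pl ll] := @rdist_path x y (rdist A g x y + e / 2); first by rewrite ltrDl.
have [|l' pl' ll'] := @rdist_path y z (rdist A g y z + e / 2); first by rewrite ltrDl.
by apply: (le_trans (rdist_le (piecewise_cat pl pl'))); lra.
Qed.

Lemma rdist_near (x : M) (e : R) : 0 < e -> exists2 U : set M, nbhs x U &
  forall y z, U y -> U z -> rdist A g y z < e.
Proof.
move=> e0; have [U Ux HU] := local_length x e0; exists U => // y z Uy Uz.
by have [l pl /(le_lt_trans (rdist_le pl))] := HU y z Uy Uz.
Qed.

End RiemannianDistance.

(** * Lower bounds for lengths: the distance induces the topology of [M] *)

Section WithinContinuity.

Lemma within_open_preimage (X Y : topologicalType) (D : set X) (f : X -> Y) (x : X) (B : set Y) :
  {within D, continuous f} -> D x -> open B -> B (f x) ->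
  exists U : set X, [/\ open U, U x & forall y, U y -> D y -> B (f y)].
Proof.
move=> cf Dx oB Bfx; have := cf x.
have nB : nbhs (f x) B by apply: open_nbhs_nbhs.
move=> /(_ B nB); rewrite /= /nbhs /= -nbhs_subspace_in // /within /= nbhsE.
by move=> [U [oU Ux] HU]; exists U; split=> // y Uy Dy; exact: HU.
Qed.

End WithinContinuity.

Section DistanceSeparates.
Context {R : realType} {d : nat} {M : topologicalType}.
Local Notation E := 'rV[R]_d.+1.
Local Notation chart := (chart R d M).
Context (A : set chart) (g : chart -> E -> 'M[R]_d.+1).
Hypothesis hM : closed_connected_manifold A.
Hypothesis hg : riemannian_metric A g.

Lemma curve_extension (gamma : R -> M) (t0 : R) : smooth_curve A gamma -> 0 <= t0 <= 1 ->
  exists c (U : set R) (G : R -> E), [/\ A c, open U, U t0, smooth_on U G &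
    forall t, U t -> 0 <= t <= 1 -> dom c (gamma t) /\ c (gamma t) = G t].
Proof.
move=> [cg sg] t01; have [c [Ac dc]] := chart_at hM (gamma t0).
have It0 : `[0, 1]%classic t0 by rewrite /= in_itv.
have [U1 [oU1 U1t HU1]] := within_open_preimage cg It0 (@dom_open _ _ _ c) dc.
have [U2 [G [oU2 U2t sG HG]]] := sg c Ac t0 (conj It0 dc).
exists c, (U1 `&` U2), G; split=> //; first exact: openI.
  by move=> k; apply: Ck_sub (sG k) => t [].
move=> t [U1t' U2t'] t01'; have It : `[0, 1]%classic t by rewrite /= in_itv.
have dt := HU1 _ U1t' It; split=> //.
by rewrite -HG.
Qed.

Lemma curve_derivative (gamma : R -> M) c (U : set R) (G : R -> E) t : open U -> smooth_on U G ->
  (forall t, U t -> 0 <= t <= 1 -> dom c (gamma t) /\ c (gamma t) = G t) ->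
  U t -> 0 < t < 1 ->
  [/\ derivable (c \o gamma) t 1, 'D_1 (c \o gamma) t = 'D_1 G t & {for t, continuous ('D_1 G)}].
Proof.
move=> oU sG H Ut /andP[t0 t1].
have nE : \near t, G t = (c \o gamma) t.
  near=> s; have Us : U s by near: s; exact: open_nbhs_nbhs.
  have [|_ e] := H s Us; last by rewrite -e.
  by apply/andP; split; near: s; [exact: lt_le_nbhsr|exact: lt_le_nbhsl].
have [_ /(_ 1)[dG cG]] := sG 1%N; split.
- exact: near_eq_derivable nE (dG t Ut).
- by apply/esym/near_eq_derive.
- exact: (cG.1 t Ut).
Unshelve. all: by end_near. Qed.

(** [speed] is prescribed in the open interval only. Near each time of [0,1], ends included, it
    agrees there with the continuous speed of a smooth extension of the curve; boundedness follows
    by compactness. *)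
Lemma speed_regular (gamma : R -> M) (speed : R -> R) : smooth_curve A gamma ->
  (forall (t : R) c, 0 < t < 1 -> at_chart A c (gamma t) ->
     speed t = Num.sqrt (quad (g c (c (gamma t))) ('D_1 (c \o gamma) t))) ->
  (forall t, 0 < t < 1 -> {for t, continuous speed}) /\
  exists B : R, forall t, 0 < t < 1 -> `|speed t| <= B.
Proof.
move=> sg Hs.
have loc (t0 : R) : 0 <= t0 <= 1 -> exists (S : R -> R) (U : set R), [/\ open U, U t0,
    {for t0, continuous S} & forall t, U t -> 0 < t < 1 -> speed t = S t].
  move=> t01; have [c [U [G [Ac oU Ut sG H]]]] := curve_extension sg t01.
  exists (fun t => Num.sqrt (quad (g c (G t)) ('D_1 G t))), U; split=> //.
    have [dt Gt] := H t0 Ut t01.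
    apply: (@continuous_comp _ _ _ (fun t => quad (g c (G t)) ('D_1 G t)));
      last exact: sqrt_continuous.
    apply: continuous_quad; first by have [_ /(_ 1)[_ cG]] := sG 1%N; exact: (cG.1 t0 Ut).
    apply: continuous_comp; first exact: (Ck_cont (sG 0%N) Ut).
    have [sm _ _ _] := hg; apply: (Ck_cont (sm c Ac 0%N)).
    by rewrite -Gt; exact: coord_img.
  move=> t Ut' t01'; have [_ Dc1 _] := curve_derivative oU sG H Ut' t01'.
  have [dt Gt] : dom c (gamma t) /\ c (gamma t) = G t.
    by apply: H => //; case/andP: t01' => /ltW -> /ltW ->.
  rewrite (Hs t c t01' (conj Ac dt)) Gt.
  by congr (Num.sqrt (quad _ _)).
split=> [t t01|].
  have [|S [U [oU Ut cS HS]]] := loc t; first by case/andP: t01 => /ltW -> /ltW ->.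
  have /andP[t0 t1] := t01.
  apply: near_eq_continuous cS; near=> s; rewrite HS //.
    by near: s; exact: open_nbhs_nbhs.
  apply/andP; split; near: s; [exact: lt_nbhsr|exact: lt_nbhsl].
(* The bound is the inverse of the threshold, so that shrinking the threshold weakens the claim. *)
have [||e e0 He] := @compact_uniform R R `[0, 1]
    (fun e t => 0 < t < 1 -> `|speed t| <= e^-1) (@segment_compact _ 0 1).
- move=> e e' t e'0 ee' H t01; apply: (le_trans (H t01)).
  by rewrite lef_pV2 // posrE // (lt_le_trans e'0).
- move=> t0; rewrite /= in_itv /= => t01.
  have [S [U [oU Ut cS HS]]] := loc t0 t01.
  exists (`|S t0| + 1)^-1; first by rewrite invr_gt0 ltr_wpDl.
  have [r r0 Hr] := (continuous_atP _ _).1 cS 1 ltr01.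
  near=> t => t01'; rewrite invrK HS //; last by near: t; exact: open_nbhs_nbhs.
  rewrite -lerBlDl (le_trans (lerB_dist _ _)) // ltW // Hr //.
- exists e^-1 => t t01; apply: He => //=; rewrite in_itv /=.
  by case/andP: t01 => /ltW -> /ltW ->.
Unshelve. all: by end_near. Qed.

(** With [S] the integral of the speed, [C * S + h \o gamma] has nonnegative derivative in the open
    interval, hence does not decrease between two interior times. The ends are reached by continuity
    of [h \o gamma] alone. *)
Lemma curve_drop (h : M -> R) (C : R) (gamma : R -> M) (speed : R -> R) :
  continuous h -> 0 <= C -> smooth_curve A gamma ->
  (forall (t : R) c, 0 < t < 1 -> at_chart A c (gamma t) ->
     speed t = Num.sqrt (quad (g c (c (gamma t))) ('D_1 (c \o gamma) t))) ->
  (forall t, 0 < t < 1 -> derivable (h \o gamma) t 1 /\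
      - 'D_1 (h \o gamma) t <= C * speed t) ->
  h (gamma 0) - h (gamma 1) <= C * \int[lebesgue_measure]_(t in `]0, 1[) speed t.
Proof.
move=> ch C0 sg Hs dh.
have [csp [B HB]] := speed_regular sg Hs.
have sp0 t : 0 < t < 1 -> 0 <= speed t.
  by move=> t01; have [c ct] := chart_at hM (gamma t); rewrite (Hs t c) // sqrtr_ge0.
have m01 : measurable (`]0, 1[%classic : set (measurableTypeR R)) by exact: measurable_itv.
have isp : lebesgue_measure.-integrable (`]0, 1[%classic : set (measurableTypeR R)) (EFin \o speed).
  apply: measurable_bounded_integrable => //.
  - by rewrite /= lebesgue_measure_itv /= lte01 oppr0 adde0 ltry.
  - apply: measurable_realfun.open_continuous_measurable_fun.
      exact: interval_open.
    by move=> t; rewrite inE /= in_itv /= => /csp.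
  - exists B; split; first exact: num_real.
    by move=> x Bx t /=; rewrite in_itv /= => /HB/le_trans; apply; exact: ltW.
pose S t := \int[lebesgue_measure]_(s in `]0, t]) speed s.
have dS (t : R) : 0 < t < 1 -> is_derive t 1 S (speed t).
  move=> t01; have /andP[t0 t1] := t01.
  have tu : t < (1 + t) / 2 by lra.
  have iu : lebesgue_measure.-integrable
      (`]0, (1 + t) / 2]%classic : set (measurableTypeR R)) (EFin \o speed).
    apply: (integrableS _ _ _ isp) => //.
    by apply: subset_itvl; rewrite bnd_simp; lra.
  have [|d1 d2] := @continuous_FTC1 R speed (BRight 0) t _ tu iu _ (csp t t01).
    exact: t0.
  by apply: DeriveDef; [exact: d1|rewrite -derive1E d2].
have S0 (t : R) : 0 < t < 1 -> 0 <= S t <= \int[lebesgue_measure]_(t in `]0, 1[) speed t.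
  move=> /andP[t0 t1]; apply/andP; split.
    apply: Rintegral_ge0 => s; rewrite /= in_itv /= => /andP[s0 st].
    by apply: sp0; rewrite s0 (le_lt_trans st).
  have H := @Rintegral_itvB R speed (BRight 0) (BLeft 1) t isp.
  rewrite -subr_ge0 H ?bnd_simp ?(ltW t0) //.
  apply: Rintegral_ge0 => s; rewrite /= in_itv /= => /andP[ts s1].
  by apply: sp0; rewrite s1 (lt_trans t0).
have key (s t : R) : 0 < s -> s < t -> t < 1 -> h (gamma s) - h (gamma t) <=
    C * \int[lebesgue_measure]_(t in `]0, 1[) speed t.
  move=> s0 st t1.
  have itv x : s <= x -> x <= t -> 0 < x < 1.
    by move=> sx xt; rewrite (lt_le_trans s0) // (le_lt_trans xt).
  have dQ (x : R) : x \in `]s, t[ -> is_derive x 1 (fun x => C * S x + (h \o gamma) x)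
      (C * speed x + 'D_1 (h \o gamma) x).
    rewrite in_itv /= => /andP[/ltW sx /ltW xt]; apply: is_deriveD.
      by have := dS x (itv _ sx xt) => ?; exact: is_deriveZ.
    by have [/derivableP] := dh x (itv _ sx xt).
  have [|c cst] := MVT st dQ.
    apply: derivable_within_continuous => x; rewrite in_itv /= => /andP[sx xt].
    apply: derivableD; last by have [] := dh x (itv _ sx xt).
    by have [dSx _] := dS x (itv _ sx xt); exact: derivableZ.
  have cst' : 0 < c < 1.
    by move: cst; rewrite in_itv /= => /andP[/ltW sc /ltW ct]; exact: itv.
  have [_ Hc] := dh c cst'.
  have Q0 : 0 <= (C * speed c + 'D_1 (h \o gamma) c) * (t - s).
    by rewrite mulr_ge0 ?subr_ge0 ?(ltW st) //; lra.
  move=> e; rewrite -e /= in Q0.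
  have /andP[Ss0 _] := S0 s (itv _ (lexx s) (ltW st)).
  have /andP[_ St1] := S0 t (itv _ (ltW st) (lexx t)).
  have := ler_wpM2l C0 St1; have := mulr_ge0 C0 Ss0.
  move: Q0; move: (C * S t) (C * S s) (C * \int[_]_(_ in _) _) => a b c' ? ? ?.
  lra.
apply/ler_addgt0Pr => e e0; have e20 : 0 < e / 2 by rewrite divr_gt0.
have loc (t0 : R) : 0 <= t0 <= 1 -> exists2 r, 0 < r &
    forall t : R, `|t - t0| < r -> 0 <= t <= 1 -> `|h (gamma t) - h (gamma t0)| < e / 2.
  move=> t01; pose B' := h @^-1` ball (h (gamma t0)) (e / 2).
  have oB : open B' by move/continuousP: ch; apply; exact: ball_open.
  have It0 : `[0, 1]%classic t0 by rewrite /= in_itv.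
  have [|U [oU Ut HU]] := within_open_preimage sg.1 It0 oB; first exact: ballxx.
  have [r r0 Hr] := open_norm_ball oU Ut; exists r => // t tr t01'.
  have : B' (gamma t) by apply: HU; [exact: Hr|rewrite /= in_itv].
  by rewrite /B' /= -ball_normE /= distrC.
have [|r0 r00 H0] := loc 0; first by rewrite lexx ler01.
have [|r1 r10 H1] := loc 1; first by rewrite lexx ler01.
(* Interior times close to the ends; the cap 1/4 ensures [s < t]. *)
pose s := Num.min (r0 / 2) 4^-1; pose t := 1 - Num.min (r1 / 2) 4^-1.
have s0 : 0 < s by rewrite lt_min; apply/andP; split; lra.
have s4 : s <= 4^-1 by rewrite ge_min lexx orbT.
have sr : s <= r0 / 2 by rewrite ge_min lexx.
have tE : 1 - t = Num.min (r1 / 2) 4^-1 by rewrite /t subKr.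
have t0 : 0 < 1 - t by rewrite tE lt_min; apply/andP; split; lra.
have t4 : 1 - t <= 4^-1 by rewrite tE ge_min lexx orbT.
have tr : 1 - t <= r1 / 2 by rewrite tE ge_min lexx.
have := key s t s0; have := H0 s; rewrite subr0 gtr0_norm //.
have := H1 t; rewrite distrC gtr0_norm //.
have -> : 1 - t < r1 by lra.
have -> : s < r0 by lra.
have -> : 0 <= s <= 1 by apply/andP; split; lra.
have -> : 0 <= t <= 1 by apply/andP; split; lra.
have -> : s < t by lra.
have -> : t < 1 by lra.
move=> /(_ isT isT); rewrite ltr_norml => /andP[? ?].
move=> /(_ isT isT); rewrite ltr_norml => /andP[? ?] /(_ isT isT) ?.
lra.
Unshelve. all: by end_near. Qed.
End DistanceSeparates.

Section DistanceTopology.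
Context {R : realType} {d : nat} {M : topologicalType}.
Local Notation E := 'rV[R]_d.+1.
Local Notation chart := (chart R d M).
Context (A : set chart) (g : chart -> E -> 'M[R]_d.+1).
Hypothesis hM : closed_connected_manifold A.
Hypothesis hg : riemannian_metric A g.

Lemma gradient_bound (f : E -> R) (K : set E) : smooth_on setT f -> compact K ->
  exists2 C, 0 < C & forall y v, K y -> `|'D_v f y| <= C * `|v|.
Proof.
move=> sf cK.
have dc (j : 'I_d.+1) : continuous ('D_('e_j) f) by move=> y; exact: ((sf 1%N).2 'e_j).2.1.
have [||e e0 He] := @compact_uniform R E K (fun e y => forall j : 'I_d.+1, `|'D_('e_j) f y| <= e^-1) cK.
- move=> e e' y e'0 ee' H j; apply: (le_trans (H j)).
  by rewrite lef_pV2 // posrE // (lt_le_trans e'0).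
- move=> y Ky; exists (\sum_j `|'D_('e_j) f y| + 1)^-1.
    by rewrite invr_gt0 ltr_wpDl // sumr_ge0.
  rewrite invrK; apply: (@filter_forall _ _ _ (nbhs y)) => j.
  have [r r0 Hr] := (continuous_atP _ _).1 (dc j y) 1 ltr01.
  apply/nbhs_ballP; exists r => // z; rewrite -ball_normE /= distrC => /Hr.
  move=> /ltW H; rewrite -(subrK ('D_('e_j) f y) ('D_('e_j) f z)).
  rewrite (le_trans (ler_normD _ _)) // addrC lerD //.
  by rewrite (bigD1 j) //= lerDl sumr_ge0.
exists (d.+1%:R * e^-1) => [|y v Ky]; first by rewrite mulr_gt0 // invr_gt0.
have df : differentiable f y.
  exact: (Ck_differentiable (fin_dim_rV _) fin_dim_real openT I (sf 1%N)).
rewrite deriveE // [in X in `|X|](row_sum_delta v) linear_sum.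
apply: (le_trans (ler_norm_sum _ _ _)).
apply: (@le_trans _ _ (\sum_(j < d.+1) (e^-1 * `|v|))).
  apply: ler_sum => j _; rewrite linearZ_LR normrM mulrC -deriveE //.
  by rewrite ler_pM // ?mx_entry_le // He.
by rewrite sumr_const card_ord -[leLHS]mulr_natl mulrA.
Qed.

(** Positive definiteness is uniform on the compact product of [K] with the unit sphere, and
    homogeneity extends the bound to all vectors. *)
Lemma metric_lower_bound (c : chart) (K : set E) : A c -> compact K -> K `<=` img c ->
  exists2 e, 0 < e & forall y v, K y -> e * `|v| ^+ 2 <= quad (g c y) v.
Proof.
move=> Ac cK Kc; pose S := (fun v : E => `|v|) @^-1` [set x : R | x = 1].
have [sg _ gp _] := hg.
have cS : compact S.
  apply: bounded_closed_compact.
    exists 1; split=> [|x Bx v Sv]; first exact: num_real.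
    apply: (le_trans _ (ltW Bx)); rewrite le_eqVlt; apply/orP; left; apply/eqP; exact: Sv.
  have /continuous_closedP nc : continuous (fun v : E => `|v| : R) by exact: norm_continuous.
  by apply: nc; exact: closed_eq.
have cKS : compact (K `*` S) by exact: compact_setX.
have [||e e0 He] := @compact_uniform R (E * E)%type (K `*` S)
  (fun e p => e <= quad (g c p.1) p.2) cKS.
- by move=> e e' p _ /le_trans H /H.
- move=> [y v] [/= Ky Sv].
  have q0 : 0 < quad (g c y) v.
    by apply: gp => //; [exact: Kc|rewrite -normr_gt0 Sv].
  have cq : {for (y, v), continuous (fun p : E * E => quad (g c p.1) p.2)}.
    apply: continuous_quad; first exact: cvg_snd.
    apply: (@continuous_comp _ _ _ fst); first exact: cvg_fst.
    exact: (Ck_cont (sg c Ac 0%N) (Kc _ Ky)).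
  exists (quad (g c y) v / 2); first exact: divr_gt0.
  have q20 : 0 < quad (g c y) v / 2 by exact: divr_gt0.
  move/cvgrPdist_lt: cq => /(_ _ q20); apply: filterS => p /=.
  by rewrite ltr_norml => /andP[_]; lra.
exists e => // y v Ky; have [->|v0] := eqVneq v 0.
  by rewrite normr0 expr0n mulr0 /quad !mul0mx mxE.
have nv : 0 < `|v| by rewrite normr_gt0.
have Sv : S (`|v|^-1 *: v).
  by rewrite /S /= normrZ normfV normr_id mulVf // gt_eqF.
have := He (y, `|v|^-1 *: v) (conj Ky Sv); rewrite /= /quad.
rewrite -scalemxAl linearZ /= -!scalemxAl -scalemxAr scalerA mxE.
rewrite -expr2 exprVn mulrC ler_pdivlMr ?exprn_gt0 //.
Qed.
End DistanceTopology.

Section DistanceSeparation.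
Context {R : realType} {d : nat} {M : topologicalType}.
Local Notation E := 'rV[R]_d.+1.
Local Notation chart := (chart R d M).
Context (A : set chart) (g : chart -> E -> 'M[R]_d.+1).
Hypothesis hM : closed_connected_manifold A.
Hypothesis hg : riemannian_metric A g.

(** Row vectors carry the maximum norm, which is not smooth. The Euclidean distance gives a smooth
    profile, and its balls lie in those of the maximum norm. *)
Definition round (x0 : E) (r : R) (y : E) : R := r ^+ 2 - \sum_i (y 0 i - x0 0 i) ^+ 2.

Lemma smooth_round x0 r : smooth_on setT (round x0 r).
Proof.
move=> k; have Ci i : Ck k setT (fun y : E => y 0 i - x0 0 i).
  apply: Ck_add; [exact: openT| |exact: Ck_cst].
  by apply: Ck_coord; [exact: openT|exact: Ck_id].
apply: Ck_add; [exact: openT|exact: Ck_cst|].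
apply: Ck_opp; first exact: openT.
apply: Ck_bigsum => [|i]; first exact: openT.
by apply: Ck_mul; [exact: openT|exact: Ci|exact: Ci].
Qed.

Lemma smooth_bump x0 r : smooth_on setT (flat 0 \o round x0 r).
Proof.
move=> k; apply: (@Ck_comp _ k E R R setT setT (flat 0) (round x0 r)) => //;
  try exact: openT; try exact: fin_dim_real; [exact: smooth_flat|exact: smooth_round].
Qed.

Lemma round_ge0 x0 r y : 0 <= r -> 0 <= round x0 r y -> `|y - x0| <= r.
Proof.
move=> r0; rewrite subr_ge0 => H; apply/rV_norm_le => // i; rewrite !mxE.
rewrite -(@ler_pXn2r _ 2) // ?nnegrE // real_normK ?num_real //.
by apply: le_trans H; rewrite (bigD1 i) //= lerDl sumr_ge0 // => j _; exact: sqr_ge0.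
Qed.

Section Bump.
Context (c : chart) (x0 : E) (r : R).
Hypothesis Ac : A c.
Hypothesis r0 : 0 < r.
Hypothesis Kc : forall y, `|y - x0| <= r -> img c y.

Let K := [set y | 0 <= round x0 r y].
Let h (z : M) : R := if z \in dom c then flat 0 (round x0 r (c z)) else 0.

Let Kimg : K `<=` img c.
Proof. by move=> y Ky; apply/Kc/round_ge0 => //; exact: ltW. Qed.

Let cK : compact K.
Proof.
apply: bounded_closed_compact.
  exists (r + `|x0|); split=> [|x Bx v Kv]; first exact: num_real.
  apply: (le_trans _ (ltW Bx)); rewrite -(subrK x0 v).
  by rewrite (le_trans (ler_normD _ _)) // lerD2r round_ge0 // ltW.
have /continuous_closedP nc : continuous (round x0 r).
  by move=> y; exact: (Ck_cont (smooth_round x0 r 0%N) I).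
exact: (nc _ (@closed_ge _ 0)).
Qed.

Let hout z : ~ (cinv c @` K) z -> h z = 0.
Proof.
rewrite /h; case: ifPn => // /set_mem dz nK.
rewrite /flat; case: ifPn => // q0; case: nK; exists (c z); last exact: coordK.
by rewrite /K /=; exact: ltW.
Qed.

Let openKC : open (~` (cinv c @` K)).
Proof.
have [_ _ HM _ _] := hM.
apply: closed_openC; apply: compact_closed => //.
apply: continuous_compact => //.
by apply: continuous_subspaceW Kimg _; exact: cinv_continuous.
Qed.

Lemma bump_continuous : continuous h.
Proof.
move=> z; have [dz|ndz] := pselect (dom c z).
  apply: (@near_eq_continuous _ _ (flat 0 \o round x0 r \o c)).
    apply: filterS (open_nbhs_nbhs (conj (@dom_open _ _ _ c) dz)) => w dw.
    by rewrite /h mem_set.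
  apply: continuous_comp; first exact: coord_cont.
  exact: (Ck_cont (smooth_bump x0 r 0%N) I).
apply: (@near_eq_continuous _ _ (cst 0)); last exact: cst_continuous.
have nz : (~` (cinv c @` K)) z by move=> [y /Kimg/cinv_dom dy yz]; apply: ndz; rewrite -yz.
by apply: filterS (open_nbhs_nbhs (conj openKC nz)) => w /hout.
Qed.

Lemma bump_drop_curve : exists2 C, 0 < C & forall (gamma : R -> M) l,
  smooth_curve A gamma -> curve_length A g gamma l -> h (gamma 0) - h (gamma 1) <= C * l.
Proof.
have [C1 C10 HC1] := gradient_bound (smooth_bump x0 r) cK.
have [e e0 He] := metric_lower_bound hg Ac cK Kimg.
have se : 0 < Num.sqrt e by rewrite sqrtr_gt0.
exists (C1 / Num.sqrt e) => [|gamma l sg [speed [Hs ->]]]; first exact: divr_gt0.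
apply: (curve_drop hM hg bump_continuous) => //; first by rewrite divr_ge0 ?(ltW C10) ?(ltW se).
move=> t t01; have /andP[t0 t1] := t01.
have t01' : 0 <= t <= 1 by rewrite !ltW.
have sp0 : 0 <= speed t.
  by have [c' ct] := chart_at hM (gamma t); rewrite (Hs t c') // sqrtr_ge0.
have Cs0 : 0 <= C1 / Num.sqrt e * speed t by rewrite mulr_ge0 // divr_ge0 ?(ltW C10) ?(ltW se).
have It : `[0, 1]%classic t by rewrite /= in_itv.
have [Kt|nKt] := pselect ((cinv c @` K) (gamma t)); last first.
  have [V [oV Vt HV]] := within_open_preimage sg.1 It openKC nKt.
  have nE : \near t, cst 0 t = (h \o gamma) t.
    near=> s; rewrite /= hout //; apply: HV.
      by near: s; exact: open_nbhs_nbhs.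
    rewrite /= in_itv /=; apply/andP; split; near: s; [exact: lt_le_nbhsr|exact: lt_le_nbhsl].
  split; first exact: (near_eq_derivable nE (derivable_cst _ _ _)).
  by rewrite -(near_eq_derive _ nE) derive_cst oppr0.
have dt : dom c (gamma t) by case: Kt => y /Kimg/cinv_dom dy <-.
have [V [oV Vt HV]] := within_open_preimage sg.1 It (@dom_open _ _ _ c) dt.
have [W [G [oW Wt sG HG]]] := sg.2 c Ac t (conj It dt).
have HVW s : (V `&` W) s -> 0 <= s <= 1 -> dom c (gamma s) /\ c (gamma s) = G s.
  move=> [Vs Ws] s01; have Is : `[0, 1]%classic s by rewrite /= in_itv.
  by split; [exact: HV|rewrite -HG //; split=> //; exact: HV].
have sG' : smooth_on (V `&` W) G by move=> k; apply: Ck_sub (sG k) => s [].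
have [dg _ _] := curve_derivative (openI oV oW) sG' HVW (conj Vt Wt) t01.
have nE : \near t, (flat 0 \o round x0 r \o (c \o gamma)) t = (h \o gamma) t.
  near=> s; have Vs : V s by near: s; exact: open_nbhs_nbhs.
  rewrite /= /h mem_set //; apply: HV => //.
  rewrite /= in_itv /=; apply/andP; split; near: s; [exact: lt_le_nbhsr|exact: lt_le_nbhsl].
have db : differentiable (flat 0 \o round x0 r) ((c \o gamma) t).
  exact: (Ck_differentiable (fin_dim_rV _) fin_dim_real openT I (smooth_bump x0 r 1%N)).
have [d1 d2] := is_derive_chain db dg.
split; first exact: (near_eq_derivable nE d1).
rewrite -(near_eq_derive _ nE) d2.
have Kct : K (c (gamma t)) by case: Kt => y Ky <-; rewrite cinvK //; exact: Kimg.
apply: (le_trans (ler_norm _)); rewrite normrN.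
apply: (le_trans (HC1 _ _ Kct)); rewrite -mulrA ler_wpM2l ?(ltW C10) //.
rewrite mulrC ler_pdivlMr // (Hs t c) //.
set v := 'D_1 (c \o gamma) t.
have -> : `|v| = Num.sqrt (`|v| ^+ 2) by rewrite sqrtr_sqr normr_id.
rewrite -sqrtrM ?sqr_ge0 // ler_wsqrtr // mulrC.
exact: He.
Unshelve. all: by end_near. Qed.

Lemma bump_drop : exists2 C, 0 < C & forall y z l,
  piecewise_length A g y z l -> h y - h z <= C * l.
Proof.
have [C C0 HC] := bump_drop_curve; exists C => // y z l.
elim=> [w|gamma w l0 l1 sg cl _ IH]; first by rewrite subrr mulr0.
by have := HC gamma l0 sg cl; rewrite mulrDr; lra.
Qed.

End Bump.

(** A bump at [x] that vanishes outside [U] must lose its whole value along a path that ends outside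
    [U], and the loss is at most [C] times the length. *)
Lemma rdist_separates (x : M) (U : set M) : nbhs x U ->
  exists2 e, 0 < e & forall y, rdist A g x y < e -> U y.
Proof.
rewrite nbhsE => -[V [oV Vx] VU]; have [c [Ac dx]] := chart_at hM x.
have oW : open (img c `&` cinv c @^-1` V).
  rewrite openE => y [iy Vy]; apply: (@filterI _ (nbhs y)).
    by apply: open_nbhs_nbhs; split=> //; exact: open_img.
  by apply: (cinv_cont iy); apply: open_nbhs_nbhs.
have Wx : (img c `&` cinv c @^-1` V) (c x).
  by split; [exact: coord_img|rewrite /= coordK].
have [r r0 Hr] := open_norm_ball oW Wx.
have r20 : 0 < r / 2 by rewrite divr_gt0.
have HK y : `|y - c x| <= r / 2 -> (img c `&` cinv c @^-1` V) y.
  by move=> /le_lt_trans H; apply/Hr/H; lra.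
have [C C0 HC] := bump_drop Ac r20 (fun y H => (HK y H).1).
have hx : 0 < flat 0 (round (c x) (r / 2) (c x)).
  apply: flat_gt0; rewrite /round big1 ?subr0 ?exprn_gt0 // => i _.
  by rewrite subrr expr0n.
exists (flat 0 (round (c x) (r / 2) (c x)) / C) => [|y yx]; first exact: divr_gt0.
have [l pl lC] := rdist_path hM hg yx.
have := HC _ _ _ pl; rewrite mem_set //.
rewrite ltr_pdivlMr // mulrC in lC.
case: ifPn => [/set_mem dy H|_]; last by rewrite subr0; lra.
have : 0 < flat 0 (round (c x) (r / 2) (c y)) by lra.
rewrite {1}/flat; case: ifPn => [q0 _|]; last by rewrite ltxx.
by apply: VU; have [_] := HK _ (round_ge0 (ltW r20) (ltW q0)); rewrite /= coordK.
Qed.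

End DistanceSeparation.

(** * Velocities and smooth families of maps in charts *)

Section Velocity.
Context {R : realType} {d : nat}.
Local Notation E := 'rV[R]_d.+1.

(** Properness makes the velocity unique, at the ends of [0,1] too. The witness is moved away from
    [t] by at most 1/4, towards the farther end. *)
Lemma unit_interval_proper (t : R) : 0 <= t <= 1 -> ProperFilter (within `[0, 1]%classic t^').
Proof.
move=> /andP[t0 t1]; apply: Build_ProperFilter_ex => P.
rewrite /within /dnbhs /within /= => /nbhs_ballP[e /= e0 H].
pose s := if t <= 1 / 2 then t + Num.min (e / 2) 4^-1 else t - Num.min (e / 2) 4^-1.
pose m := Num.min (e / 2) 4^-1.
have m0 : 0 < m by rewrite lt_min; apply/andP; split; lra.
have m1 : m <= e / 2 by rewrite ge_min lexx.
have m2 : m <= 4^-1 by rewrite ge_min lexx orbT.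
exists s; apply: H.
- rewrite -ball_normE /= /s -/m; case: ifPn => _.
    by rewrite opprD addNKr normrN gtr0_norm //; lra.
  by rewrite opprB addrC subrK gtr0_norm //; lra.
- by rewrite /s -/m; case: ifPn => _; rewrite -subr_eq0 addrAC subrr add0r ?oppr_eq0 gt_eqF.
- rewrite /s -/m /= in_itv /=; case: ifPn; rewrite -?ltNge => ?; apply/andP; split; lra.
Qed.

Lemma velocity_unique (u : R -> E) (t : R) w w' : 0 <= t <= 1 ->
  velocity u t w -> velocity u t w' -> w = w'.
Proof.
move=> t01 h h'; have PF := unit_interval_proper t01.
exact: (cvg_unique _ h h').
Qed.

Lemma velocity_derive (u G : R -> E) (U : set R) (t : R) (w : E) : open U -> U t -> 0 <= t <= 1 ->
  (forall s, U s -> 0 <= s <= 1 -> u s = G s) -> is_derive t 1 G w -> velocity u t w.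
Proof.
move=> oU Ut t01 uG [dG <-]; apply/cvgrPdist_lt => e e0.
have [r r0 Hr] := open_norm_ball oU Ut.
have /cvgrPdist_lt/(_ e e0) : h^-1 *: (G (h *: 1 + t) - G t) @[h --> (0 : R)^'] --> 'D_1 G t by [].
rewrite /dnbhs /within /= => /nbhs_ballP[r' /= r'0 H].
rewrite /within /=; apply/nbhs_ballP; exists (Num.min r r') => /=.
  by rewrite lt_min r0.
move=> s; rewrite -ball_normE /= lt_min distrC => /andP[sr sr'] st.
rewrite in_itv /= => s01.
rewrite (uG s) ?(uG t) //; last exact: Hr.
have := H (s - t); rewrite -ball_normE /= sub0r normrN => /(_ sr').
by rewrite subr_eq0 [_ *: 1]mulr1 subrK; exact.
Qed.

Lemma velocity_cst (c : E) (t : R) : 0 <= t <= 1 -> velocity (fun=> c) t 0.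
Proof.
move=> t01; apply: (@velocity_derive _ (cst c) setT) => //; first exact: openT.
Qed.

End Velocity.

Section CkProducts.
Context {R : realType}.
Implicit Types V W : normedModType R.

Lemma Ck_pair k V (W1 W2 : normedModType R) (U : set V) (f : V -> W1) (h : V -> W2) : open U ->
  Ck k U f -> Ck k U h -> Ck k U (fun x => (f x, h x)).
Proof.
move=> oU Cf Ch.
have l1 : linear ((fun x => (x, 0)) : W1 -> W1 * W2).
  by move=> a u v; congr pair; rewrite /= scaler0 addr0.
have l2 : linear ((fun x => (0, x)) : W2 -> W1 * W2).
  by move=> a u v; congr pair; rewrite /= scaler0 addr0.
pose L1 : {linear W1 -> (W1 * W2)%type} :=
  HB.pack (fun x : W1 => (x, 0 : W2)) (GRing.isLinear.Build _ _ _ _ _ l1).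
pose L2 : {linear W2 -> (W1 * W2)%type} :=
  HB.pack (fun x : W2 => (0 : W1, x)) (GRing.isLinear.Build _ _ _ _ _ l2).
have c1 : continuous L1 by move=> x; apply: cvg_pair; [exact: cvg_id|exact: cvg_cst].
have c2 : continuous L2 by move=> x; apply: cvg_pair; [exact: cvg_cst|exact: cvg_id].
apply: Ck_eq (Ck_add oU (Ck_linear oU c1 Cf) (Ck_linear oU c2 Ch)) => // x _ /=.
by congr pair; rewrite /= ?addr0 ?add0r.
Qed.

Lemma Ck_fst k V W (U : set (V * W)) : open U -> Ck k U (fun p : V * W => p.1).
Proof.
move=> oU; apply: (@Ck_linear R k _ _ _ U id fst) => //; last exact: Ck_id.
by move=> p; exact: cvg_fst.
Qed.

Lemma Ck_snd k V W (U : set (V * W)) : open U -> Ck k U (fun p : V * W => p.2).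
Proof.
move=> oU; apply: (@Ck_linear R k _ _ _ U id snd) => //; last exact: Ck_id.
by move=> p; exact: cvg_snd.
Qed.

End CkProducts.

Section Families.
Context {R : realType} {d : nat} {M : topologicalType}.
Local Notation E := 'rV[R]_d.+1.
Local Notation chart := (chart R d M).
Context (A : set chart).
Hypothesis hM : closed_connected_manifold A.

Lemma continuous_familyP {T : topologicalType} (I : set R) (f : R -> M -> T) :
  continuous_family I f <-> forall t x B, I t -> open B -> B (f t x) ->
    exists U V, [/\ open U, open V, U t, V x & forall s y, U s -> I s -> V y -> B (f s y)].
Proof.
split=> [cf t x B It oB Bf|H].
  have [W [oW Wt HW]] := @within_open_preimage _ _ (I `*` setT)
    (fun p : R * M => f p.1 p.2) (t, x) B cf (conj It Logic.I) oB Bf.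
  have [[P Q] /= [+ +] HPQ] := open_nbhs_nbhs (conj oW Wt).
  rewrite !nbhsE => -[U [oU Ut] UP] [V [oV Vx] VQ].
  exists U, V; split=> // s y Us Is Vy.
  by apply: (HW (s, y)); [apply: HPQ; split; [exact: UP|exact: VQ]|split].
rewrite /continuous_family continuous_subspace_in => -[t x].
rewrite inE => -[/= It _] B nB; rewrite /= /nbhs /= -nbhs_subspace_in //.
move: nB; rewrite /= nbhsE => -[B' [oB' B'f] B'B].
have [U [V [oU oV Ut Vx HUV]]] := H t x B' It oB' B'f.
exists (U, V) => /=; first by split; apply: open_nbhs_nbhs.
by move=> [s y] [/= Us Vy] [/= Is _]; apply/B'B/HUV.
Qed.

Lemma open_chart_box (c : chart) (U : set R) (V : set M) : open U -> open V ->
  open [set p : R * E | [/\ U p.1, img c p.2 & V (cinv c p.2)]].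
Proof.
move=> oU oV; rewrite openE => -[t y] [/= Ut iy Vy].
exists (U, img c `&` cinv c @^-1` V) => /=; last by move=> [s z] [/= Us [iz Vz]].
split; first by apply: open_nbhs_nbhs.
apply: filterI; first by apply: open_nbhs_nbhs; split=> //; exact: open_img.
by apply: (cinv_cont iy); apply: open_nbhs_nbhs.
Qed.

(** [G] is smooth on an open set of [R * E], past the ends of [I] if necessary, and represents [f]
    at times in [I]. Derivatives and compositions are computed on [G]. *)
Definition extends (I : set R) (f : R -> M -> M) (c c' : chart) (U : set (R * E)) (G : R * E -> E) :=
  [/\ open U, smooth_on U G & forall t y, U (t, y) -> I t ->
    [/\ img c y, dom c' (f t (cinv c y)) & c' (f t (cinv c y)) = G (t, y)]].

Lemma family_extension (I : set R) (f : R -> M -> M) t x c c' : smooth_family_map A I f -> I t ->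
  at_chart A c x -> at_chart A c' (f t x) ->
  exists U G, U (t, c x) /\ extends I f c c' U G.
Proof.
move=> [cf sf] It [Ac dx] [Ac' dx'].
have ix := coord_img dx.
have [|U1 [G [oU1 U1t sG HG]]] := sf c c' Ac Ac' (t, c x).
  by split=> //=; rewrite coordK.
have [U [V [oU oV Ut Vx HUV]]] := (continuous_familyP _ _).1 cf t x _ It (@dom_open _ _ _ c') dx'.
exists (U1 `&` [set p : R * E | [/\ U p.1, img c p.2 & V (cinv c p.2)]]), G.
split; first by split=> //; split=> //=; rewrite coordK.
split.
- by apply: openI => //; exact: open_chart_box.
- by move=> k; apply: Ck_sub (sG k) => p [].
- move=> s y [U1s [/= Us iy Vy]] Is.
  have dy := HUV s _ Us Is Vy; split=> //.
  by apply: (HG (s, y)).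
Qed.

Lemma extends_smooth (I : set R) (f : R -> M -> M) : continuous_family I f ->
  (forall t x c c', I t -> at_chart A c x -> at_chart A c' (f t x) ->
     exists U G, U (t, c x) /\ extends I f c c' U G) -> smooth_family_map A I f.
Proof.
move=> cf H; split=> // c c' Ac Ac' [t y] [/= It iy dy].
have [||U [G [Ut [oU sG HG]]]] := H t (cinv c y) c c' It.
- by split=> //; exact: cinv_dom.
- by [].
rewrite cinvK // in Ut; exists U, G; split=> // -[s z] Us [/= Is _ _].
by have [] := HG s z Us Is.
Qed.

Lemma continuous_family_comp {T : topologicalType} (I : set R) (f : R -> M -> T) (h : R -> M -> M) :
  continuous_family I f -> continuous_family I h -> continuous_family I (fun t x => f t (h t x)).
Proof.
move=> /continuous_familyP cf /continuous_familyP ch; apply/continuous_familyP => t x B It oB Bf.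
have [U [V [oU oV Ut Vh HUV]]] := cf t (h t x) B It oB Bf.
have [U' [V' [oU' oV' Ut' Vx' HUV']]] := ch t x V It oV Vh.
exists (U `&` U'), V'; split=> //; first exact: openI.
by move=> s y [Us Us'] Is Vy; apply: HUV => //; exact: HUV'.
Qed.

Lemma extends_comp (I : set R) (f h : R -> M -> M) c c1 c' U G U' G' t x :
  extends I h c c1 U G -> extends I f c1 c' U' G' -> U (t, c x) -> U' (t, c1 (h t x)) ->
  I t -> dom c x ->
  extends I (fun t x => f t (h t x)) c c' (U `&` (fun p => (p.1, G p)) @^-1` U')
    (fun p => G' (p.1, G p)) /\ (U `&` (fun p => (p.1, G p)) @^-1` U') (t, c x).
Proof.
move=> [oU sG HG] [oU' sG' HG'] Ut Ut' It dx.
have sP k : Ck k U (fun p : R * E => (p.1, G p)).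
  by apply: Ck_pair => //; exact: Ck_fst.
have oW : open (U `&` (fun p => (p.1, G p)) @^-1` U').
  rewrite openE => p [Up Up']; apply: (@filterI _ (nbhs p)).
    exact: open_nbhs_nbhs.
  by apply: (Ck_cont (sP 0%N) Up); apply: open_nbhs_nbhs.
split; last first.
  split=> //=; have [_ _ <-] := HG t (c x) Ut It; by rewrite coordK.
split=> //.
  move=> k; apply: (@Ck_comp _ k _ _ _ _ U' G' (fun p : R * E => (p.1, G p))) => //.
  - by apply: fin_dim_prod; [exact: fin_dim_real|exact: fin_dim_rV].
  - exact: fin_dim_rV.
  - by move=> p [].
  - by apply: Ck_sub (sP k) => p [].
move=> s y [/= Us Us'] Is; have [iy dy ey] := HG s y Us Is.
have [iG dG eG] := HG' s (G (s, y)) Us' Is.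
by rewrite -ey coordK // in dG eG *; split=> //; rewrite eG ey.
Qed.

Lemma smooth_family_comp (I : set R) (f h : R -> M -> M) :
  smooth_family_map A I f -> smooth_family_map A I h ->
  smooth_family_map A I (fun t x => f t (h t x)).
Proof.
move=> sf sh; apply: extends_smooth; first exact: (continuous_family_comp sf.1 sh.1).
move=> t x c c' It cx c'x; have [c1 c1x] := chart_at hM (h t x).
have [U [G [Ut HG]]] := family_extension sh It cx c1x.
have [U' [G' [Ut' HG']]] := family_extension sf It c1x c'x.
have [HH HU] := extends_comp HG HG' Ut Ut' It cx.2.
by eexists; eexists; split; [exact: HU|exact: HH].
Qed.

Lemma smooth_family_reparam (I J : set R) (f : R -> M -> M) (z : R -> R) : smooth_on setT z ->
  (forall t, J t -> I (z t)) -> smooth_family_map A I f ->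
  smooth_family_map A J (fun t x => f (z t) x).
Proof.
move=> sz zI sf; have cz := smooth_on_cont sz.
apply: extends_smooth => [|t x c c' Jt cx c'x].
  apply/continuous_familyP => t x B Jt oB Bf.
  have [U [V [oU oV Ut Vx HUV]]] := (continuous_familyP _ _).1 sf.1 (z t) x B (zI _ Jt) oB Bf.
  exists (z @^-1` U), V; split=> //; first by move/continuousP: cz; apply.
  by move=> s y Us Js Vy; apply: HUV => //; exact: zI.
have [U [G [Ut [oU sG HG]]]] := family_extension sf (zI _ Jt) cx c'x.
have sP k (V : set (R * E)) : open V -> Ck k V (fun p : R * E => (z p.1, p.2)).
  move=> oV; apply: Ck_pair => //; last exact: Ck_snd.
  apply: (@Ck_comp _ k _ _ _ V setT z (fun p : R * E => p.1)) => //.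
  - exact: fin_dim_real.
  - exact: fin_dim_real.
  - exact: openT.
  - exact: Ck_fst.
have oW : open ((fun p : R * E => (z p.1, p.2)) @^-1` U).
  have /continuousP : continuous (fun p : R * E => (z p.1, p.2)).
    by move=> p; exact: (Ck_cont (sP 0%N setT openT)).
  exact.
exists ((fun p : R * E => (z p.1, p.2)) @^-1` U), (G \o (fun p : R * E => (z p.1, p.2))).
split=> //; split=> //.
  move=> k; apply: (@Ck_comp _ k _ _ _ _ U) => //.
  - by apply: fin_dim_prod; [exact: fin_dim_real|exact: fin_dim_rV].
  - exact: fin_dim_rV.
  - exact: sP.
by move=> s y Us Js; exact: HG Us (zI _ Js).
Qed.

(** Meant for the limit isotopy, which near each time before 1 coincides with a single stage. *)
Lemma smooth_family_local (I : set R) (f : R -> M -> M) :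
  (forall t, I t -> exists (U : set R) (J : set R) (f' : R -> M -> M),
     [/\ open U, U t, smooth_family_map A J f' &
       forall s, U s -> I s -> J s /\ f s = f' s]) ->
  smooth_family_map A I f.
Proof.
move=> H; apply: extends_smooth => [|t x c c' It cx c'x].
  apply/continuous_familyP => t x B It oB; have [U [J [f' [oU Ut sf' HU]]]] := H t It.
  have [Jt ->] := HU t Ut It => Bf.
  have [U1 [V [oU1 oV U1t Vx HUV]]] := (continuous_familyP _ _).1 sf'.1 t x B Jt oB Bf.
  exists (U `&` U1), V; split=> //; first exact: openI.
  by move=> s y [Us U1s] Is Vy; have [Js ->] := HU s Us Is; exact: HUV.
have [U [J [f' [oU Ut sf' HU]]]] := H t It; have [Jt ft] := HU t Ut It.
rewrite ft in c'x; have [W [G [Wt [oW sG HG]]]] := family_extension sf' Jt cx c'x.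
exists (W `&` [set p | U p.1]), G.
have oU' : open [set p : R * E | U p.1].
  have /continuousP : continuous (fun p : R * E => p.1) by move=> p; exact: cvg_fst.
  exact.
split=> //; split; first exact: openI.
  by move=> k; apply: Ck_sub (sG k) => p [].
by move=> s y [Ws /= Us] Is; have [Js ->] := HU s Us Is; exact: HG.
Qed.

Lemma smooth_family_id (I : set R) : smooth_family_map A I (fun _ : R => @id M).
Proof.
apply: extends_smooth => [|t x c c' It cx c'x].
  by apply/continuous_familyP => t x B It oB Bx; exists setT, B; split=> //; exact: openT.
have oW : open [set p : R * E | (c @` (dom c `&` dom c')) p.2].
  have /continuousP : continuous (fun p : R * E => p.2) by move=> p; exact: cvg_snd.
  by apply; exact: open_overlap.
exists [set p : R * E | (c @` (dom c `&` dom c')) p.2], (transition c c' \o snd).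
split; first by apply/overlapP; split; [exact: coord_img cx.2|rewrite coordK //; [exact: c'x.2|exact: cx.2]].
split=> // [k|s y /= /overlapP[iy dy] _] //.
apply: (@Ck_comp _ k _ _ _ _ (c @` (dom c `&` dom c'))) => //.
- exact: fin_dim_rV.
- exact: fin_dim_rV.
- exact: open_overlap.
- exact: (transition_smooth hM cx.1 c'x.1).
- exact: Ck_snd.
Qed.

End Families.

Section FamilyDerivatives.
Context {R : realType} {d : nat} {M : topologicalType}.
Local Notation E := 'rV[R]_d.+1.
Local Notation chart := (chart R d M).
Context (A : set chart).
Hypothesis hM : closed_connected_manifold A.

Lemma continuous_at_id (T : topologicalType) (x : T) : {for x, continuous (fun y : T => y)}.
Proof. exact: cvg_id. Qed.

Lemma continuous_pair (T S S' : topologicalType) (f : T -> S) (h : T -> S') (x : T) :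
  {for x, continuous f} -> {for x, continuous h} -> {for x, continuous (fun y => (f y, h y))}.
Proof. by move=> cf ch; apply: cvg_pair; [exact: cf|exact: ch]. Qed.

Lemma is_derive_pair (V W1 W2 : normedModType R) (f : V -> W1) (h : V -> W2) (x v : V) df dh :
  is_derive x v f df -> is_derive x v h dh -> is_derive x v (fun x => (f x, h x)) (df, dh).
Proof.
move=> [d1 <-] [d2 <-].
have H : e^-1 *: ((f (e *: v + x), h (e *: v + x)) - (f x, h x)) @[e --> (0 : R)^'] -->
    ('D_v f x, 'D_v h x).
  by apply: cvg_pair; [exact: d1|exact: d2].
by apply: DeriveDef; [apply/cvg_ex; eexists; exact: H|exact: cvg_lim H].
Qed.

Lemma fin_dim_time : fin_dim (R * E)%type.
Proof. by apply: fin_dim_prod; [exact: fin_dim_real|exact: fin_dim_rV]. Qed.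

Lemma extends_differentiable (I : set R) (f : R -> M -> M) (c c' : chart) U G p :
  extends I f c c' U G -> U p -> differentiable G p.
Proof.
by move=> [oU sG _] Up; exact: (Ck_differentiable fin_dim_time (fin_dim_rV _) oU Up (sG 1%N)).
Qed.

Lemma near_slice (U : set (R * E)) t y : open U -> U (t, y) -> \forall z \near y, U (t, z).
Proof.
move=> oU Ut; have /continuousP c : continuous (fun z : E => (t, z)).
  by move=> z; apply: continuous_pair; [exact: cst_continuous|exact: continuous_at_id].
by apply: (@open_nbhs_nbhs _ y); split=> //; exact: c.
Qed.

Lemma extends_slice (I : set R) (f : R -> M -> M) (c c' : chart) U G t y v :
  extends I f c c' U G -> U (t, y) -> I t ->
  differentiable (c' \o f t \o cinv c) y /\
  'D_v (c' \o f t \o cinv c) y = 'D_(0, v) G (t, y).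
Proof.
move=> eG Ut It; have dG := extends_differentiable eG Ut; have [oU sG HG] := eG.
have nE : \forall z \near y, (G \o (fun z => (t, z))) z = (c' \o f t \o cinv c) z.
  by apply: filterS (near_slice oU Ut) => z Uz; have [_ _ /esym] := HG t z Uz It.
have dv u : is_derive y u (G \o (fun z : E => (t, z))) ('D_(0, u) G (t, y)).
  have [dp ep] := is_derive_pair (is_derive_cst t y u) (is_derive_id y u).
  by have := @is_derive_chain R E _ E G (fun z => (t, z)) y u dG dp; rewrite ep.
split; last by rewrite -(near_eq_derive _ nE); have [_ ->] := dv v.
pose W := [set z | U (t, z)].
have oW : open W by rewrite openE => z Uz; exact: near_slice.
have sW k : Ck k W (c' \o f t \o cinv c).
  apply: (@Ck_eq R k E E W (G \o (fun z => (t, z)))) => //.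
    by move=> z Uz; have [_ _ /esym] := HG t z Uz It.
  apply: (@Ck_comp _ k _ _ _ _ U) => //; [exact: fin_dim_time|exact: fin_dim_rV|].
  by apply: Ck_pair => //; [exact: Ck_cst|exact: Ck_id].
exact: (Ck_differentiable (fin_dim_rV _) (fin_dim_rV _) oW Ut (sW 1%N)).
Qed.

Lemma open_time_slice (U : set (R * E)) (gamma : R -> E) (V : set R) : open V ->
  (forall s, V s -> {for s, continuous gamma}) -> open U ->
  open [set s | V s /\ U (s, gamma s)].
Proof.
move=> oV cg oU; rewrite openE => s [Vs Us]; apply: (@filterI _ (nbhs s)).
  exact: open_nbhs_nbhs.
have c : {for s, continuous (fun s => (s, gamma s))}.
  by apply: continuous_pair; [exact: continuous_at_id|exact: cg].
by apply: c; apply: open_nbhs_nbhs.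
Qed.

Lemma extends_velocity (f : R -> M -> M) (c c' : chart) U G t x :
  extends `[0, 1] f c c' U G -> U (t, c x) -> 0 <= t <= 1 -> dom c x ->
  velocity (fun s => c' (f s x)) t ('D_(1, 0) G (t, c x)).
Proof.
move=> eG Ut t01 dx; have dG := extends_differentiable eG Ut; have [oU sG HG] := eG.
apply: (@velocity_derive _ _ _ (G \o (fun s => (s, c x)))
  [set s | setT s /\ U (s, c x)]) => //.
- by apply: (@open_time_slice U (cst (c x)) setT) => //; [exact: openT|move=> s _; exact: cst_continuous].
- move=> s [_ Us] s01; have [|_ _ e] := HG s (c x) Us; first by rewrite /= in_itv.
  by rewrite /= -e coordK.
have [dp ep] := is_derive_pair (is_derive_id t 1) (is_derive_cst (c x) t 1).
by have := @is_derive_chain R R _ E G (fun s => (s, c x)) t 1 dG dp; rewrite ep.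
Qed.

(** The chain rule applied to the extension of [f]: its derivative along [(1, w2)] splits into the
    time part [w1] and the space part. The velocities are given by witnesses, to be identified later
    through [velocity_unique]. *)
Lemma product_velocity (f h : R -> M -> M) t x (c1 c' : chart) :
  smooth_family_map A `[0, 1] f -> smooth_family_map A `[0, 1] h -> 0 <= t <= 1 ->
  at_chart A c1 (h t x) -> at_chart A c' (f t (h t x)) ->
  exists w1 w2, [/\ velocity (fun s => c' (f s (h t x))) t w1,
    velocity (fun s => c1 (h s x)) t w2 &
    velocity (fun s => c' (f s (h s x))) t (w1 + 'D_w2 (c' \o f t \o cinv c1) (c1 (h t x)))].
Proof.
move=> sf sh t01 c1x c'x; have It : `[0, 1]%classic t by rewrite /= in_itv.
have [c cx] := chart_at hM x.
have [U [G [Ut eG]]] := family_extension sh It cx c1x.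
have [U' [G' [Ut' eG']]] := family_extension sf It c1x c'x.
have [oU sG HG] := eG; have [oU' sG' HG'] := eG'.
have dG := extends_differentiable eG Ut; have dG' := extends_differentiable eG' Ut'.
have Gt : c1 (h t x) = G (t, c x) by have [_ _ <-] := HG t (c x) Ut It; rewrite coordK //; exact: cx.2.
set w2 := 'D_(1, 0) G (t, c x).
exists ('D_(1, 0) G' (t, c1 (h t x))), w2; split.
- exact: (extends_velocity eG' Ut' t01 c1x.2).
- exact: (extends_velocity eG Ut t01 cx.2).
have [_ ->] := extends_slice w2 eG' Ut' It.
have -> : 'D_(1, 0) G' (t, c1 (h t x)) + 'D_(0, w2) G' (t, c1 (h t x)) =
    'D_(1, w2) G' (t, c1 (h t x)).
  rewrite !deriveE // -linearD; congr ('d _ _ _).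
  by congr pair; rewrite /= ?addr0 ?add0r.
have dgam : is_derive t 1 (fun s : R => G (s, c x)) w2.
  have [dp ep] := is_derive_pair (is_derive_id t 1) (is_derive_cst (c x) t 1).
  by have := @is_derive_chain R R _ E G (fun s => (s, c x)) t 1 dG dp; rewrite ep.
pose V := [set s : R | setT s /\ U (s, c x)].
have oV : open V.
  by apply: (@open_time_slice U (cst (c x)) setT) => //; [exact: openT|move=> s _; exact: cst_continuous].
apply: (@velocity_derive _ _ _ (G' \o (fun s => (s, G (s, c x))))
  [set s | V s /\ U' (s, G (s, c x))]) => //.
- apply: (@open_time_slice U' (fun s => G (s, c x)) V) => // s [_ Us].
  apply: (@continuous_comp _ _ _ (fun s => (s, c x)) G); last exact: (Ck_cont (sG 0%N) Us).
  by apply: continuous_pair; [exact: continuous_at_id|exact: cst_continuous].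
- by split=> //; rewrite -Gt.
- move=> s [[_ Us] Us'] s01; have Is : `[0, 1]%classic s by rewrite /= in_itv.
  have [_ dy ey] := HG s (c x) Us Is; have [_ _ ey'] := HG' s _ Us' Is.
  by rewrite /= -ey' -ey coordK // coordK //; exact: cx.2.
have [dp ep] := is_derive_pair (is_derive_id t 1) dgam.
rewrite Gt in dG' *.
by have := @is_derive_chain R R _ E G' (fun s => (s, G (s, c x))) t 1 dG' dp; rewrite ep.
Qed.

End FamilyDerivatives.

(** * Products, inverses and reparametrizations of strictly contact systems *)

Section Systems.
Context {R : realType} {d : nat} {M : topologicalType}.
Local Notation E := 'rV[R]_d.+1.
Local Notation chart := (chart R d M).
Context (A : set chart) (alpha : chart -> E -> E).
Hypothesis hM : closed_connected_manifold A.
Hypothesis halpha : one_form A alpha.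
Implicit Types (Phi Psi : isotopy R M) (H K : R -> M -> R).

(** The vector field is replaced by a velocity at each time and point of the trajectory passing
    there, which can be verified chart by chart; [smooth_systemE] recovers a field by choice. *)
Definition hamilton Phi H := forall (t : R) z c, 0 <= t <= 1 -> at_chart A c z ->
  exists w, velocity (fun s => c (Phi s (bwd Phi t z))) t w /\ H t z = pairing (alpha c (c z)) w.

Lemma smooth_systemE Phi H : smooth_system A alpha Phi H <->
  [/\ smooth_isotopy A Phi, forall t : R, 0 <= t <= 1 -> strictly_contact A alpha (Phi t) &
      hamilton Phi H].
Proof.
split=> [[sP cP [X [gX hX]]]|[sP cP hP]]; split=> //.
  have [iP _ _ _] := sP; move=> t z c t01 cz; have [_ K2] := iP t t01.
  have := gX t (bwd Phi t z) c t01; rewrite K2 => /(_ cz) v.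
  by exists (X t c z); split=> //; exact: hX.
have [iP _ _ _] := sP.
pose X (t : R) (c : chart) (z : M) : E := xget 0 [set w |
  velocity (fun s => c (Phi s (bwd Phi t z))) t w /\ H t z = pairing (alpha c (c z)) w].
have HX t z c : 0 <= t <= 1 -> at_chart A c z ->
    velocity (fun s => c (Phi s (bwd Phi t z))) t (X t c z) /\
    H t z = pairing (alpha c (c z)) (X t c z).
  by move=> t01 cz; exact: (xgetPex 0 (hP t z c t01 cz)).
exists X; split=> [t x c t01 cx|t z c t01 cz]; last by have [] := HX t z c t01 cz.
have [K1 _] := iP t t01; have [v _] := HX t (Phi t x) c t01 cx.
by rewrite K1 in v.
Qed.

Lemma slice_chain (f h : R -> M -> M) t x (c c1 c' : chart) v :
  smooth_family_map A `[0, 1] f -> smooth_family_map A `[0, 1] h -> 0 <= t <= 1 ->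
  at_chart A c x -> at_chart A c1 (h t x) -> at_chart A c' (f t (h t x)) ->
  'D_v (c' \o (fun x => f t (h t x)) \o cinv c) (c x) =
  'D_('D_v (c1 \o h t \o cinv c) (c x)) (c' \o f t \o cinv c1) (c1 (h t x)).
Proof.
move=> sf sh t01 cx c1x c'x; have It : `[0, 1]%classic t by rewrite /= in_itv.
have [U [G [Ut eG]]] := family_extension sh It cx c1x.
have [U' [G' [Ut' eG']]] := family_extension sf It c1x c'x.
have [d1 _] := extends_slice v eG Ut It.
have [d2 _] := extends_slice 0 eG' Ut' It.
have Ex : (c1 \o h t \o cinv c) (c x) = c1 (h t x) by rewrite /= coordK //; exact: cx.2.
have nE : \forall z \near c x, ((c' \o f t \o cinv c1) \o (c1 \o h t \o cinv c)) z =
    (c' \o (fun x => f t (h t x)) \o cinv c) z.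
  have [oU _ HG] := eG; apply: filterS (near_slice oU Ut) => z Uz.
  by have [_ dz _] := HG t z Uz It; rewrite /= coordK.
rewrite -(near_eq_derive _ nE) -Ex in d2 *.
by have [_ ->] := is_derive_chain d2 (@diff_derivable _ _ _ _ _ v d1).
Qed.

Lemma strictly_contact_comp (f h : R -> M -> M) t :
  smooth_family_map A `[0, 1] f -> smooth_family_map A `[0, 1] h -> 0 <= t <= 1 ->
  strictly_contact A alpha (f t) -> strictly_contact A alpha (h t) ->
  strictly_contact A alpha (fun x => f t (h t x)).
Proof.
move=> sf sh t01 kf kh x c c' cx c'x v; have [c1 c1x] := chart_at hM (h t x).
by rewrite (slice_chain v sf sh t01 cx c1x c'x) (kf _ _ _ c1x c'x) (kh _ _ _ cx c1x).
Qed.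

Lemma strictly_contact_inv Phi t : smooth_isotopy A Phi -> 0 <= t <= 1 ->
  strictly_contact A alpha (Phi t) -> strictly_contact A alpha (bwd Phi t).
Proof.
move=> [iP _ sf sb] t01 kf x c c' cx c'x v; have [_ K2] := iP t t01.
have cx' : at_chart A c (Phi t (bwd Phi t x)) by rewrite K2.
have := kf _ _ _ c'x cx' ('D_v (c' \o bwd Phi t \o cinv c) (c x)).
rewrite -(slice_chain v sf sb t01 cx c'x cx') K2 => <-; congr pairing.
have nE : \forall z \near c x, z = (c \o (fun x => Phi t (bwd Phi t x)) \o cinv c) z.
  have oI : open_nbhs (c x) (img c) by split; [exact: open_img|exact: coord_img cx.2].
  by apply: filterS (open_nbhs_nbhs oI) => z iz; rewrite /= K2 cinvK.
by rewrite -(near_eq_derive _ nE) derive_id.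
Qed.

Definition iso_mul Phi Psi : isotopy R M :=
  Isotopy (fun t x => Phi t (Psi t x)) (fun t x => bwd Psi t (bwd Phi t x)).
Definition iso_inv Phi : isotopy R M := Isotopy (bwd Phi) (fwd Phi).
Definition iso_reparam (z : R -> R) Phi : isotopy R M :=
  Isotopy (fun t => Phi (z t)) (fun t => bwd Phi (z t)).

Lemma pairingD (a u v : E) : pairing a (u + v) = pairing a u + pairing a v.
Proof. by rewrite /pairing linearD /= mulmxDr mxE. Qed.

Lemma pairingZ (a v : E) k : pairing a (k *: v) = k * pairing a v.
Proof. by rewrite /pairing linearZ /= -scalemxAr mxE. Qed.

Lemma pairing0 (a : E) : pairing a 0 = 0.
Proof. by rewrite /pairing trmx0 mulmx0 mxE. Qed.

(** The velocity of the product is that of [Phi] plus the image under the derivative of [Phi t] of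
    that of [Psi]. As [Phi t] preserves [alpha], the second term pairs to [K] at the preimage. *)
Lemma smooth_system_mul Phi Psi H K : smooth_system A alpha Phi H -> smooth_system A alpha Psi K ->
  smooth_system A alpha (iso_mul Phi Psi) (fun t z => H t z + K t (bwd Phi t z)).
Proof.
move=> /smooth_systemE[sP cP hP] /smooth_systemE[sQ cQ hQ]; apply/smooth_systemE.
have [iP P0 fP bP] := sP; have [iQ Q0 fQ bQ] := sQ.
split; first split.
- move=> t t01; have [p1 p2] := iP t t01; have [q1 q2] := iQ t t01.
  by split=> x /=; [rewrite p1 q1|rewrite q2 p2].
- by apply/funext => x; rewrite /= P0 Q0.
- exact: smooth_family_comp.
- exact: smooth_family_comp.
- by move=> t t01; apply: strictly_contact_comp => //; [exact: cP|exact: cQ].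
move=> t z c t01 cz /=; have [p1 p2] := iP t t01; have [q1 q2] := iQ t t01.
set w := bwd Phi t z; set x := bwd Psi t w.
have [c1 c1w] := chart_at hM w.
have Ew : Psi t x = w by exact: q2.
have [||w1 [w2 [v1 v2 v3]]] := @product_velocity R d M A hM Phi Psi t x c1 c fP fQ t01.
- by rewrite Ew.
- by rewrite Ew p2.
rewrite Ew in v1 v3.
exists (w1 + 'D_w2 (c \o Phi t \o cinv c1) (c1 w)); split=> //.
have [w1' [v1' ->]] := hP t z c t01 cz; rewrite (velocity_unique t01 v1' v1).
have [w2' [v2' ->]] := hQ t w c1 t01 c1w; rewrite (velocity_unique t01 v2' v2).
rewrite pairingD; congr (_ + _).
have cz' : at_chart A c (Phi t w) by rewrite p2.
by rewrite -(cP t t01 w c1 c c1w cz' w2) p2.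
Qed.

(** Differentiating [Phi t (bwd Phi t z) = z] in time shows that the derivative of [Phi t] carries
    the velocity of the inverse to minus that of [Phi]; invariance of [alpha] does the rest. *)
Lemma smooth_system_inv Phi H : smooth_system A alpha Phi H ->
  smooth_system A alpha (iso_inv Phi) (fun t z => - H t (Phi t z)).
Proof.
move=> /smooth_systemE[sP cP hP]; apply/smooth_systemE.
have [iP P0 fP bP] := sP.
have K01 : 0 <= (0 : R) <= 1 by rewrite lexx ler01.
split; first split.
- by move=> t t01; have [p1 p2] := iP t t01.
- by apply/funext => x; have [_ p2] := iP 0 K01; have := p2 x; rewrite P0.
- exact: bP.
- exact: fP.
- by move=> t t01; apply: strictly_contact_inv => //; exact: cP.
move=> t w c1 t01 c1w /=; have [p1 p2] := iP t t01; set z := Phi t w.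
have [c cz] := chart_at hM z.
have [||w1 [w2 [v1 v2 v3]]] := @product_velocity R d M A hM Phi (bwd Phi) t z c1 c fP bP t01.
- by rewrite p1.
- by rewrite p1.
exists w2; split=> //; rewrite p1 in v1 v3.
have [w1' [v1' ->]] := hP t z c t01 cz; rewrite p1 in v1'; rewrite (velocity_unique t01 v1' v1).
have v0 : velocity (fun s => c (Phi s (bwd Phi s z))) t 0.
  apply: (@velocity_derive _ _ _ (cst (c z)) setT) => //; first exact: openT.
  by move=> s _ s01; have [_ ->] := iP s s01.
have e := velocity_unique t01 v3 v0.
have := cP t t01 w c1 c c1w cz w2; rewrite -/z => <-.
have -> : 'D_w2 (c \o Phi t \o cinv c1) (c1 w) = -1 *: w1.
  by rewrite scaleN1r; apply/eqP; rewrite -addr_eq0 addrC e.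
by rewrite pairingZ mulN1r.
Qed.

Lemma smooth_system_reparam Phi H (z dz : R -> R) : smooth_system A alpha Phi H ->
  smooth_on setT z -> (forall t : R, is_derive t (1 : R) z (dz t)) ->
  (forall t, 0 <= z t <= 1) -> z 0 = 0 ->
  smooth_system A alpha (iso_reparam z Phi) (fun t x => dz t * H (z t) x).
Proof.
move=> /smooth_systemE[sP cP hP] sz dzz z01 z0; apply/smooth_systemE.
have [iP P0 fP bP] := sP.
have zI t : `[0, 1]%classic t -> `[0, 1]%classic (z t) by move=> _; rewrite /= in_itv /= z01.
split; first split.
- by move=> t _; exact: iP.
- by rewrite /= z0.
- exact: (smooth_family_reparam sz zI fP).
- exact: (smooth_family_reparam sz zI bP).
- by move=> t _; exact: cP.
move=> t x c t01 cx /=; have [p1 p2] := iP _ (z01 t); set y := bwd Phi (z t) x.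
have [w [vw ->]] := hP (z t) x c (z01 t) cx; rewrite -/y in vw.
exists (dz t *: w); split; last by rewrite pairingZ.
have [c0 c0y] := chart_at hM y.
have cx' : at_chart A c (Phi (z t) y) by rewrite p2.
have Iz : `[0, 1]%classic (z t) by rewrite /= in_itv /= z01.
have [U [G [Ut eG]]] := family_extension fP Iz c0y cx'.
have dG := extends_differentiable eG Ut; have [oU sG HG] := eG.
rewrite (velocity_unique (z01 t) vw (extends_velocity eG Ut (z01 t) c0y.2)).
have cz := smooth_on_cont sz.
apply: (@velocity_derive _ _ _ (G \o (fun s => (z s, c0 y)))
  [set s | U (z s, c0 y)]) => //.
- have /continuousP : continuous (fun s : R => (z s, c0 y)).
    by move=> s; apply: (@continuous_pair R R E z (fun=> c0 y)); [exact: cz|exact: cst_continuous].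
  exact.
- move=> s Us s01; have [|_ _ e] := HG (z s) (c0 y) Us; first by rewrite /= in_itv /= z01.
  by rewrite /= -e coordK //; exact: c0y.2.
have [dp ep] := is_derive_pair (dzz t) (is_derive_cst (c0 y) t 1).
have := @is_derive_chain R R _ E G (fun s => (z s, c0 y)) t 1 dG dp; rewrite ep.
have -> : (dz t, 0) = dz t *: (1, 0) :> (R * E)%type.
  by congr pair; rewrite /= ?scaler0 // [_ *: _]mulr1.
by have [_ ->] := is_derive_scale (dz t) (@diff_derivable R (R * E)%type E G _ ((1, 0) : (R * E)%type) dG).
Qed.

(** A smooth system prescribes [H] only pointwise. In a chart it is [alpha] paired with the time
    derivative of an extension [G] of the isotopy, evaluated at an extension [B] of the inverse, and
    this formula is smooth. *)
Lemma hamiltonian_smooth Phi H : smooth_system A alpha Phi H -> smooth_family_fun A `[0, 1] H.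
Proof.
move=> /smooth_systemE[[iP P0 fP bP] cP hP] c Ac [t y] [/= It iy].
have t01 : 0 <= t <= 1 by rewrite in_itv in It.
have [p1 p2] := iP t t01.
set z := cinv c y; set x := bwd Phi t z.
have cz : at_chart A c z by split=> //; exact: cinv_dom.
have [c0 c0x] := chart_at hM x.
have cz' : at_chart A c (Phi t x) by rewrite p2.
have [U [G [Ut eG]]] := family_extension fP It c0x cz'.
have [V [B [Vt eB]]] := family_extension bP It cz c0x.
have [oU sG HG] := eG; have [oV sB HB] := eB.
have Ey : c z = y by rewrite cinvK.
rewrite Ey in Vt.
have sP k (W : set (R * E)) : open W -> W `<=` V -> Ck k W (fun p : R * E => (p.1, B p)).
  by move=> oW WV; apply: Ck_pair => //; [exact: Ck_fst|apply: Ck_sub (sB k)].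
pose V' := V `&` [set p : R * E | img c p.2].
have oV' : open V'.
  apply: openI => //; have /continuousP : continuous (fun p : R * E => p.2) by move=> p; exact: cvg_snd.
  by apply; exact: open_img.
pose W := V' `&` (fun p => (p.1, B p)) @^-1` U.
have oW : open W.
  rewrite openE => p [Vp Up]; apply: (@filterI _ (nbhs p)); first exact: open_nbhs_nbhs.
  by apply: (Ck_cont (sP 0%N V oV (fun _ h => h)) Vp.1); apply: open_nbhs_nbhs.
have WV : W `<=` V by move=> p [[]].
exists W, (fun p => \sum_i alpha c p.2 0 i * ('D_(1, 0) G (p.1, B p)) 0 i); split=> //.
- by split=> //=; have [_ _ <-] := HB t y Vt It.
- move=> k; apply: Ck_sum => // i; apply: Ck_mul => //; apply: Ck_coord => //.
    apply: (@Ck_comp _ k _ _ _ W (img c) (alpha c) snd) => //.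
    + exact: fin_dim_rV.
    + exact: fin_dim_rV.
    + exact: open_img.
    + by move=> p [[]].
    + exact: halpha.1.
    + exact: Ck_snd.
  apply: (@Ck_comp _ k _ _ _ W U ('D_(1, 0) G) (fun p => (p.1, B p))) => //.
  + exact: fin_dim_time.
  + exact: fin_dim_rV.
  + by move=> p [].
  + by have [_ /(_ (1, 0))[]] := sG k.+1.
  + exact: sP.
move=> [s y'] [/= [Vs _] Us] [/= Is iy']; have s01 : 0 <= s <= 1 by rewrite in_itv in Is.
have [_ dy eB'] := HB s y' Vs Is.
have cy' : at_chart A c (cinv c y') by split=> //; exact: cinv_dom.
have [w [vw ->]] := hP s (cinv c y') c s01 cy'.
rewrite -eB' in Us.
rewrite (velocity_unique s01 vw (extends_velocity eG Us s01 dy)) eB' cinvK //.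
by rewrite /pairing mxE; apply: eq_bigr => i _; rewrite mxE.
Qed.
End Systems.

(** * Uniform distances between isotopies *)

Section UniformEstimates.
Context {R : realType} {d : nat} {M : topologicalType}.
Local Notation E := 'rV[R]_d.+1.
Local Notation chart := (chart R d M).
Context (A : set chart) (g : chart -> E -> 'M[R]_d.+1).
Hypothesis hM : closed_connected_manifold A.
Hypothesis hg : riemannian_metric A g.
Implicit Types (Phi Psi : isotopy R M).

(* Reversing curves would show that [rdist] is symmetric; symmetrizing it is
   enough for the uniform estimates. *)
Definition sdist (x y : M) : R := rdist A g x y + rdist A g y x.
Local Notation D := sdist.

Lemma sdist_ge0 x y : 0 <= D x y.
Proof. by rewrite addr_ge0 // rdist_ge0. Qed.

Lemma sdistC x y : D x y = D y x.
Proof. by rewrite /D addrC. Qed.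

Lemma sdistxx x : D x x = 0.
Proof. by rewrite /D (rdistxx hM hg) addr0. Qed.

Lemma sdist_tri x y z : D x z <= D x y + D y z.
Proof. by have := rdist_tri hM hg x y z; have := rdist_tri hM hg z y x; rewrite /D; lra. Qed.

Lemma rdist_sdist x y : rdist A g x y <= D x y.
Proof. by rewrite lerDl rdist_ge0. Qed.

Lemma nbhs_sdist (x : M) e : 0 < e -> \forall y \near x, D x y < e.
Proof.
move=> e0; have [U Ux HU] := rdist_near hM hg x (divr_gt0 e0 (ltr0Sn _ 1)).
apply: (filterS _ Ux) => y Uy; have := HU x y (nbhs_singleton Ux) Uy.
by have := HU y x Uy (nbhs_singleton Ux); rewrite /D; lra.
Qed.

Lemma sdist_nbhs (x : M) U : nbhs x U -> exists2 e, 0 < e & forall y, D x y < e -> U y.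
Proof.
move=> /(rdist_separates hM hg)[e e0 H]; exists e => // y /(le_lt_trans (rdist_sdist x y)).
exact: H.
Qed.

(** Compactness makes [rdist] and its symmetrization uniformly comparable at small scales; this
    transfers smallness of [dbar] to [sdist]. *)
Lemma rdist_small e : 0 < e -> exists2 e', 0 < e' & forall x y, rdist A g x y < e' -> D x y < e.
Proof.
move=> e0; have [_ cM _ _ _] := hM.
have [||e' e'0 H] := @compact_uniform R M setT (fun r x => forall y, rdist A g x y < r -> D x y < e) cM.
- by move=> r r' y _ rr' H z zr; apply: H; exact: lt_le_trans rr'.
- move=> x _; have e20 : 0 < e / 2 by rewrite divr_gt0.
  have [r r0 Hr] := rdist_separates hM hg (nbhs_sdist x e20).
  exists (r / 2); first by rewrite divr_gt0.
  have re : 0 < Num.min (r / 2) (e / 2) by rewrite lt_min; apply/andP; split; lra.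
  apply: (filterS _ (nbhs_sdist x re)) => y; rewrite lt_min => /andP[yr ye] z zr.
  have := Hr z; have := rdist_tri hM hg x y z; have := rdist_sdist x y => ? ? HH.
  have : D x z < e / 2 by apply: HH; lra.
  by have := sdist_tri y x z; rewrite (sdistC y x); lra.
- by exists e' => // x; exact: H.
Qed.

Lemma sdist_bounded : exists B, forall x y, D x y <= B.
Proof.
have [_ cM _ _ [x0 _]] := hM.
have [||e e0 H] := @compact_uniform R M setT (fun r x => D x0 x <= r^-1) cM.
- by move=> r r' y r'0 rr' /le_trans; apply; rewrite lef_pV2 // posrE // (lt_le_trans r'0).
- move=> x _; exists (D x0 x + 1)^-1; first by rewrite invr_gt0 ltr_wpDl // sdist_ge0.
  rewrite invrK; apply: (filterS _ (nbhs_sdist x ltr01)) => y xy.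
  by rewrite (le_trans (sdist_tri x0 x y)) // lerD2l ltW.
exists (e^-1 + e^-1) => x y; rewrite (le_trans (sdist_tri x x0 y)) // lerD ?H //.
by rewrite sdistC H.
Qed.

Lemma rdist_bounded : exists B, forall x y, rdist A g x y <= B.
Proof. by have [B HB] := sdist_bounded; exists B => x y; exact: le_trans (rdist_sdist x y) (HB x y). Qed.

Lemma family_uniform (f : R -> M -> M) e : continuous_family `[0, 1] f -> 0 < e ->
  exists2 r, 0 < r & forall (s t : R) x y, 0 <= s <= 1 -> 0 <= t <= 1 -> `|s - t| < r -> D x y < r ->
    D (f s x) (f t y) < e.
Proof.
move=> /continuous_familyP cf e0; have [_ cM _ _ _] := hM.
have cI : compact (`[0, 1]%classic `*` [set: M] : set (R * M)).
  by apply: compact_setX => //; exact: segment_compact.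
have [||r r0 H] := @compact_uniform R (R * M)%type _ (fun r p => 0 <= p.1 <= 1 -> forall s x, 0 <= s <= 1 ->
    `|s - p.1| < r -> D x p.2 < r -> D (f s x) (f p.1 p.2) < e) cI.
- move=> r r' p _ rr' H p01 s x s01 sr xr; apply: H => //; exact: lt_le_trans rr'.
- move=> [t x] [/= It _]; have e20 : 0 < e / 2 by rewrite divr_gt0.
  have : nbhs (f t x) [set y | D (f t x) y < e / 2] by exact: nbhs_sdist.
  rewrite nbhsE => -[B [oB Bf] HB].
  have [U [V [oU oV Ut Vx HUV]]] := cf t x B It oB Bf.
  have [r1 r10 H1] := open_norm_ball oU Ut.
  have [r2 r20 H2] := sdist_nbhs (open_nbhs_nbhs (conj oV Vx)).
  pose r := Num.min (r1 / 2) (r2 / 2).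
  have r0 : 0 < r by rewrite lt_min; apply/andP; split; lra.
  have rr1 : r <= r1 / 2 by rewrite ge_min lexx.
  have rr2 : r <= r2 / 2 by rewrite ge_min lexx orbT.
  exists r => //.
  exists (ball t r, [set y | D x y < r]).
    by split; [exact: nbhsx_ballx|exact: nbhs_sdist].
  move=> [t' x'] [/=]; rewrite -ball_normE /= => tt' xx' t'01 s y s01 st' yx'.
  have HD s' y' : 0 <= s' <= 1 -> `|s' - t| < r1 -> D x y' < r2 -> D (f t x) (f s' y') < e / 2.
    by move=> s'01 s't xy'; apply/HB/HUV; [exact: H1|rewrite /= in_itv|exact: H2].
  have h1 : D (f t x) (f t' x') < e / 2 by apply: HD => //; [rewrite distrC|]; lra.
  have h2 : D (f t x) (f s y) < e / 2.
    apply: HD => //.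
      have := ler_normD (s - t') (t' - t); rewrite subrKA => /le_lt_trans; apply.
      by rewrite (distrC t'); lra.
    by have := sdist_tri x x' y; rewrite (sdistC x' y); lra.
  by have := sdist_tri (f s y) (f t x) (f t' x'); rewrite (sdistC (f s y) (f t x)); lra.
exists r => // s t x y s01 t01 st xy.
by apply: (H (t, y)) => //; split => //; rewrite /= in_itv.
Qed.

Lemma dist_map_bounded (f h : M -> M) x : rdist A g (f x) (h x) <= dist_map (rdist A g) f h.
Proof.
have [B HB] := rdist_bounded; apply: ub_le_sup; last by exists x.
by exists B => _ [y _ <-]; exact: HB.
Qed.

Lemma le_dist_map (f h : M -> M) B : (forall x, rdist A g (f x) (h x) <= B) ->
  dist_map (rdist A g) f h <= B.
Proof.
have [_ _ _ _ [x0 _]] := hM.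
by move=> H; apply: ge_sup => [|_ [x _ <-]//]; exists (rdist A g (f x0) (h x0)), x0.
Qed.

(** The points [x] and [y] are independent because [dbar] adds the suprema for the maps and for
    their inverses. *)
Lemma le_dbar Phi Psi (t : R) x y : 0 <= t <= 1 ->
  rdist A g (Phi t x) (Psi t x) + rdist A g (bwd Phi t y) (bwd Psi t y) <= dbar (rdist A g) Phi Psi.
Proof.
move=> t01; have [B HB] := rdist_bounded.
apply: (@le_trans _ _ (dist_map (rdist A g) (Phi t) (Psi t) +
  dist_map (rdist A g) (bwd Phi t) (bwd Psi t))).
  by rewrite lerD // dist_map_bounded.
apply: ub_le_sup; last by exists t; rewrite //= in_itv.
by exists (B + B) => _ [s _ <-]; rewrite lerD // le_dist_map.
Qed.

Lemma dbar_le Phi Psi B : (forall (t : R) x y, 0 <= t <= 1 ->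
    rdist A g (Phi t x) (Psi t x) + rdist A g (bwd Phi t y) (bwd Psi t y) <= B) ->
  dbar (rdist A g) Phi Psi <= B.
Proof.
move=> H; apply: ge_sup.
  by eexists; exists 0 => //; rewrite /= in_itv /= lexx ler01.
move=> _ [t + <-]; rewrite /= in_itv /= => t01.
have H1 y : dist_map (rdist A g) (Phi t) (Psi t) <= B - rdist A g (bwd Phi t y) (bwd Psi t y).
  by apply: le_dist_map => x; rewrite lerBrDr H.
rewrite addrC -lerBrDr; apply: le_dist_map => y.
by have := H1 y; lra.
Qed.

Definition isotopy_close Phi Psi e := forall (t : R) x, 0 <= t <= 1 ->
  D (Phi t x) (Psi t x) < e /\ D (bwd Phi t x) (bwd Psi t x) < e.

Lemma dbar_lt_close e : 0 < e -> exists2 r, 0 < r & forall Phi Psi,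
  dbar (rdist A g) Phi Psi < r -> isotopy_close Phi Psi e.
Proof.
move=> /rdist_small[r r0 H]; exists r => // Phi Psi Hd t x t01.
have H1 := le_dbar Phi Psi x x t01.
have p1 := rdist_ge0 hM hg (Phi t x) (Psi t x).
have p2 := rdist_ge0 hM hg (bwd Phi t x) (bwd Psi t x).
by split; apply: H; lra.
Qed.

Lemma close_dbar Phi Psi e : isotopy_close Phi Psi e -> dbar (rdist A g) Phi Psi <= e + e.
Proof.
move=> H; apply: dbar_le => t x y t01; rewrite lerD //.
  by have [/ltW + _] := H t x t01; apply: le_trans; exact: rdist_sdist.
by have [_ /ltW] := H t y t01; apply: le_trans; exact: rdist_sdist.
Qed.

(** If [Phi1] and [Phi2] are both near [Phi], then the inverse of [Phi1 s] nearly undoes [Phi2 s],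
    and applying [Phi1 1] yields nearly [Phi 1]. Only moduli of continuity of [Phi] enter, so one
    [r] serves all approximations. *)
Lemma correction_estimate Phi e : continuous_isotopy Phi -> 0 < e ->
  exists2 r, 0 < r & forall Phi1 Phi2, inverse_pair Phi1 -> inverse_pair Phi2 ->
    isotopy_close Phi1 Phi r -> isotopy_close Phi2 Phi r ->
    forall (s : R) x, 0 <= s <= 1 ->
      D (Phi1 1 (bwd Phi1 s (Phi2 s x))) (Phi 1 x) < e /\
      D (bwd Phi2 s (Phi1 s (bwd Phi1 1 x))) (bwd Phi 1 x) < e.
Proof.
move=> [iP cP bP] e0; have i1 : 0 <= (1 : R) <= 1 by rewrite ler01 lexx.
have e20 : 0 < e / 2 by rewrite divr_gt0.
have [r1 r10 H1] := family_uniform cP e20.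
(* The argument of [Phi 1] carries two errors below [m], whose sum must stay under [r1]; the
   estimate for inverses collects three, whose sum must stay under [e]. *)
pose m := Num.min (e / 4) (r1 / 2).
have m0 : 0 < m by rewrite lt_min; apply/andP; split; lra.
have me : m <= e / 4 by rewrite ge_min lexx.
have mr : m <= r1 / 2 by rewrite ge_min lexx orbT.
have [r2 r20 H2] := family_uniform bP m0.
pose r := Num.min r2 m.
have r0 : 0 < r by rewrite lt_min r20.
have rr2 : r <= r2 by rewrite ge_min lexx.
have rm : r <= m by rewrite ge_min lexx orbT.
exists r => // Phi1 Phi2 iP1 iP2 c1 c2 s x s01.
have [K1 K2] := iP s s01.
have b s' x' y' : 0 <= s' <= 1 -> D x' y' < r -> D (bwd Phi s' x') (bwd Phi s' y') < m.
  by move=> s'01 xy; apply: H2 => //; [rewrite subrr normr0|exact: lt_le_trans rr2].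
split.
  set u := Phi2 s x; set w := bwd Phi1 s u.
  have [_ a1] := c1 s u s01; have [a2 _] := c2 s x s01.
  have a3 := b s u (Phi s x) s01 a2; rewrite K1 in a3.
  have a4 := sdist_tri w (bwd Phi s u) x.
  have a5 : D (Phi 1 w) (Phi 1 x) < e / 2.
    by apply: H1 => //; [rewrite subrr normr0|rewrite -/w -/u in a1; lra].
  have [a6 _] := c1 1 w i1.
  by have := sdist_tri (Phi1 1 w) (Phi 1 w) (Phi 1 x); lra.
set w := bwd Phi1 1 x; set v := Phi1 s w.
have [_ a1] := c1 1 x i1; have [a2 _] := c1 s w s01.
have [_ a3] := c2 s v s01.
have a4 := b s v (Phi s w) s01 a2; rewrite K1 in a4.
have a5 := sdist_tri (bwd Phi2 s v) (bwd Phi s v) w.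
by have := sdist_tri (bwd Phi2 s v) w (bwd Phi 1 x); rewrite -/w in a1; lra.
Qed.

End UniformEstimates.

(** * Norms of Hamiltonians as functions of time *)

Section HamiltonianFamilies.
Context {R : realType} {d : nat} {M : topologicalType}.
Local Notation E := 'rV[R]_d.+1.
Local Notation chart := (chart R d M).
Context (A : set chart).
Hypothesis hM : closed_connected_manifold A.

Lemma continuous_family_slice {T : topologicalType} (I : set R) (f : R -> M -> T) t :
  continuous_family I f -> I t -> continuous (f t).
Proof.
move=> /continuous_familyP cf It x B; rewrite nbhsE => -[B' [oB' B'f] B'B].
have [U [V [oU oV Ut Vx HUV]]] := cf t x B' It oB' B'f.
by apply: (filterS _ (open_nbhs_nbhs (conj oV Vx))) => y Vy; apply/B'B/HUV.
Qed.

Lemma smooth_family_fun_continuous (I : set R) (h : R -> M -> R) : smooth_family_fun A I h ->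
  continuous_family I h.
Proof.
move=> sh; apply/continuous_familyP => t x B It oB Bx.
have [c cx] := chart_at hM x.
have [|U [G [oU Ut sG HG]]] := sh c cx.1 (t, c x); first by split=> //; exact: coord_img cx.2.
have Gt : G (t, c x) = h t x by rewrite -HG //=; [rewrite coordK //; exact: cx.2|split=> //; exact: coord_img cx.2].
have : nbhs (t, c x) (U `&` G @^-1` B).
  apply: (@filterI _ (nbhs (t, c x))); first exact: open_nbhs_nbhs.
  by apply: (Ck_cont (sG 0%N) Ut); apply: open_nbhs_nbhs; rewrite Gt.
move=> [[P Q] /= [+ +] HPQ]; rewrite !nbhsE => -[V [oV Vt] VP] [W [oW Wx] WQ].
have : nbhs x (dom c `&` c @^-1` W).
  apply: (@filterI _ (nbhs x)); first by apply: open_nbhs_nbhs; split; [exact: dom_open|exact: cx.2].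
  by apply: (coord_cont cx.2); apply: open_nbhs_nbhs.
rewrite nbhsE => -[X [oX Xx] HX].
exists V, X; split=> // s y Vs Is Xy; have [dy Wy] := HX y Xy.
have [|Us Bs] := HPQ (s, c y); first by split; [exact: VP|exact: WQ].
by move: Bs; rewrite /= -HG //= ?coordK //; split=> //; exact: coord_img.
Qed.

Lemma smooth_family_fun_local (I : set R) (h : R -> M -> R) :
  (forall t, I t -> exists (U : set R) (J : set R) (h' : R -> M -> R),
     [/\ open U, U t, smooth_family_fun A J h' &
       forall s, U s -> I s -> J s /\ h s = h' s]) ->
  smooth_family_fun A I h.
Proof.
move=> H c Ac [t y] [/= It iy]; have [U [J [h' [oU Ut sh' HU]]]] := H t It.
have [Jt _] := HU t Ut It; have [W [G [oW Wt sG HG]]] := sh' c Ac (t, y) (conj Jt iy).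
have oU' : open [set p : R * E | U p.1].
  have /continuousP : continuous (fun p : R * E => p.1) by move=> p; exact: cvg_fst.
  exact.
exists (W `&` [set p | U p.1]), G; split=> //; first exact: openI.
  by move=> k; apply: Ck_sub (sG k) => p [].
by move=> [s z] [Ws /= Us] [/= Is iz]; have [Js ->] := HU s Us Is; rewrite -HG.
Qed.

Lemma family_time_uniform (K : R -> M -> R) e : continuous_family `[0, 1] K -> 0 < e ->
  exists2 r, 0 < r & forall (s t : R) x, 0 <= s <= 1 -> 0 <= t <= 1 -> `|s - t| < r ->
    `|K s x - K t x| < e.
Proof.
move=> /continuous_familyP cf e0; have [_ cM _ _ _] := hM.
have cI : compact (`[0, 1]%classic `*` [set: M] : set (R * M)).
  by apply: compact_setX => //; exact: segment_compact.
have [||r r0 H] := @compact_uniform R (R * M)%type _ (fun r p => 0 <= p.1 <= 1 -> forall s, 0 <= s <= 1 ->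
    `|s - p.1| < r -> `|K s p.2 - K p.1 p.2| < e) cI.
- by move=> r r' p _ rr' H p01 s s01 sr; apply: H => //; exact: lt_le_trans rr'.
- move=> [t x] [/= It _]; have e20 : 0 < e / 2 by rewrite divr_gt0.
  have [U [V [oU oV Ut Vx HUV]]] := cf t x (ball (K t x) (e / 2)) It (ball_open _ _) (ballxx _ e20).
  have [r1 r10 H1] := open_norm_ball oU Ut.
  exists (r1 / 2); first by lra.
  exists (ball t (r1 / 2), V).
    by split; [apply: nbhsx_ballx; lra|exact: open_nbhs_nbhs].
  move=> [t' x'] [/=]; rewrite -ball_normE /= => tt' Vx' t'01 s s01 st'.
  have HK s' : 0 <= s' <= 1 -> `|s' - t| < r1 -> `|K t x - K s' x'| < e / 2.
    by move=> s'01 s't; have := HUV s' x'; rewrite -ball_normE /=; apply; [exact: H1|rewrite /= in_itv|].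
  have h1 : `|K t x - K t' x'| < e / 2 by apply: HK => //; rewrite distrC; lra.
  have h2 : `|K t x - K s x'| < e / 2.
    apply: HK => //; have := ler_normD (s - t') (t' - t); rewrite subrKA => /le_lt_trans; apply.
    by rewrite (distrC t'); lra.
  have := ler_normD (K s x' - K t x) (K t x - K t' x'); rewrite subrKA => /le_lt_trans; apply.
  by rewrite (distrC (K s x')); lra.
exists r => // s t x s01 t01 st.
by apply: (H (t, x)) => //; split => //; rewrite /= in_itv.
Qed.
End HamiltonianFamilies.

Section UnitInterval.
Context {R : realType}.

Lemma integral_derive01 (k K : R -> R) : continuous k -> (forall x : R, is_derive x (1 : R) K (k x)) ->
  (\int[lebesgue_measure]_(t in `[0%R, 1%R]) (k t)%:E)%E = (K 1 - K 0)%:E.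
Proof.
move=> ck dK; rewrite EFinB; apply: continuous_FTC2; first exact: ltr01.
- exact: continuous_subspaceT.
- have cK : continuous K.
    by move=> x; apply/differentiable_continuous/derivable1_diffP; have [] := dK x.
  split; [by move=> x _; have [] := dK x|apply: cvg_at_right_filter; exact: cK|apply: cvg_at_left_filter; exact: cK].
- by move=> x _; rewrite derive1E; have [_ ->] := dK x.
Qed.

(** Families are controlled on [0,1] only, whereas primitives and time changes are stated on the
    whole line; composing with [clamp] extends by the values at the ends. *)
Definition clamp (t : R) : R := Num.max 0 (Num.min t 1).

Lemma clamp_itv t : 0 <= clamp t <= 1.
Proof. by rewrite /clamp le_max lexx /= ge_max ler01 ge_min lexx orbT. Qed.

Lemma clamp_id t : 0 <= t <= 1 -> clamp t = t.
Proof. by move=> /andP[t0 t1]; rewrite /clamp min_l // max_r. Qed.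

Lemma clampP t : [\/ t <= 0 /\ clamp t = 0, 0 <= t <= 1 /\ clamp t = t | 1 <= t /\ clamp t = 1 :> R].
Proof.
have [t0|t0] := leP t 0.
  by constructor 1; split=> //; rewrite /clamp min_l ?max_l // (le_trans t0).
have [t1|t1] := leP t 1.
  by constructor 2; split; [|apply: clamp_id]; rewrite (ltW t0).
by constructor 3; split; [exact: ltW|rewrite /clamp min_r ?max_r // ltW].
Qed.

Lemma clamp_dist s t : `|clamp s - clamp t| <= `|s - t :> R|.
Proof.
rewrite (ler_norml (clamp s - clamp t)); have := ler_norm (s - t); have := ler_norm (t - s); rewrite (distrC t s).
move: `|s - t| => x h1 h2.
by case: (clampP s) => -[s0 ->]; case: (clampP t) => -[t0 ->]; apply/andP; split; lra.
Qed.

Lemma uniform_continuous (k : R -> R) :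
  (forall e, 0 < e -> exists2 r, 0 < r & forall x y, `|x - y| <= r -> `|k x - k y| <= e) ->
  continuous k.
Proof.
move=> uk x; apply/(continuous_atP (V := R) (W := R)) => e e0; have [|r r0 H] := uk (e / 2); first by rewrite divr_gt0.
exists r => // y /= yx.
by apply: (le_lt_trans (H _ _ (ltW yx))); lra.
Qed.

Lemma integral_clamp (k : R -> R) :
  (forall e, 0 < e -> exists2 r, 0 < r & forall x y, `|x - y| <= r ->
    `|k (clamp x) - k (clamp y)| <= e) ->
  exists K, (forall x : R, is_derive x (1 : R) K (k (clamp x))) /\
    (\int[lebesgue_measure]_(t in `[0%R, 1%R]) (k t)%:E)%E = (K 1 - K 0)%:E.
Proof.
move=> uk; have ck := uniform_continuous uk.
(* [exists_primitive] wants a function that vanishes on the negative half-line; the constant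
   subtracted here is restored as a linear term. *)
have [|x x0|H dH _] := @exists_primitive R (fun x => k (clamp x) - k (clamp 0)).
- by move=> x; apply: (@cvgB R R _ (nbhs x)); [exact: ck|exact: cst_continuous].
- apply/eqP; rewrite subr_eq0 /clamp; apply/eqP; congr k.
  rewrite (min_l (y := 1)); last by lra.
  by rewrite max_l // min_l // max_l.
exists (fun x => H x + x * k (clamp 0)).
have dK x : is_derive x (1 : R) (fun x => H x + x * k (clamp 0)) (k (clamp x)).
  have h := dH x; apply: is_derive_eq; rewrite /GRing.scale /=; ring.
split=> //; rewrite -(integral_derive01 ck dK); apply: eq_integral => x.
by rewrite inE /= in_itv /= => x01; rewrite clamp_id.
Qed.
End UnitInterval.

Section NormsOfFamilies.
Context {R : realType} {n : nat} {M : topologicalType}.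
Local Notation E := 'rV[R]_((n.*2).+1).
Local Notation chart := (chart R n.*2 M).
Context (A : set chart) (alpha : chart -> E -> E).
Hypothesis hM : closed_connected_manifold A.
Hypothesis halpha : contact_form A alpha.
Local Notation hnorm := (hnorm A alpha).

Lemma continuous_diff (f h : M -> R) : continuous f -> continuous h -> continuous (fun x => f x - h x).
Proof. by move=> cf ch x; apply: (@cvgB R R _ (nbhs x)); [exact: cf|exact: ch]. Qed.

Lemma hnorm_dist (f h : M -> R) B : continuous f -> continuous h ->
  (forall x, `|f x - h x| <= B) -> `|hnorm f - hnorm h| <= 3 * B.
Proof.
move=> cf ch fh; have H f' h' : continuous f' -> continuous h' -> (forall x, `|f' x - h' x| <= B) ->
    hnorm f' - hnorm h' <= 3 * B.
  move=> cf' ch' fh'; have cd := continuous_diff cf' ch'.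
  have := hnorm_lincomb hM halpha 1 ch' cd; rewrite normr1 mul1r.
  under eq_fun do rewrite mul1r addrC subrK.
  by have := hnorm_le_bound hM halpha cd fh'; lra.
rewrite ler_norml H // andbT lerNl opprB H // => x; by rewrite distrC.
Qed.

Lemma hnormBC (f h : M -> R) : continuous f -> continuous h ->
  hnorm (fun x => f x - h x) = hnorm (fun x => h x - f x).
Proof.
have H f' h' : continuous f' -> continuous h' -> hnorm (fun x => f' x - h' x) <= hnorm (fun x => h' x - f' x).
  move=> cf ch; have := hnormZ hM halpha (-1) (continuous_diff ch cf).
  by rewrite normrN1 mul1r; under eq_fun do rewrite mulN1r opprB.
by move=> cf ch; apply/eqP; rewrite eq_le !H.
Qed.

Lemma hnormB_tri (f h k : M -> R) : continuous f -> continuous h -> continuous k ->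
  hnorm (fun x => f x - k x) <= hnorm (fun x => f x - h x) + hnorm (fun x => h x - k x).
Proof.
move=> cf ch ck; have := hnorm_lincomb hM halpha 1 (continuous_diff cf ch) (continuous_diff ch ck).
by rewrite normr1 mul1r; under eq_fun do rewrite mul1r subrKA.
Qed.

Lemma norm_family_uniform (K : R -> M -> R) e : continuous_family `[0, 1] K -> 0 < e ->
  exists2 r, 0 < r & forall s t : R, `|s - t| <= r -> `|hnorm (K (clamp s)) - hnorm (K (clamp t))| <= e.
Proof.
move=> cK e0; have [|r r0 H] := family_time_uniform hM cK (e := e / 3); first by lra.
exists (r / 2) => [|s t st]; first by lra.
have cs u : continuous (K (clamp u)) by apply: continuous_family_slice cK _; rewrite /= in_itv clamp_itv.
have -> : e = 3 * (e / 3) by field.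
apply: hnorm_dist => // x; apply/ltW/H; rewrite ?clamp_itv //.
by apply: le_lt_trans (clamp_dist _ _) _; lra.
Qed.

Lemma measurable_norm_family (K : R -> M -> R) : continuous_family `[0, 1] K ->
  measurable_fun (`[0, 1]%classic : set R) (fun t => hnorm (K t)).
Proof.
move=> cK; apply: (@eq_measurable_fun _ _ _ _ _ (fun t => hnorm (K (clamp t)))).
  by move=> t; rewrite inE /= in_itv /= => t01; rewrite clamp_id.
apply: measurable_funTS; apply: measurable_realfun.continuous_measurable_fun.
by apply: (uniform_continuous (k := fun t => hnorm (K (clamp t)))) => e; exact: norm_family_uniform.
Qed.

Lemma continuous_family_sub (I : set R) (f h : R -> M -> R) : continuous_family I f ->
  continuous_family I h -> continuous_family I (fun t x => f t x - h t x).
Proof.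
move=> cf ch p; apply: (@cvgB R R _ (nbhs (p : subspace (I `*` [set: M])))); [exact: cf|exact: ch].
Qed.

Lemma continuous_family_cst (I : set R) (f : M -> R) : continuous f -> continuous_family I (fun _ => f).
Proof.
move=> cf; apply: continuous_subspaceT => p; apply: (@continuous_comp _ _ _ (@snd R M) f).
  exact: cvg_snd.
exact: cf.
Qed.

(** [H t] is a uniform limit of simple functions at each time, and [hnorm] is continuous for uniform
    convergence. For a simple function, splitting off one measurable set at a time reduces to a
    constant function minus a continuous family, whose norm is continuous in time. *)
Lemma measurable_norm_diff (H K : R -> M -> R) :
  (forall t : R, 0 <= t <= 1 -> continuous (H t)) -> strongly_measurable H -> continuous_family `[0, 1] K ->
  measurable_fun (`[0, 1]%classic : set R) (fun t => hnorm (hsub H K t)).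
Proof.
move=> cH [S [mS HS]] cK.
have cKt (t : R) : 0 <= t <= 1 -> continuous (K t).
  by move=> t01; apply: continuous_family_slice cK _; rewrite /= in_itv.
have csum (s : seq (set R * (M -> R))) (t : R) : (forall p, p \in s -> continuous p.2) ->
    continuous (fun x => \sum_(p <- s) \1_(p.1) t * p.2 x).
  move=> cs x; rewrite (_ : (fun x => _) = \sum_(p <- s) (fun x => \1_(p.1) t * p.2 x)); last first.
    by apply/funext => y; rewrite fct_sumE.
  rewrite big_seq; elim/big_ind : _ => [|f h cf ch|p ps]; first exact: cst_continuous.
    exact: (@cvgD R R _ (nbhs x)).
  by apply: (@cvgM R _ (nbhs x)); [exact: cst_continuous|exact: cs].
(* [h0] accumulates the functions of the sets that have been split off. *)
have simple (s : seq (set R * (M -> R))) (h0 : M -> R) : continuous h0 -> (forall p, p \in s ->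
      measurable (p.1 : set (measurableTypeR R)) /\ continuous p.2) ->
    measurable_fun (`[0, 1]%classic : set R)
      (fun t => hnorm (fun x => (h0 x + \sum_(p <- s) \1_(p.1) t * p.2 x) - K t x)).
  elim: s h0 => [|p s IH] h0 ch0 Hs.
    apply: measurable_norm_family; apply: continuous_family_sub => //.
    have := continuous_family_cst (I := `[0, 1]%classic) ch0; congr continuous_family.
    by apply/funext => t; apply/funext => x; rewrite big_nil addr0.
  have [mp cp] := Hs p (mem_head _ _).
  have Hs' q : q \in s -> measurable (q.1 : set (measurableTypeR R)) /\ continuous q.2.
    by move=> qs; apply: Hs; rewrite inE qs orbT.
  have ch1 : continuous (fun x => h0 x + p.2 x).
    by move=> x; apply: (@cvgD R R _ (nbhs x)); [exact: ch0|exact: cp].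
  apply: (@eq_measurable_fun _ _ _ _ _ (fun t : R => if t \in p.1
     then hnorm (fun x => (h0 x + p.2 x) + \sum_(q <- s) \1_(q.1) t * q.2 x - K t x)
     else hnorm (fun x => h0 x + \sum_(q <- s) \1_(q.1) t * q.2 x - K t x))).
    move=> t _; case: ifP => tp; congr hnorm; apply/funext => x; rewrite big_cons indicE tp.
      by rewrite mul1r addrA.
    by rewrite mul0r add0r.
  apply: measurable_fun_if => //.
  - apply: (@measurable_fun_bool _ _ _ _ true).
    rewrite (_ : _ @^-1` _ = p.1); first exact: measurableI.
    by apply/seteqP; split=> t /=; [move/set_mem|move/mem_set].
  - by apply: (measurable_funS _ _ (IH _ ch1 Hs')).
  - by apply: (measurable_funS _ _ (IH _ ch0 Hs')).
apply: (@measurable_realfun.measurable_fun_cvg _ _ _ _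
  (fun k t => hnorm (fun x => (0 + \sum_(p <- S k) \1_(p.1) t * p.2 x) - K t x))).
  by move=> k; apply: simple; [exact: cst_continuous|exact: mS].
move=> t; rewrite /= in_itv /= => t01; apply/cvgrPdist_le => e e0.
have e30 : 0 < e / 3 by lra.
near=> k; have Hk x : `|H t x - \sum_(p <- S k) \1_(p.1) t * p.2 x| < e / 3.
  by move: x; near: k; exact: HS.
have -> : e = 3 * (e / 3) by field.
apply: hnorm_dist.
- exact: continuous_diff (cH t t01) (cKt t t01).
- apply: continuous_diff (cKt t t01); under eq_fun do rewrite add0r.
  by apply: csum => p /mS[].
- by move=> x; rewrite /hsub add0r opprB subrKA; apply/ltW/Hk.
Unshelve. all: by end_near. Qed.

End NormsOfFamilies.

Section IntegralNorm.
Context {R : realType} {n : nat} {M : topologicalType}.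
Local Notation E := 'rV[R]_((n.*2).+1).
Local Notation chart := (chart R n.*2 M).
Context (A : set chart) (alpha : chart -> E -> E).
Hypothesis hM : closed_connected_manifold A.
Hypothesis halpha : contact_form A alpha.
Local Notation hnorm := (hnorm A alpha).
Local Notation norm1oo := (norm1oo A alpha).

Lemma norm_time_change (K : R -> M -> R) (a b I : R) : continuous_family `[0, 1] K -> a < b ->
  (norm1oo K < I%:E)%E ->
  exists z dz : R -> R, smooth_step a b z dz /\ forall t, dz t * hnorm (K (z t)) <= I / (b - a).
Proof.
move=> cK ab; have uK := fun e e0 => norm_family_uniform hM halpha cK (e := e) e0.
rewrite /Defs.norm1oo; have [P [dP ->]] := @integral_clamp _ (fun t => hnorm (K t)) uK; rewrite lte_fin => PI.
have Kt t : continuous (K (clamp t)) by apply: continuous_family_slice cK _; rewrite /= in_itv clamp_itv.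
(* The strict inequality on the integral leaves exactly the loss that smoothing needs. *)
have [||z [dz [sz Hz]]] := exists_time_change ab _ _ dP uK (eps := I - (P 1 - P 0)); first by lra.
  by move=> t; exact: (hnorm_ge0 alpha hM (Kt t)).
exists z, dz; split=> // t; have := Hz t; rewrite clamp_id; last exact: (smooth_step_itv _ sz).
by rewrite subrKC.
Qed.

Lemma integral01_le (f f1 f2 : R -> R) :
  measurable_fun (`[0, 1]%classic : set R) f -> measurable_fun (`[0, 1]%classic : set R) f1 ->
  measurable_fun (`[0, 1]%classic : set R) f2 ->
  (forall t : R, 0 <= t <= 1 -> [/\ 0 <= f t, 0 <= f1 t, 0 <= f2 t & f t <= f1 t + f2 t]) ->
  (\int[lebesgue_measure]_(t in `[0%R, 1%R]) (f t)%:E <=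
   \int[lebesgue_measure]_(t in `[0%R, 1%R]) (f1 t)%:E +
   \int[lebesgue_measure]_(t in `[0%R, 1%R]) (f2 t)%:E)%E.
Proof.
move=> mf mf1 mf2 H.
have H' (t : R) : `[0, 1]%classic t -> [/\ 0 <= f t, 0 <= f1 t, 0 <= f2 t & f t <= f1 t + f2 t].
  by rewrite /= in_itv; exact: H.
rewrite -ge0_integralD //; first apply: ge0_le_integral => //.
- by move=> t /H'[f0 *]; rewrite lee_fin.
- exact/measurable_realfun.measurable_EFinP.
- by apply/measurable_realfun.measurable_EFinP; exact: measurable_realfun.measurable_funD.
- by move=> t /H'[*]; rewrite -EFinD lee_fin.
- by move=> t /H'[*]; rewrite lee_fin.
- exact/measurable_realfun.measurable_EFinP.
- by move=> t /H'[*]; rewrite lee_fin.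
- exact/measurable_realfun.measurable_EFinP.
Qed.

Context (H : R -> M -> R).
Hypothesis cH : forall t : R, 0 <= t <= 1 -> continuous (H t).
Hypothesis mH : strongly_measurable H.

Let slice (K : R -> M -> R) : continuous_family `[0, 1] K -> forall t : R, 0 <= t <= 1 -> continuous (K t).
Proof. by move=> cK t t01; apply: continuous_family_slice cK _; rewrite /= in_itv. Qed.

Lemma norm1ooB (K K' : R -> M -> R) : continuous_family `[0, 1] K -> continuous_family `[0, 1] K' ->
  (norm1oo (hsub K K') <= norm1oo (hsub H K) + norm1oo (hsub H K'))%E.
Proof.
move=> cK cK'; apply: integral01_le.
- by apply: (measurable_norm_family hM halpha); exact: continuous_family_sub.
- exact: (measurable_norm_diff hM halpha).
- exact: (measurable_norm_diff hM halpha).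
move=> t t01; have [c1 c2 c3] := And3 (slice cK t01) (slice cK' t01) (cH t01).
split; try by apply: (hnorm_ge0 alpha hM) => //; exact: continuous_diff.
by have := hnormB_tri hM halpha c1 c3 c2; rewrite (hnormBC hM halpha c1 c3).
Qed.

Lemma norm1oo_le (K : R -> M -> R) : continuous_family `[0, 1] K ->
  (norm1oo K <= norm1oo H + norm1oo (hsub H K))%E.
Proof.
move=> cK; have c0 := continuous_family_cst (I := `[0, 1]%classic) (@cst_continuous M R 0).
have E0 (F : R -> M -> R) : norm1oo F = norm1oo (hsub F (fun _ => cst 0)).
  by apply: eq_integral => t _; congr (hnorm _)%:E; apply/funext => x; rewrite /hsub subr0.
by rewrite (E0 H) (E0 K) addeC; exact: norm1ooB.
Qed.

(** [F] enters through continuous families [G k] that agree with it at each time for large [k]; they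
    make the norm of [hsub F H] measurable. The bound itself is the triangle inequality through
    [K]. *)
Lemma norm1oo_hsub (F K : R -> M -> R) (G : nat -> R -> M -> R) (b : R -> R) :
  (forall t : R, 0 <= t <= 1 -> continuous (F t)) -> (forall k, continuous_family `[0, 1] (G k)) ->
  (forall t : R, 0 <= t <= 1 -> \forall k \near \oo, G k t = F t) ->
  continuous_family `[0, 1] K -> measurable_fun (`[0, 1]%classic : set R) b ->
  (forall t : R, 0 <= t <= 1 -> hnorm (hsub F K t) <= b t) ->
  (norm1oo (hsub F H) <=
   \int[lebesgue_measure]_(t in `[0%R, 1%R]) (b t)%:E + norm1oo (hsub H K))%E.
Proof.
move=> cF cG GF cK mb Fb; apply: integral01_le => //.
- apply: (@measurable_realfun.measurable_fun_cvg _ _ _ _ (fun k t => hnorm (hsub H (G k) t))).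
    by move=> k; exact: (measurable_norm_diff hM halpha).
  move=> t; rewrite /= in_itv /= => t01; apply: cvg_near_cst.
  by apply: filterS (GF t t01) => k; rewrite /hsub => ->; apply: (hnormBC hM halpha) => //; [exact: cH|exact: cF].
- exact: (measurable_norm_diff hM halpha).
move=> t t01; have [c1 c2 c3] := And3 (slice cK t01) (cF t t01) (cH t01).
have h0 : 0 <= hnorm (hsub F K t) by apply: (hnorm_ge0 alpha hM) => //; exact: continuous_diff.
split.
- by apply: (hnorm_ge0 alpha hM) => //; exact: continuous_diff.
- exact: le_trans h0 (Fb t t01).
- by apply: (hnorm_ge0 alpha hM) => //; exact: continuous_diff.
have := hnormB_tri hM halpha c2 c1 c3; rewrite (hnormBC hM halpha c1 c3).
by have := Fb t t01; rewrite /hsub; lra.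
Qed.

End IntegralNorm.

(** * The stages of the isotopy *)

Section IdentitySystem.
Context {R : realType} {d : nat} {M : topologicalType}.
Local Notation E := 'rV[R]_d.+1.
Local Notation chart := (chart R d M).
Context (A : set chart) (alpha : chart -> E -> E).
Hypothesis hM : closed_connected_manifold A.
Hypothesis halpha : one_form A alpha.

Lemma smooth_system_id : smooth_system A alpha id_isotopy (fun _ _ => 0).
Proof.
apply/smooth_systemE; split.
- by split=> //; exact: smooth_family_id.
- move=> t t01 x c c' cx c'x v /=.
  exact: halpha.2.
move=> t z c t01 cz; exists 0; split; last by rewrite pairing0.
exact: (velocity_cst (c z) t01).
Qed.
End IdentitySystem.

Section Stages.
Context {R : realType} {d : nat} {M : topologicalType}.
Local Notation E := 'rV[R]_d.+1.
Local Notation chart := (chart R d M).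
Context (A : set chart) (alpha : chart -> E -> E).
Hypothesis hM : closed_connected_manifold A.
Hypothesis halpha : one_form A alpha.
Context (P : nat -> isotopy R M) (H : nat -> R -> M -> R) (T : nat -> R) (z dz : nat -> R -> R).
Hypothesis P0 : P 0%N = id_isotopy.
Hypothesis H0 : H 0%N = (fun _ _ => 0).
Hypothesis sP : forall N, smooth_system A alpha (P N) (H N).
Hypothesis T0 : T 0%N = 0.
Hypothesis T_lt : forall N, T N < T N.+1.
Hypothesis sz : forall N, smooth_step (T N) (T N.+1) (z N) (dz N).

(* During [T N, T N.+1] the isotopy is steered from the time-one map of [P N]
   to the one of [P N.+1] by the right factor. *)
Fixpoint stage N : isotopy R M :=
  if N is N'.+1 then iso_mul (stage N') (iso_reparam (z N') (iso_mul (iso_inv (P N')) (P N)))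
  else id_isotopy.

Fixpoint stage_ham N : R -> M -> R :=
  if N is N'.+1 then fun t x => stage_ham N' t x +
    dz N' t * (- H N' (z N' t) (P N' (z N' t) (bwd (stage N') t x)) +
               H N (z N' t) (P N' (z N' t) (bwd (stage N') t x)))
  else fun _ _ => 0.

Lemma T_ge0 N : 0 <= T N.
Proof. by elim: N => [|N IH]; [rewrite T0|exact/(le_trans IH)/ltW]. Qed.

Lemma stage_system N : smooth_system A alpha (stage N) (stage_ham N).
Proof.
elim: N => [|N IH]; first exact: smooth_system_id.
have [s1 d1 s0 s11 _] := sz N.
have X := smooth_system_mul hM (smooth_system_inv hM (sP N)) (sP N.+1).
have Y := smooth_system_reparam hM X s1 d1 (fun t => smooth_step_itv t (sz N)) (s0 _ (T_ge0 N)).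
exact: (smooth_system_mul hM IH Y).
Qed.

Lemma T_le N N' : (N <= N')%N -> T N <= T N'.
Proof.
elim: N' => [|N' IH]; first by rewrite leqn0 => /eqP ->.
by rewrite leq_eqVlt => /orP[/eqP -> //|/IH NN']; exact/(le_trans NN')/ltW.
Qed.

Lemma system_inverse N : inverse_pair (P N).
Proof. by have [[]] := sP N. Qed.

Lemma step_itv N t : 0 <= z N t <= 1.
Proof. exact: smooth_step_itv (sz N). Qed.

(** From [T N] on the steps have reached 1, and the product telescopes: each time-one map cancels
    against the inverse in the next factor. *)
Lemma stage_after N t : T N <= t ->
  [/\ stage N t = P N 1, bwd (stage N) t = bwd (P N) 1 & forall x, stage_ham N t x = 0].
Proof.
elim: N t => [|N IH] t Tt; first by rewrite /= P0.
have [e1 e2 e3] := IH t (le_trans (ltW (T_lt N)) Tt).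
have [_ _ _ s11 d0] := sz N.
have i1 : 0 <= (1 : R) <= 1 by rewrite ler01 lexx.
have [K1 K2] := system_inverse N i1; have [L1 L2] := system_inverse N.+1 i1.
split=> /= [||x]; last 1 first.
- rewrite e3 (d0 t).2 ?mul0r ?addr0 // => /andP[_]; by rewrite ltNge Tt.
- by apply/funext => x; rewrite s11 // e1 K2.
- by apply/funext => x; rewrite s11 // e2 K2.
Qed.

(** Before [T N] the new factor sits at time 0, where all isotopies are the identity. *)
Lemma stage_before N t : t <= T N ->
  [/\ stage N.+1 t = stage N t, bwd (stage N.+1) t = bwd (stage N) t & stage_ham N.+1 t = stage_ham N t].
Proof.
move=> tT; have [_ _ s0 _ d0] := sz N.
have i0 : 0 <= (0 : R) <= 1 by rewrite ler01 lexx.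
have Q0 k : P k 0 = id by have [[]] := sP k.
have B0 k : bwd (P k) 0 = id.
  by have [K1 K2] := system_inverse k i0; apply/funext => x; have := K2 x; rewrite Q0.
split; apply/funext => x /=; rewrite ?s0 ?Q0 ?B0 //.
by rewrite (d0 t).2 ?mul0r ?addr0 // => /andP[]; rewrite ltNge tT.
Qed.

Lemma stage_stable N N' t : (N <= N')%N -> t <= T N ->
  [/\ stage N' t = stage N t, bwd (stage N') t = bwd (stage N) t & stage_ham N' t = stage_ham N t].
Proof.
elim: N' => [|N' IH]; first by rewrite leqn0 => /eqP ->.
rewrite leq_eqVlt => /orP[/eqP -> //|NN'] tT.
have [<- <- <-] := IH NN' tT.
by apply: stage_before; exact: le_trans tT (T_le (NN' : (N <= N')%N)).
Qed.

Lemma stage_formula N t : T N <= t ->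
  [/\ forall x, stage N.+1 t x = P N 1 (bwd (P N) (z N t) (P N.+1 (z N t) x)),
      forall x, bwd (stage N.+1) t x = bwd (P N.+1) (z N t) (P N (z N t) (bwd (P N) 1 x)) &
      forall x, stage_ham N.+1 t x =
        dz N t * hsub (H N.+1) (H N) (z N t) (P N (z N t) (bwd (P N) 1 x))].
Proof.
move=> Tt; have [e1 e2 e3] := stage_after Tt.
by split=> x /=; rewrite ?e1 ?e2 // e3 add0r addrC.
Qed.

(** Since [P 0] is the identity, no map is composed with [H 1], so the first interval is free of the
    factor 2 of [hnorm_comp]. *)
Lemma first_stage t : 0 <= t ->
  [/\ stage 1 t = P 1 (z 0%N t), bwd (stage 1) t = bwd (P 1) (z 0%N t) &
      stage_ham 1 t = fun x => dz 0%N t * H 1%N (z 0%N t) x].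
Proof.
move=> t0; have [|e1 e2 e3] := @stage_formula 0%N t; first by rewrite T0.
split; apply/funext => x; rewrite ?e1 ?e2 ?e3 P0 //=.
by rewrite /hsub H0 subr0.
Qed.

End Stages.

(** * The limit of the stages *)

Section Limit.
Context {R : realType} {n : nat} {M : topologicalType}.
Local Notation E := 'rV[R]_((n.*2).+1).
Local Notation chart := (chart R n.*2 M).
Context (A : set chart) (alpha : chart -> E -> E) (g : chart -> E -> 'M[R]_((n.*2).+1)).
Hypothesis hM : closed_connected_manifold A.
Hypothesis halpha : contact_form A alpha.
Hypothesis hg : riemannian_metric A g.
Context (PhiH : isotopy R M) (P : nat -> isotopy R M) (H : nat -> R -> M -> R).
Context (T : nat -> R) (z dz : nat -> R -> R).
Hypothesis cPhiH : continuous_isotopy PhiH.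
Hypothesis P0 : P 0%N = id_isotopy.
Hypothesis sP : forall N, smooth_system A alpha (P N) (H N).
Hypothesis T0 : T 0%N = 0.
Hypothesis T_lt : forall N, T N < T N.+1.
Hypothesis T1 : forall N, T N < 1.
Hypothesis T_cofinal : forall t, t < 1 -> exists N, t < T N.
Hypothesis sz : forall N, smooth_step (T N) (T N.+1) (z N) (dz N).
Hypothesis P_close : forall r, 0 < r -> exists N0, forall N, (N0 <= N)%N -> isotopy_close A g (P N) PhiH r.
Hypothesis H_small : forall e, 0 < e -> exists N0, forall N t, (N0 <= N)%N ->
  2 * (dz N t * hnorm A alpha (hsub (H N.+1) (H N) (z N t))) <= e.

Local Notation D := (sdist A g).
Local Notation hnorm := (hnorm A alpha).
Local Notation stage := (stage P z).
Local Notation ham := (stage_ham P H z dz).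

(** Which index is picked does not matter, by [stage_stable]; the default 0 is never consulted at
    times below some [T N]. *)
Let index t := xget 0%N [set N | t <= T N].

Definition limit_iso : isotopy R M := Isotopy
  (fun t => if t < 1 then stage (index t) t else PhiH 1)
  (fun t => if t < 1 then bwd (stage (index t)) t else bwd PhiH 1).
(** The value at [t = 1] is 0 because the norms of the corrections tend to 0. *)
Definition limit_ham (t : R) : M -> R := if t < 1 then ham (index t) t else fun=> 0.

Lemma limitE N t : t <= T N ->
  [/\ limit_iso t = stage N t, bwd limit_iso t = bwd (stage N) t & limit_ham t = ham N t].
Proof.
move=> tT; have t1 := le_lt_trans tT (T1 N); rewrite /limit_iso /limit_ham /= t1.
have ti : t <= T (index t) by exact: (xgetPex 0%N (ex_intro (fun N => t <= T N) N tT)).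
case: (leqP (index t) N) => [iN|/ltnW Ni].
  by have [-> -> ->] := stage_stable sP T_lt sz iN ti.
by have [-> -> ->] := stage_stable sP T_lt sz Ni tT.
Qed.

Let ssys N := stage_system hM halpha.1 sP T0 T_lt sz N.

Let Tle := T_le T_lt.

Lemma limit_smooth : smooth_except_at_1 A limit_iso limit_ham.
Proof.
have H1 (t : R) : `[0, 1[%classic t -> exists2 N, t < T N & forall s, s < T N -> `[0, 1[%classic s ->
    [/\ `[0, 1]%classic s, limit_iso s = stage N s, bwd limit_iso s = bwd (stage N) s & limit_ham s = ham N s].
  move=> It; have /andP[t0 t1] : 0 <= t < 1 by move: It; rewrite /= in_itv.
  have [N tN] := T_cofinal t1.
  exists N => // s sN Is; have [-> -> ->] := limitE (ltW sN); split=> //.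
  by move: Is; rewrite /= !in_itv /= => /andP[-> /ltW].
have oT N : open [set s : R | s < T N] by exact: open_lt.
split.
- apply: smooth_family_local => t /H1[N tN HN].
  exists [set s | s < T N], `[0, 1]%classic, (stage N); split=> //.
    by have /smooth_systemE[[]] := ssys N.
  by move=> s sN Is; have [] := HN s sN Is.
- apply: smooth_family_local => t /H1[N tN HN].
  exists [set s | s < T N], `[0, 1]%classic, (bwd (stage N)); split=> //.
    by have /smooth_systemE[[]] := ssys N.
  by move=> s sN Is; have [] := HN s sN Is.
- apply: smooth_family_fun_local => t /H1[N tN HN].
  exists [set s | s < T N], `[0, 1]%classic, (ham N); split=> //.
    exact: (hamiltonian_smooth hM halpha.1 (ssys N)).
  by move=> s sN Is; have [] := HN s sN Is.
Qed.

Lemma limit_inverse : inverse_pair limit_iso.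
Proof.
move=> t t01; have [t1|t1] := ltP t 1.
  have [N tN] := T_cofinal t1; have [-> -> _] := limitE (ltW tN).
  by have [[+ _ _ _] _ _] := ssys N; apply.
by rewrite /limit_iso /= ltNge t1 /=; have [+ _ _] := cPhiH; apply; rewrite ler01 lexx.
Qed.

Lemma limit1 : [/\ limit_iso 1 = PhiH 1, bwd limit_iso 1 = bwd PhiH 1 & limit_ham 1 = fun=> 0].
Proof. by rewrite /limit_iso /limit_ham /= ltxx. Qed.

Definition correction_bound N e := forall k s x, (N <= k)%N -> 0 <= s <= 1 ->
  D (P k 1 (bwd (P k) s (P k.+1 s x))) (PhiH 1 x) < e /\
  D (bwd (P k.+1) s (P k s (bwd (P k) 1 x))) (bwd PhiH 1 x) < e.

(** By induction on [k]: past [T k] the stage [k.+1] is on a correction path, before [T k] it equals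
    the stage [k], and for [k = N] it rests at the time-one map of [P N]. *)
Lemma stage_tail N e k t x : isotopy_close A g (P N) PhiH e -> correction_bound N e ->
  (N <= k)%N -> T N <= t ->
  D (stage k t x) (PhiH 1 x) < e /\ D (bwd (stage k) t x) (bwd PhiH 1 x) < e.
Proof.
move=> cN cb; elim: k t x => [|k IH] t x.
  rewrite leqn0 => /eqP N0 Nt; rewrite N0 in Nt cN *.
  have [-> -> _] := stage_after P0 sP T_lt sz Nt.
  by apply: cN; rewrite ler01 lexx.
rewrite leq_eqVlt => /orP[/eqP Nk|Nk] Nt.
  rewrite -Nk; have [-> -> _] := stage_after P0 sP T_lt sz Nt.
  by apply: cN; rewrite ler01 lexx.
have [kt|/ltW tk] := leP (T k) t.
  have [-> -> _] := stage_formula P0 sP T_lt sz kt.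
  by apply: cb => //; exact: step_itv sz _ _.
by have [-> -> _] := stage_before sP sz tk; exact: IH.
Qed.

Lemma limit_tail N e t x : isotopy_close A g (P N) PhiH e -> correction_bound N e -> 0 < e ->
  T N <= t <= 1 ->
  D (limit_iso t x) (PhiH 1 x) < e /\ D (bwd limit_iso t x) (bwd PhiH 1 x) < e.
Proof.
move=> cN cb e0 /andP[Nt]; rewrite le_eqVlt => /orP[/eqP ->|t1].
  by have [-> -> _] := limit1; rewrite !(sdistxx hM hg).
have [k tk] := T_cofinal t1; have [-> -> _] := limitE (ltW tk).
apply: (stage_tail (N := N)) => //; case: leqP => // /ltnW/Tle; lra.
Qed.

Lemma tail_exists e : 0 < e -> exists N0, forall N, (N0 <= N)%N ->
  isotopy_close A g (P N) PhiH e /\ correction_bound N e.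
Proof.
move=> e0; have [r r0 Hr] := correction_estimate hM hg cPhiH e0.
have [N1 H1] := P_close e0; have [N2 H2] := P_close r0.
exists (maxn N1 N2) => N; rewrite geq_max => /andP[N1N N2N]; split; first exact: H1.
move=> k s x Nk s01; apply: Hr => //; try exact: (system_inverse sP).
- exact/H2/(leq_trans N2N).
- exact/H2/(leq_trans N2N)/leqW.
Qed.

(** Uniform convergence to [f 1] supplies the joint continuity at the final time. *)
Lemma continuous_family_end (f : R -> M -> M) : continuous_family `[0, 1[ f -> continuous (f 1) ->
  (forall e, 0 < e -> exists2 t0, t0 < 1 & forall t x, t0 <= t <= 1 -> D (f t x) (f 1 x) < e) ->
  continuous_family `[0, 1] f.
Proof.
move=> /continuous_familyP cf c1 He; apply/continuous_familyP => t x B It oB Bf.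
have /andP[t0 t1] : 0 <= t <= 1 by move: It; rewrite /= in_itv.
move: t1; rewrite le_eqVlt => /orP[/eqP E1|t1].
  rewrite {}E1 in Bf *; have [e e0 HB] := sdist_nbhs hM hg (open_nbhs_nbhs (conj oB Bf)).
  have [|s0 s01 Hs] := He (e / 2); first by rewrite divr_gt0.
  have : nbhs x (f 1 @^-1` [set y | D (f 1 x) y < e / 2]).
    by apply: c1; apply: (nbhs_sdist hM hg); rewrite divr_gt0.
  rewrite nbhsE => -[V [oV Vx] HV]; exists [set s : R | s0 < s], V; split=> //.
  move=> s y /= ss0 Is Vy; apply: HB; have /= := HV y Vy.
  have := Hs s y; rewrite (ltW ss0) /=; have /andP[_ ->] : 0 <= s <= 1 by move: Is; rewrite in_itv.
  move=> /(_ isT); rewrite (sdistC A g (f s y)).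
  have := sdist_tri hM hg (f 1 x) (f 1 y) (f s y); lra.
have [|U [V [oU oV Ut Vx HUV]]] := cf t x B _ oB Bf; first by rewrite /= in_itv /= t0.
exists (U `&` [set s | s < 1]), V; split=> //; first by apply: openI => //; exact: open_lt.
move=> s y [Us s1] Is Vy; apply: HUV => //; move: Is; rewrite /= !in_itv /= => /andP[-> _] //.
Qed.

Lemma limit_continuous : continuous_isotopy limit_iso.
Proof.
have [s1 s2 _] := limit_smooth; have [iP cP bP] := cPhiH; have [e1 e2 _] := limit1.
have i1 : `[0, 1]%classic (1 : R) by rewrite /= in_itv /= ler01 lexx.
have tail e : 0 < e -> exists2 t0, t0 < 1 & forall t x, t0 <= t <= 1 ->
    D (limit_iso t x) (limit_iso 1 x) < e /\ D (bwd limit_iso t x) (bwd limit_iso 1 x) < e.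
  move=> e0; have [N HN] := tail_exists e0; have [c1 c2] := HN N (leqnn N).
  by exists (T N) => // t x; rewrite e1 e2; exact: limit_tail.
split; first exact: limit_inverse.
- apply: continuous_family_end; [exact: s1.1|by rewrite e1; exact: continuous_family_slice cP i1|].
  by move=> e /tail[t0 t01 Ht]; exists t0 => // t x /(Ht _ x)[].
- apply: continuous_family_end; [exact: s2.1|by rewrite e2; exact: continuous_family_slice bP i1|].
  by move=> e /tail[t0 t01 Ht]; exists t0 => // t x /(Ht _ x)[].
Qed.

Lemma ham_continuous N (t : R) : 0 <= t <= 1 -> continuous (ham N t).
Proof.
move=> t01; apply: (continuous_family_slice (I := `[0, 1]%classic)); last by rewrite /= in_itv.
apply: (smooth_family_fun_continuous hM); exact: (hamiltonian_smooth hM halpha.1 (ssys N)).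
Qed.

(** At a time past [T N] at most one correction moves. Its Hamiltonian is a difference composed with
    a map, and [hnorm_comp] accounts for the 2 in the hypothesis. *)
Lemma ham_tail N b k t : (forall k t, (N <= k)%N ->
    2 * (dz k t * hnorm (hsub (H k.+1) (H k) (z k t))) <= b) -> 0 <= b ->
  (N <= k)%N -> T N <= t <= 1 -> hnorm (ham k t) <= b.
Proof.
move=> Hb b0; elim: k t => [|k IH] t.
  rewrite leqn0 => /eqP N0 /andP[Nt _]; rewrite N0 in Nt.
  have [_ _ e3] := stage_after P0 sP T_lt sz Nt.
  by rewrite (_ : ham 0 t = fun=> 0) ?hnorm0 //; apply/funext.
rewrite leq_eqVlt => /orP[/eqP Nk|Nk] /andP[Nt t1].
  rewrite -Nk; have [_ _ e3] := stage_after P0 sP T_lt sz Nt.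
  by rewrite (_ : ham N t = fun=> 0) ?hnorm0 //; apply/funext.
have [kt|/ltW tk] := leP (T k) t; last first.
  by have [_ _ ->] := stage_before sP sz tk; apply: IH => //; rewrite Nt.
have [_ _ e3] := stage_formula P0 sP T_lt sz kt.
rewrite (_ : ham k.+1 t = fun x => dz k t *
  (hsub (H k.+1) (H k) (z k t) \o (fun x => P k (z k t) (bwd (P k) 1 x))) x); last exact/funext.
have z01 := step_itv sz k t.
have cH j : continuous (H j (z k t)).
  apply: (continuous_family_slice (I := `[0, 1]%classic)); last by rewrite /= in_itv.
  apply: (smooth_family_fun_continuous hM); exact: (hamiltonian_smooth hM halpha.1 (sP j)).
have cH' : continuous (hsub (H k.+1) (H k) (z k t)) by exact: continuous_diff.
have cphi : continuous (fun x => P k (z k t) (bwd (P k) 1 x)).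
  have /smooth_systemE[[_ _ [f1 _] [b1 _]] _ _] := sP k.
  move=> x; apply: continuous_comp.
    by apply: (continuous_family_slice b1); rewrite /= in_itv /= ler01 lexx.
  by apply: (continuous_family_slice f1); rewrite /= in_itv.
have ccomp : continuous (hsub (H k.+1) (H k) (z k t) \o (fun x => P k (z k t) (bwd (P k) 1 x))).
  by move=> x; apply: continuous_comp; [exact: cphi|exact: cH'].
apply: le_trans (hnormZ hM halpha _ ccomp) _.
have [_ _ _ _ /(_ t)[d0 _]] := sz k; rewrite ger0_norm //.
by apply: le_trans (Hb k t Nk); rewrite mulrCA ler_wpM2l // hnorm_comp.
Qed.

Lemma limit_ham_tail N b t : (forall k t, (N <= k)%N ->
    2 * (dz k t * hnorm (hsub (H k.+1) (H k) (z k t))) <= b) -> 0 <= b ->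
  T N <= t <= 1 -> hnorm (limit_ham t) <= b.
Proof.
move=> Hb b0 /andP[Nt]; rewrite le_eqVlt => /orP[/eqP ->|t1].
  by have [_ _ ->] := limit1; rewrite hnorm0.
have [k tk] := T_cofinal t1; have [_ _ ->] := limitE (ltW tk).
apply: (ham_tail (N := N)) => //; last by rewrite Nt ltW.
by case: leqP => // /ltnW/Tle; lra.
Qed.

(** Stage and limit agree up to [T N]; afterwards both stay near [PhiH 1]. *)
Lemma stage_cvg : dbar (rdist A g) (stage i) limit_iso @[i --> \oo] --> (0 : R).
Proof.
have dbar0 Phi Psi : 0 <= dbar (rdist A g) Phi Psi.
  have [_ _ _ _ [x0 _]] := hM; have i0 : 0 <= (0 : R) <= 1 by rewrite lexx ler01.
  apply: le_trans (le_dbar hM hg Phi Psi x0 x0 i0).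
  by rewrite addr_ge0 // (rdist_ge0 hM hg).
apply/cvgrPdist_le => e e0; have e40 : 0 < e / 4 by rewrite divr_gt0.
have [N0 HN] := tail_exists e40; near=> N.
rewrite sub0r normrN ger0_norm //.
have N0N : (N0 <= N)%N by near: N; exact: nbhs_infty_ge.
have [c1 c2] := HN N N0N.
have e2 : 0 < e / 2 by lra.
apply: (@le_trans _ _ (e / 2 + e / 2)); last by rewrite -splitr.
apply: (close_dbar hM hg) => t x t01.
have [Nt|/ltW tN] := leP (T N) t; last first.
  by have [-> -> _] := limitE tN; rewrite !(sdistxx hM hg).
have [a1 a2] := stage_tail x c1 c2 (leqnn N) Nt.
have [||b1 b2] := @limit_tail N (e / 4) t x c1 c2; [by []|by case/andP: t01 => _ ->; rewrite Nt|].
have := sdist_tri hM hg (stage N t x) (PhiH 1 x) (limit_iso t x).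
have := sdist_tri hM hg (bwd (stage N) t x) (bwd PhiH 1 x) (bwd limit_iso t x).
rewrite (sdistC A g (PhiH 1 x)) (sdistC A g (bwd PhiH 1 x)); split; lra.
Unshelve. all: by end_near. Qed.

Lemma limit_ham_continuous (t : R) : 0 <= t <= 1 -> continuous (limit_ham t).
Proof.
move=> t01; have [t1|t1] := ltP t 1.
  by have [N tN] := T_cofinal t1; have [_ _ ->] := limitE (ltW tN); exact: ham_continuous.
by rewrite /limit_ham ltNge t1; exact: cst_continuous.
Qed.

(** Past [T N] the Hamiltonian of the stage is 0, so the difference is the tail of [limit_ham],
    which is uniformly small. *)
Lemma ham_cvg : normoo A alpha (hsub limit_ham (ham i)) @[i --> \oo] --> (0 : \bar R).
Proof.
(* Both bounds are needed, as finiteness in the extended reals has to be established along with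
   convergence. *)
have H1 e : 0 < e -> \forall i \near \oo, (0 <= normoo A alpha (hsub limit_ham (ham i)) <= e%:E)%E.
  move=> e0; have [N0 HN] := H_small e0; near=> N.
  have N0N : (N0 <= N)%N by near: N; exact: nbhs_infty_ge.
  have cd (t : R) : 0 <= t <= 1 -> continuous (hsub limit_ham (ham N) t).
    by move=> t01; apply: continuous_diff; [exact: limit_ham_continuous|exact: ham_continuous].
  apply/andP; split.
    apply: (@le_trans _ _ (hnorm (hsub limit_ham (ham N) 0))%:E).
      by rewrite lee_fin (hnorm_ge0 alpha hM) //; apply: cd; rewrite lexx ler01.
    by apply: ereal_sup_ubound; exists 0 => //; rewrite /= in_itv /= lexx ler01.
  apply: ge_ereal_sup => _ [t + <-]; rewrite /= in_itv /= => t01; rewrite lee_fin.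
  have [Nt|/ltW tN] := leP (T N) t; last first.
    have [_ _ e3] := limitE tN; rewrite (_ : hsub _ _ t = fun=> 0) ?hnorm0 ?ltW //.
    by apply/funext => x; rewrite /hsub e3 subrr.
  have [_ _ e3] := stage_after P0 sP T_lt sz Nt.
  rewrite (_ : hsub _ _ t = limit_ham t); last by apply/funext => x; rewrite /hsub e3 subr0.
  apply: (limit_ham_tail (N := N)) => // [k s Nk||]; [exact/HN/(leq_trans N0N)|exact: ltW|].
  by case/andP: t01 => _ ->; rewrite Nt.
apply/fine_cvgP; split.
  apply: filterS (H1 1 ltr01) => i /andP[i0 i1].
  by rewrite fin_numE; apply/andP; split; apply/eqP => E1; move: i0 i1; rewrite E1.
apply/cvgrPdist_le => e e0; apply: filterS (H1 e e0) => i /= /andP[].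
by case: (normoo _ _ _) => [r||] //; rewrite !lee_fin /= sub0r normrN => r0; rewrite ger0_norm.
Unshelve. all: by end_near. Qed.

Theorem limit_system : [/\ continuous_system A alpha g limit_iso limit_ham,
  limit_iso 1 = PhiH 1 & smooth_except_at_1 A limit_iso limit_ham].
Proof.
split; [|by have [-> _ _] := limit1|exact: limit_smooth].
split; [exact: limit_continuous|exact: limit_ham_continuous|].
by exists stage, ham; split; [exact: ssys|exact: stage_cvg|exact: ham_cvg].
Qed.

End Limit.

(** * Choice of the approximating systems and of the times *)

Section Construction.
Context {R : realType} {n : nat} {M : topologicalType}.
Local Notation E := 'rV[R]_((n.*2).+1).
Local Notation chart := (chart R n.*2 M).
Context (A : set chart) (alpha : chart -> E -> E) (g : chart -> E -> 'M[R]_((n.*2).+1)).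
Hypothesis hM : closed_connected_manifold A.
Hypothesis halpha : contact_form A alpha.
Hypothesis hg : riemannian_metric A g.
Context (PhiH : isotopy R M) (H : R -> M -> R).
Hypothesis hH : topological_system A alpha g PhiH H.

Local Notation D := (sdist A g).
Local Notation hnorm := (hnorm A alpha).
Local Notation norm1oo := (norm1oo A alpha).

Lemma hamiltonian_continuous Phi K : smooth_system A alpha Phi K -> continuous_family `[0, 1] K.
Proof.
by move=> s; apply: (smooth_family_fun_continuous hM); exact: (hamiltonian_smooth hM halpha.1 s).
Qed.

Lemma norm1oo_ge0 K : (forall t : R, 0 <= t <= 1 -> continuous (K t)) -> (0 <= norm1oo K)%E.
Proof.
move=> cK; apply: integral_ge0 => t; rewrite /= in_itv /= => t01.
by rewrite lee_fin (hnorm_ge0 alpha hM) //; exact: cK.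
Qed.

(** Terms of the given sequence are picked for rates prescribed in advance; their indices need not
    increase. *)
Lemma choose_systems (r k : nat -> R) : (forall N, 0 < r N) -> (forall N, 0 < k N) ->
  exists (P : nat -> isotopy R M) (K : nat -> R -> M -> R), forall N,
    [/\ smooth_system A alpha (P N) (K N), isotopy_close A g (P N) PhiH (r N) &
      (norm1oo (hsub H (K N)) < (k N)%:E)%E].
Proof.
move=> r0 k0; have [_ [cH _ _] [Phi_ [H_ [sH dH nH]]]] := hH.
have /choice[i Hi] N : exists i, isotopy_close A g (Phi_ i) PhiH (r N) /\
    (norm1oo (hsub H (H_ i)) < (k N)%:E)%E.
  have [e e0 He] := dbar_lt_close hM hg (r0 N).
  have /fine_cvgP[fin cfin] := nH.
  have H1 : \forall i \near \oo, dbar (rdist A g) (Phi_ i) PhiH < e.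
    have /cvgrPdist_lt/(_ e e0) := dH; apply: filterS => i.
    by rewrite sub0r normrN; apply: le_lt_trans; exact: ler_norm.
  have H2 : \forall i \near \oo, fine (norm1oo (hsub H (H_ i))) < k N.
    have /cvgrPdist_lt/(_ _ (k0 N)) := cfin; apply: filterS => i /=.
    by rewrite sub0r normrN; apply: le_lt_trans; exact: ler_norm.
  near \oo => i; exists i; split.
    by apply: He; near: i.
  have finI : norm1oo (hsub H (H_ i)) \is a fin_num by near: i.
  by rewrite -(fineK finI) lte_fin; near: i.
exists (Phi_ \o i), (H_ \o i) => N; have [] := Hi N; split=> //; exact: sH.
Unshelve. all: by end_near. Qed.

Let q N : R := 2^-1 ^+ N.

Let q0 N : 0 < q N. Proof. by rewrite exprn_gt0 // invr_gt0. Qed.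
Let qS N : q N.+1 = q N / 2. Proof. by rewrite /q exprSr. Qed.
Let q1 N : q N <= 1.
Proof. by elim: N => [|N IH]; [rewrite /q expr0|rewrite qS; have := q0 N; lra]. Qed.
Let q_small e : 0 < e -> exists N0, forall N, (N0 <= N)%N -> q N < e.
Proof.
move=> e0; have : geometric 1 (2^-1 : R) @ \oo --> (0 : R).
  by apply: cvg_geometric; rewrite ger0_norm ?invr_ge0 // invf_lt1 // ltr1n.
move=> /cvgrPdist_lt/(_ e e0)[N0 _ HN]; exists N0 => N N0N; have := HN N N0N.
by rewrite /= sub0r normrN mul1r ger0_norm // ltW.
Qed.

(** The order of the quantifiers is the point: [Phi1] and [H1] depend on [e] and [k] only, and
    [delta] and the first step [z] may be chosen in terms of them. The families [G] are the
    Hamiltonians of the stages, which at each time are eventually equal to [F t]; they serve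
    measurability. *)
Lemma limit_construction (e k : R) : 0 < e -> 0 < k ->
  exists (Phi1 : isotopy R M) (H1 : R -> M -> R),
  [/\ smooth_system A alpha Phi1 H1, isotopy_close A g Phi1 PhiH e, (norm1oo (hsub H H1) < k%:E)%E &
    forall (delta : R) (z dz : R -> R), 0 < delta < 1 -> smooth_step 0 (1 - delta) z dz ->
    exists (PhiF : isotopy R M) (F : R -> M -> R),
    [/\ [/\ continuous_system A alpha g PhiF F, PhiF 1 = PhiH 1 & smooth_except_at_1 A PhiF F],
      forall t : R, 0 <= t <= 1 - delta -> [/\ PhiF t = Phi1 (z t), bwd PhiF t = bwd Phi1 (z t) &
        F t = fun x => dz t * H1 (z t) x],
      forall (t : R) x, 1 - delta <= t <= 1 -> D (PhiF t x) (PhiH 1 x) < e /\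
        D (bwd PhiF t x) (bwd PhiH 1 x) < e,
      forall t : R, 1 - delta <= t <= 1 -> hnorm (F t) <= k / delta &
      exists G : nat -> R -> M -> R, (forall k, continuous_family `[0, 1] (G k)) /\
        (forall t : R, 0 <= t <= 1 -> \forall k \near \oo, G k t = F t)]].
Proof.
move=> e0 k0; have [cPhiH [cH mH _] _] := hH.
have [r r0 Hr] := correction_estimate hM hg cPhiH e0.
(* The interval from [T N.+1] to [T N.+2] will have length [delta * q N.+1]; dividing by it leaves
   [(k / delta) * q N / 2], which cancels the factor 2 and tends to 0 for any [delta]. *)
pose I N : R := k * q N * q N.+1 / 2.
have I0 N : 0 < I N by rewrite divr_gt0 // !mulr_gt0.
have IS N : I N.+1 <= I N.
  have := mulr_gt0 k0 (mulr_gt0 (q0 N) (q0 N)).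
  by rewrite /I !qS; lra.
pose r' := Num.min r e.
have r'0 : 0 < r' by rewrite lt_min r0.
(* Consecutive Hamiltonians are compared through [H], and [I] does not increase, whence the halves;
   the minimum with [k] is for the first system. *)
pose k' N := Num.min k (I N / 2).
have k'0 N : 0 < k' N by rewrite lt_min k0 divr_gt0.
have [P [K HP]] := choose_systems (r := fun N => r' * q N) (k := k') (fun N => mulr_gt0 r'0 (q0 N)) k'0.
have cK N : continuous_family `[0, 1] (K N) by have [/hamiltonian_continuous] := HP N.
have nK N : (norm1oo (hsub (K N.+1) (K N)) < (I N)%:E)%E.
  apply: (le_lt_trans (norm1ooB hM halpha cH mH (cK N.+1) (cK N))).
  have [_ _ a1] := HP N; have [_ _ a2] := HP N.+1.
  have : (norm1oo (hsub H (K N.+1)) + norm1oo (hsub H (K N)) < (k' N.+1)%:E + (k' N)%:E)%E.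
    exact: lteD.
  move=> /lt_le_trans; apply; rewrite -EFinD lee_fin.
  have h1 : k' N <= I N / 2 by rewrite ge_min lexx orbT.
  have h2 : k' N.+1 <= I N.+1 / 2 by rewrite ge_min lexx orbT.
  by have := IS N; lra.
have [s1 c1 n1] := HP 0%N.
exists (P 0%N), (K 0%N); split=> //.
- by move=> t x t01; have [] := c1 t x t01; rewrite /q expr0 mulr1 /r' !lt_min => /andP[_ ->] /andP[_ ->].
- by apply: lt_le_trans n1 _; rewrite lee_fin ge_min lexx.
move=> delta z dz /andP[d0 d1] sz; pose b := k / delta.
have b0 : 0 < b by rewrite divr_gt0.
(* The first stage occupies [[0, 1 - delta]]; each later stage takes half of the time that is
   left. *)
pose T N : R := if N is N'.+1 then 1 - delta * q N' else 0.
have T_lt N : T N < T N.+1.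
  case: N => [|N] /=; first by rewrite /q expr0; lra.
  by rewrite ltrD2l ltrN2 qS; have := mulr_gt0 d0 (q0 N); lra.
have T1 N : T N < 1 by case: N => [|N] //=; have := mulr_gt0 d0 (q0 N); lra.
have /choice[zz Hzz] N : exists zz : (R -> R) * (R -> R), smooth_step (T N.+1) (T N.+2) zz.1 zz.2 /\
    forall t, 2 * (zz.2 t * hnorm (hsub (K N.+1) (K N) (zz.1 t))) <= b * q N.
  have cd : continuous_family `[0, 1] (hsub (K N.+1) (K N)) by exact: continuous_family_sub.
  have [y [dy [sy Hy]]] := norm_time_change hM halpha cd (T_lt N.+1) (nK N).
  exists (y, dy); split=> //= t; have := Hy t.
  have -> : I N / (T N.+2 - T N.+1) = b * q N / 2.
    rewrite (_ : T N.+2 - T N.+1 = delta * q N.+1); last by rewrite /T qS; field.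
    have := lt0r_neq0 d0; have := lt0r_neq0 (q0 N.+1) => qn dn; rewrite /I /b; field; exact/andP.
  by lra.
(* The identity is put in front, which shifts the chosen systems by one; the first step is the given
   [z]. *)
pose P' N := if N is N'.+1 then P N' else id_isotopy.
pose K' N : R -> M -> R := if N is N'.+1 then K N' else fun _ _ => 0.
pose z' N := if N is N'.+1 then (zz N').1 else z.
pose dz' N := if N is N'.+1 then (zz N').2 else dz.
have sP N : smooth_system A alpha (P' N) (K' N).
  by case: N => [|N] /=; [exact: smooth_system_id hM halpha.1|have [] := HP N].
have sz' N : smooth_step (T N) (T N.+1) (z' N) (dz' N).
  case: N => [|N] /=; last by have [] := Hzz N.
  by move: sz; rewrite /q expr0 mulr1.
have cofinal t : t < 1 -> exists N, t < T N.
  move=> t1; have [|N0 HN] := q_small (e := (1 - t) / delta); first by rewrite divr_gt0 // subr_gt0.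
  by exists N0.+1; have := HN N0 (leqnn _); rewrite ltr_pdivlMr // /= mulrC; lra.
have close e' : 0 < e' -> exists N0, forall N, (N0 <= N)%N -> isotopy_close A g (P' N) PhiH e'.
  move=> e'0; have [|N0 HN] := q_small (e := e' / r'); first by rewrite divr_gt0.
  exists N0.+1 => -[//|N] N0N t x t01; have [_ + _] := HP N => /(_ t x t01)[].
  have := HN N N0N; rewrite ltr_pdivlMr // mulrC => qe.
  by move=> /lt_trans/(_ qe) a1 /lt_trans/(_ qe).
have small e' : 0 < e' -> exists N0, forall N t, (N0 <= N)%N ->
    2 * (dz' N t * hnorm (hsub (K' N.+1) (K' N) (z' N t))) <= e'.
  move=> e'0; have [|N0 HN] := q_small (e := e' / b); first by rewrite divr_gt0.
  exists N0.+1 => -[//|N] t N0N; have [_ /(_ t)] := Hzz N; move/le_trans; apply.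
  by have := HN N N0N; rewrite ltr_pdivlMr // mulrC => /ltW.
have T1E : T 1%N = 1 - delta by rewrite /T /q expr0 mulr1.
have corr : correction_bound A g PhiH P' 1 e.
  move=> -[//|k1] s x _ s01 /=.
  have cl N : isotopy_close A g (P N) PhiH r.
    move=> t y t01; have [_ + _] := HP N => /(_ t y t01)[].
    have qr : r' * q N <= r.
      have rr : r' <= r by rewrite ge_min lexx.
      by have := ler_pM (ltW r'0) (ltW (q0 N)) rr (q1 N); rewrite mulr1.
    by move=> /lt_le_trans/(_ qr) a1 /lt_le_trans/(_ qr).
  by apply: Hr => //; [exact: (system_inverse sP k1.+1)|exact: (system_inverse sP k1.+2)].
have close1 : isotopy_close A g (P' 1%N) PhiH e.
  by move=> t x t01; have [] := c1 t x t01; rewrite /q expr0 mulr1 /r' !lt_min => /andP[_ ->] /andP[_ ->].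
pose PhiF := limit_iso PhiH P' T z'; pose F := limit_ham P' K' T z' dz'.
have LE := limitE PhiH sP T_lt T1 sz'.
exists PhiF, F; split.
- exact: (limit_system hM halpha hg cPhiH _ sP _ T_lt T1 cofinal sz' close small).
- move=> t /andP[t0 t1]; rewrite /F; have [|-> -> ->] := LE 1%N t; first by rewrite T1E.
  exact: (first_stage _ _ sP _ T_lt sz').
- move=> t x t1; apply: (limit_tail hM hg _ sP T_lt T1 cofinal sz' (N := 1%N)) => //; rewrite ?T1E //.
- move=> t t1; apply: (limit_ham_tail hM halpha PhiH _ sP T_lt T1 cofinal sz' (N := 1%N)) => //.
  + move=> [//|k1] s _; have [_ /(_ s)] := Hzz k1; move/le_trans; apply.
    by rewrite ger_pMr // q1.
  + exact: ltW.
  + by rewrite T1E.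
exists (stage_ham P' K' z' dz'); split=> [k1|t t01].
  exact: (hamiltonian_continuous (stage_system hM halpha.1 sP _ T_lt sz' k1)).
have [t1|t1] := ltP t 1; last first.
  have E1 : t = 1 by apply/eqP; rewrite eq_le t1 andbT; case/andP: t01.
  rewrite E1; near=> k1; have [_ _ e3] := stage_after (erefl _) sP T_lt sz' (ltW (T1 k1)).
  by apply/funext => x; rewrite e3 /F /limit_ham ltxx.
have [N tN] := cofinal t t1; near=> k1.
have Nk : (N <= k1)%N by near: k1; exact: nbhs_infty_ge.
have [_ _ e3] := stage_stable sP T_lt sz' Nk (ltW tN).
by have [_ _ e4] := LE N t (ltW tN); rewrite /F e4 e3.
Unshelve. all: by end_near. Qed.

End Construction.

(** * The two estimates *)

Section Estimates.
Context {R : realType} {n : nat} {M : topologicalType}.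
Local Notation E := 'rV[R]_((n.*2).+1).
Local Notation chart := (chart R n.*2 M).
Context (A : set chart) (alpha : chart -> E -> E) (g : chart -> E -> 'M[R]_((n.*2).+1)).
Hypothesis hM : closed_connected_manifold A.
Hypothesis halpha : contact_form A alpha.
Hypothesis hg : riemannian_metric A g.
Context (PhiH : isotopy R M) (H : R -> M -> R).
Hypothesis hH : topological_system A alpha g PhiH H.

Local Notation D := (sdist A g).
Local Notation hnorm := (hnorm A alpha).
Local Notation norm1oo := (norm1oo A alpha).

(** [PhiF t] is near [PhiH s] for some [s], possibly far from [t]: the time change is governed by
    the norm. This is enough to compare distances to the identity. *)
Lemma uniform_approximation (eps : R) : 0 < eps ->
  exists (PhiF : isotopy R M) (F : R -> M -> R),
    [/\ continuous_system A alpha g PhiF F, PhiF 1 = PhiH 1, smooth_except_at_1 A PhiF F,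
        dbar (rdist A g) PhiF id_isotopy < dbar (rdist A g) PhiH id_isotopy + eps &
        (normoo A alpha F < norm1oo H + eps%:E)%E].
Proof.
move=> eps0; have [_ [cH mH Hfin] _] := hH.
have nH0 := norm1oo_ge0 alpha hM cH.
have [I IE I0] : exists2 I : R, norm1oo H = I%:E & 0 <= I.
  move: Hfin nH0; case: (norm1oo H) => [I|//|//] _.
  by rewrite lee_fin; exists I.
(* Then [(1 - delta) * (I + eps / 2) = I + eps / 8], so compressing the first stage to length
   [1 - delta] raises the bound [I + k] to at most [I + eps / 2]. *)
pose delta := (3 * eps / 8) / (I + eps / 2).
have Ie : 0 < I + eps / 2 by lra.
have d0 : 0 < delta by rewrite divr_gt0 //; lra.
have dE : delta * (I + eps / 2) = 3 * eps / 8 by rewrite /delta divfK ?lt0r_neq0.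
have d1 : delta < 1 by rewrite /delta ltr_pdivrMr //; lra.
(* The second entry keeps the tail bound [k / delta] below [eps / 2]. *)
pose k := Num.min (eps / 8) (delta * (eps / 2)).
have k0 : 0 < k by rewrite lt_min; apply/andP; split; [lra|rewrite mulr_gt0 //; lra].
have k1 : k <= eps / 8 by rewrite ge_min lexx.
have k2 : k / delta <= eps / 2 by rewrite ler_pdivrMr // mulrC ge_min lexx orbT.
have e0 : 0 < eps / 8 by lra.
have [Phi1 [H1 [s1 cl1 n1 HF]]] := limit_construction hM halpha hg hH e0 k0.
have cK := hamiltonian_continuous hM halpha s1.
have nH1 : (norm1oo H1 < (I + k)%:E)%E.
  apply: (le_lt_trans (norm1oo_le hM halpha cH mH cK)).
  by rewrite IE EFinD lteD2lE.
have d1' : 0 < 1 - delta by rewrite subr_gt0.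
have [z [dz [sz Hz]]] := norm_time_change hM halpha cK d1' nH1.
have [|PhiF [F [[cF F1 sF] Ha Hb Hc _]]] := HF delta z dz _ sz; first by rewrite d0.
have bound t : dz t * hnorm (H1 (z t)) <= I + eps / 2.
  apply: (le_trans (Hz t)); rewrite subr0 ler_pdivrMr // mulrBr mulr1 (mulrC _ delta) dE.
  by lra.
exists PhiF, F; split=> //.
  apply: (@le_lt_trans _ _ (dbar (rdist A g) PhiH id_isotopy + (eps / 8 + eps / 8))); last by lra.
  have near t : 0 <= t <= 1 -> exists2 s, 0 <= s <= 1 & forall x,
      D (PhiF t x) (PhiH s x) < eps / 8 /\ D (bwd PhiF t x) (bwd PhiH s x) < eps / 8.
    move=> /andP[t0 t1]; have [td|/ltW td] := leP t (1 - delta).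
      exists (z t) => [|x]; first exact: smooth_step_itv sz.
      have [|-> -> _] := Ha t; first by rewrite t0.
      by apply: cl1; exact: smooth_step_itv sz.
    by exists 1; [rewrite ler01 lexx|move=> x; apply: Hb; rewrite td].
  apply: (dbar_le hM) => t x y /near[s s01 Hs].
  have := le_dbar hM hg PhiH id_isotopy x y s01; rewrite /=.
  have [a1 _] := Hs x; have [_ a2] := Hs y.
  have := rdist_tri hM hg (PhiF t x) (PhiH s x) x.
  have := rdist_tri hM hg (bwd PhiF t y) (bwd PhiH s y) y.
  have := rdist_sdist hM hg (PhiF t x) (PhiH s x).
  have := rdist_sdist hM hg (bwd PhiF t y) (bwd PhiH s y).
  lra.
rewrite IE -EFinD; apply: (@le_lt_trans _ _ (I + eps / 2)%:E); last by rewrite lte_fin; lra.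
apply: ge_ereal_sup => _ [t + <-]; rewrite /= in_itv /= => /andP[t0 t1]; rewrite lee_fin.
have [td|/ltW td] := leP t (1 - delta); last first.
  by apply: (le_trans (Hc t _)); [rewrite td|lra].
have [|_ _ ->] := Ha t; first by rewrite t0.
have cHz : continuous (H1 (z t)).
  by apply: (continuous_family_slice cK); rewrite /= in_itv; exact: smooth_step_itv sz.
apply: (le_trans (hnormZ hM halpha _ cHz)).
by have [_ _ _ _ /(_ t)[dz0 _]] := sz; rewrite ger0_norm.
Qed.

Lemma hnorm_family_bounded (K : R -> M -> R) : continuous_family `[0, 1] K ->
  exists2 B : R, 0 < B & forall t : R, 0 <= t <= 1 -> hnorm (K t) <= B.
Proof.
move=> cK; pose k t := hnorm (K (clamp t)).
have ck : continuous k by apply: uniform_continuous => e; exact: norm_family_uniform.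
have [|c _ Hc] := @EVT_max R k 0 1 ler01; first exact: continuous_subspaceT.
exists (`|k c| + 1) => [|t t01]; first by rewrite ltr_pwDr.
have := Hc t; rewrite in_itv /= => /(_ t01); rewrite /k (clamp_id t01) => /le_trans; apply.
by apply: (le_trans (ler_norm _)); rewrite lerDl.
Qed.

(** The slope bound gives an upper bound when integrated from 0, where [z] is 0, and a lower bound
    when integrated back from [1 - delta], where [z] is 1. *)
Lemma step_near_identity (delta m : R) (z dz : R -> R) : 0 < delta < 1 -> smooth_step 0 (1 - delta) z dz ->
  (forall x, dz x <= 1 + m) -> forall t, 0 <= t <= 1 - delta -> `|z t - t| <= m.
Proof.
move=> /andP[d0 d1] [_ dzz z0 z1 dz0] dm t /andP[t0 td].
have b1 := mvt_ge t0 dzz (fun x _ => dm x); have b2 := mvt_ge td dzz (fun x _ => dm x).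
rewrite (z0 0) // in b1; rewrite (z1 (1 - delta)) // in b2.
have m0 : 0 <= m.
  have : 0 <= 1 - delta by lra.
  move=> /mvt_ge/(_ dzz (fun x _ => dm x)); rewrite (z0 0) // (z1 (1 - delta)) // !subr0 => b3.
  by rewrite leNgt; apply/negP => m0; nra.
have mt : 0 <= m * t by rewrite mulr_ge0.
have mt1 : 0 <= m * (1 - delta - t) by rewrite mulr_ge0 //; lra.
have md : 0 <= m * delta by rewrite mulr_ge0 // ltW.
by rewrite ler_norml; apply/andP; split; lra.
Qed.

Lemma tail_indicator (delta : R) : 0 < delta < 1 ->
  (\int[lebesgue_measure]_(t in `[0%R, 1%R]) (\1_(`[1 - delta, 1]%classic : set R) t)%:E = delta%:E)%E.
Proof.
move=> /andP[d0 d1]; rewrite integral_indic //= setIidl ?lebesgue_measure_itv /= ?lte_fin.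
  rewrite ltrBlDr ltrDl d0 -EFinB; congr (_%:E); ring.
by move=> t /=; rewrite !in_itv /= => /andP[t1 ->]; rewrite andbT; lra.
Qed.

Lemma smooth_step_derivative_continuous (a b : R) (z dz : R -> R) : smooth_step a b z dz -> continuous dz.
Proof.
move=> [sz dzz _ _ _]; have -> : dz = 'D_1 z by apply/funext => x; have [_ ->] := dzz x.
have [_ /(_ 1)[_ c1]] := sz 1%N; move=> x; exact: (c1.1 x Logic.I).
Qed.

(** On the first stage [F - K] is [K (z t) - K t] plus [(dz t - 1) * K (z t)]. Since
    [dz t <= 1 + m], the absolute value of [dz t - 1] is at most [1 + 2 * m - dz t], which unlike it
    has an explicit integral. On the tail [dz] vanishes, and the same term covers the norm of
    [K]. *)
Lemma difference_bound (F K : R -> M -> R) (B m w c delta : R) (z dz : R -> R) :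
  continuous_family `[0, 1] K -> (forall t : R, 0 <= t <= 1 -> hnorm (K t) <= B) -> 0 <= B -> 0 <= m ->
  smooth_step 0 (1 - delta) z dz -> (forall t, dz t <= 1 + m) ->
  (forall t : R, 0 <= t <= 1 -> continuous (F t)) -> 0 <= w -> 0 <= c ->
  (forall t x, 0 <= t <= 1 - delta -> `|K (z t) x - K t x| <= w) ->
  (forall t, 0 <= t <= 1 - delta -> F t = fun x => dz t * K (z t) x) ->
  (forall t, 1 - delta <= t <= 1 -> hnorm (F t) <= c) ->
  forall t : R, 0 <= t <= 1 ->
    hnorm (hsub F K t) <= B * (1 + 2 * m - dz t) + 3 * w + c * \1_(`[1 - delta, 1]%classic) t.
Proof.
move=> cK HB B0 m0 sz dz1 cF w0 c0 Hw Ha Hc t t01; have /andP[t0 t1] := t01.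
have cKt (s : R) : 0 <= s <= 1 -> continuous (K s).
  by move=> s01; apply: (continuous_family_slice cK); rewrite /= in_itv.
have z01 : 0 <= z t <= 1 by exact: smooth_step_itv sz.
have [td|/ltW td] := leP (1 - delta) t.
  have dzt : dz t = 0.
    by have [_ _ _ _ /(_ t)[_ +]] := sz; apply => /andP[_]; rewrite ltNge td.
  have tS : \1_(`[1 - delta, 1]%classic : set R) t = 1 :> R by rewrite indicE mem_set //= in_itv /= td.
  have : hnorm (hsub F K t) <= hnorm (F t) + hnorm (K t) by exact: (hnorm_sub hM halpha (cF t t01) (cKt t t01)).
  have := Hc t; rewrite td t1 => /(_ isT); have := HB t t01.
  by rewrite dzt tS mulr1 subr0; have := mulr_ge0 B0 m0; lra.
have t0d : 0 <= t <= 1 - delta by rewrite t0.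
have cd : continuous (fun x => K (z t) x - K t x) by apply: continuous_diff; exact: cKt.
rewrite (_ : hsub F K t = fun x => (K (z t) x - K t x) + (dz t - 1) * K (z t) x); last first.
  by apply/funext => x; rewrite /hsub Ha //; ring.
apply: (le_trans (hnorm_lincomb hM halpha _ cd (cKt _ z01))).
apply: ler_wpDr; first by rewrite mulr_ge0.
rewrite addrC; apply: lerD; last by apply: (hnorm_le_bound hM halpha cd) => x; exact: Hw.
rewrite mulrC; apply: ler_pM => //.
- exact: (hnorm_ge0 alpha hM (cKt _ z01)).
- exact: HB.
- by rewrite ler_norml; have := dz1 t; lra.
Qed.

(** [z] climbs from 0 to 1, so the integral of [dz] is 1 and only the excess [2 * m] remains. *)
Lemma integral_step_excess (B m w delta : R) (z dz : R -> R) : 0 < delta < 1 -> smooth_step 0 (1 - delta) z dz ->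
  (\int[lebesgue_measure]_(t in `[0%R, 1%R]) (B * (1 + 2 * m - dz t) + w)%:E = (B * (2 * m) + w)%:E)%E.
Proof.
move=> /andP[d0 _] sz; have [_ dzz z0 z1 _] := sz.
have cdz := smooth_step_derivative_continuous sz.
have dP (x : R) : is_derive x (1 : R) (fun x => B * ((1 + 2 * m) * x - z x) + w * x) (B * (1 + 2 * m - dz x) + w).
  by have h := dzz x; apply: is_derive_eq; rewrite /GRing.scale /=; ring.
rewrite (integral_derive01 _ dP).
  by rewrite (z0 0) // (z1 1) ?gerBl ?ltW //; congr (_%:E); ring.
move=> x; apply: (@cvgD R R _ (nbhs x)); last exact: cst_continuous.
apply: (@cvgM R _ (nbhs x)); first exact: cst_continuous.
by apply: (@cvgB R R _ (nbhs x)); [exact: cst_continuous|exact: cdz].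
Qed.

(** The bound [c] on the tail is paid only over a time [delta], which permits [c] to be of order
    [1 / delta]. *)
Lemma integral_difference_bound (F K : R -> M -> R) (G : nat -> R -> M -> R) (B m w c delta : R)
    (z dz : R -> R) : 0 < delta < 1 ->
  continuous_family `[0, 1] K -> (forall t : R, 0 <= t <= 1 -> hnorm (K t) <= B) -> 0 <= B -> 0 <= m ->
  smooth_step 0 (1 - delta) z dz -> (forall t, dz t <= 1 + m) ->
  (forall t : R, 0 <= t <= 1 -> continuous (F t)) -> 0 <= w -> 0 <= c ->
  (forall t x, 0 <= t <= 1 - delta -> `|K (z t) x - K t x| <= w) ->
  (forall t, 0 <= t <= 1 - delta -> F t = fun x => dz t * K (z t) x) ->
  (forall t, 1 - delta <= t <= 1 -> hnorm (F t) <= c) ->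
  (forall k, continuous_family `[0, 1] (G k)) ->
  (forall t : R, 0 <= t <= 1 -> \forall k \near \oo, G k t = F t) ->
  (norm1oo (hsub F H) <= (B * (2 * m) + 3 * w + c * delta)%:E + norm1oo (hsub H K))%E.
Proof.
move=> d01 cK HB B0 m0 sz dz1 cF w0 c0 Hw Ha Hc cG GF; have [_ [cH mH _] _] := hH.
pose b1 (t : R) := B * (1 + 2 * m - dz t) + 3 * w.
pose b2 (t : R) := c * \1_(`[1 - delta, 1]%classic : set R) t.
have mb1 : measurable_fun (`[0, 1]%classic : set R) b1.
  apply: measurable_funTS; apply: measurable_realfun.continuous_measurable_fun => x.
  apply: (@cvgD R R _ (nbhs x)); last exact: cst_continuous.
  apply: (@cvgM R _ (nbhs x)); first exact: cst_continuous.
  apply: (@cvgB R R _ (nbhs x)); first exact: cst_continuous.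
  exact: smooth_step_derivative_continuous sz _.
have mS : measurable (`[1 - delta, 1]%classic : set (measurableTypeR R)) by exact: measurable_itv.
have mb2 : measurable_fun (`[0, 1]%classic : set R) b2.
  by apply: measurable_realfun.measurable_funM => //; exact: measurable_realfun.measurable_indic.
have b10 t : 0 <= b1 t.
  by rewrite /b1; apply: addr_ge0; [rewrite mulr_ge0 //; have := dz1 t; lra|rewrite mulr_ge0].
have b20 t : 0 <= b2 t by rewrite /b2 mulr_ge0.
have mb : measurable_fun (`[0, 1]%classic : set R) (b1 \+ b2) by exact: measurable_realfun.measurable_funD.
apply: (le_trans (norm1oo_hsub hM halpha cH mH cF cG GF cK mb
  (difference_bound cK HB B0 m0 sz dz1 cF w0 c0 Hw Ha Hc))).
apply: leeD2r; rewrite EFinD -(integral_step_excess B m (3 * w) d01 sz).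
have <- : (\int[lebesgue_measure]_(t in `[0%R, 1%R]) (b2 t)%:E)%E = (c * delta)%:E.
  rewrite /b2; under eq_integral do rewrite EFinM.
  rewrite ge0_integralZl_EFin //; first by rewrite tail_indicator.
  by apply/measurable_realfun.measurable_EFinP; exact: measurable_realfun.measurable_indic.
by apply: (integral01_le mb mb1 mb2) => t _; split=> //; exact: addr_ge0.
Qed.

(** The relation [delta * (1 + m) = m / 2] means [(1 + m / 2) / (1 - delta) = 1 + m]: a step over
    [[0, 1 - delta]] with relative excess [m / 2] has slope at most [1 + m]. By [delta <= m], times
    in the tail are within [m] of 1. *)
Lemma exists_time_parameters (r B e : R) : 0 < r -> 0 < B -> 0 < e ->
  exists m delta : R, [/\ 0 < m < r, B * m <= e, 0 < delta < 1, delta <= m & delta * (1 + m) = m / 2].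
Proof.
move=> r0 B0 e0; have [m [m0 mr mB]] : exists m : R, [/\ 0 < m, m < r & B * m <= e].
  exists (Num.min (r / 2) (e / B)); rewrite lt_min !divr_gt0 //; split=> //.
    by rewrite gt_min ltr_pdivrMr // mulr_natr mulr2n ltrDl r0.
  by rewrite mulrC -ler_pdivlMr // ge_min lexx orbT.
have m1 : 0 < 2 * (1 + m) by lra.
exists m, (m / (2 * (1 + m))).
have d0 : 0 < m / (2 * (1 + m)) by rewrite divr_gt0.
have dE : m / (2 * (1 + m)) * (1 + m) = m / 2 by field; lra.
have := mulr_gt0 d0 m0; split=> //; last by lra.
  by rewrite m0.
by rewrite d0 ltr_pdivrMr //; lra.
Qed.

(** [PhiF t] is near [PhiH s] for some [s] within [m] of [t], and [PhiH] and its inverse are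
    uniformly continuous in time. *)
Lemma integral_approximation (eps : R) : 0 < eps ->
  exists (PhiF : isotopy R M) (F : R -> M -> R),
    [/\ continuous_system A alpha g PhiF F, PhiF 1 = PhiH 1, smooth_except_at_1 A PhiF F,
        dbar (rdist A g) PhiF PhiH < eps & (norm1oo (hsub F H) < eps%:E)%E].
Proof.
move=> eps0; have [[_ cP bP] [cH mH _] _] := hH.
have e0 : 0 < eps / 8 by lra.
have e1 : 0 < eps / 24 by lra.
have [Phi1 [H1 [s1 cl1 n1 HF]]] := limit_construction hM halpha hg hH e0 e0.
have cK := hamiltonian_continuous hM halpha s1.
have [r1 r10 U1] := family_uniform hM hg cP e0.
have [r2 r20 U2] := family_uniform hM hg bP e0.
have [r3 r30 U3] := family_time_uniform hM cK e1.
have [B B0 HB] := hnorm_family_bounded cK.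
have r0 : 0 < Num.min (Num.min r1 r2) r3 by rewrite !lt_min r10 r20.
(* [m] has to respect the moduli of continuity of [PhiH], of its inverse and of [H1], as well as the
   bound [B] on the norm of [H1]. *)
have [m [delta [/andP[m0 mr] mB d01 dm dE]]] := exists_time_parameters r0 B0 (e := eps / 16) (divr_gt0 eps0 (ltr0Sn _ 15)).
have /andP[d0 d1] := d01.
have [mr1 mr2 mr3] : [/\ m < r1, m < r2 & m < r3].
  by move: mr; rewrite !lt_min => /andP[/andP[]].
have d1' : 0 < 1 - delta by rewrite subr_gt0.
have m20 : 0 < m / 2 by rewrite divr_gt0.
have [z [dz [sz Hz]]] := exists_smooth_step d1' m20.
have dz1 x : dz x <= 1 + m.
  by apply: (le_trans (Hz x)); rewrite subr0 ler_pdivrMr // mulrBr mulr1 (mulrC _ delta) dE; lra.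
have [PhiF [F [[cF F1 sF] Ha Hb Hc [G [cG GF]]]]] := HF delta z dz d01 sz.
have zt := step_near_identity d01 sz dz1.
exists PhiF, F; split=> //.
  apply: (@le_lt_trans _ _ (eps / 4 + eps / 4)); last by lra.
  apply: (close_dbar hM hg) => t x t01.
  have [s [s01 st] Hs] : exists2 s : R, 0 <= s <= 1 /\ `|s - t| <= m & forall x,
      D (PhiF t x) (PhiH s x) < eps / 8 /\ D (bwd PhiF t x) (bwd PhiH s x) < eps / 8.
    have /andP[t0 t1] := t01; have [td|/ltW td] := leP t (1 - delta).
      exists (z t) => [|y]; first by split; [exact: smooth_step_itv sz|apply: zt; rewrite t0].
      have [|-> -> _] := Ha t; first by rewrite t0.
      by apply: cl1; exact: smooth_step_itv sz.
    exists 1; last by move=> y; apply: Hb; rewrite td.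
    by rewrite ler01 lexx ger0_norm ?subr_ge0 //; split=> //; lra.
  have [h1 h2] := Hs x.
  have h3 : D (PhiH s x) (PhiH t x) < eps / 8.
    by apply: U1; rewrite ?(sdistxx hM hg) //; exact: le_lt_trans st mr1.
  have h4 : D (bwd PhiH s x) (bwd PhiH t x) < eps / 8.
    by apply: U2; rewrite ?(sdistxx hM hg) //; exact: le_lt_trans st mr2.
  split; first by apply: (le_lt_trans (sdist_tri hM hg _ (PhiH s x) _)); lra.
  by apply: (le_lt_trans (sdist_tri hM hg _ (bwd PhiH s x) _)); lra.
have cFt : forall t : R, 0 <= t <= 1 -> continuous (F t) by have [] := cF.
(* The slope excess, the displacement in time, the tail and the distance from [H] to [H1] contribute
   at most [eps / 8] each. *)
apply: (@le_lt_trans _ _ ((B * (2 * m) + 3 * (eps / 24) + eps / 8 / delta * delta)%:E + norm1oo (hsub H H1))%E).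
  apply: (integral_difference_bound d01 cK HB (ltW B0) (ltW m0) sz dz1 cFt (ltW e1) _ _ _ Hc cG GF).
  - by rewrite divr_ge0 // ltW.
  - move=> s x s01; have /andP[s0 sd] := s01; apply/ltW/U3; first exact: smooth_step_itv sz.
      by rewrite s0 (le_trans sd) // gerBl ltW.
    exact: le_lt_trans (zt s s01) mr3.
  - by move=> s /Ha[].
rewrite divfK ?lt0r_neq0 //.
apply: (@lt_le_trans _ _ ((B * (2 * m) + 3 * (eps / 24) + eps / 8)%:E + (eps / 8)%:E)%E).
  by rewrite lteD2lE.
rewrite -EFinD lee_fin; lra.
Qed.

End Estimates.

Theorem lemma5p9 (R : realType) (n : nat) (M : topologicalType)
    (A : set (chart R n.*2 M))
    (alpha : chart R n.*2 M -> 'rV[R]_((n.*2).+1) -> 'rV[R]_((n.*2).+1))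
    (g : chart R n.*2 M -> 'rV[R]_((n.*2).+1) -> 'M[R]_((n.*2).+1))
    (hM : closed_connected_manifold A)
    (halpha : contact_form A alpha)
    (hg : riemannian_metric A g)
    (PhiH : isotopy R M) (H : R -> M -> R)
    (hH : topological_system A alpha g PhiH H) :
  (exists (PhiF : isotopy R M) (F : R -> M -> R),
     [/\ continuous_system A alpha g PhiF F,
         PhiF 1 = PhiH 1 & smooth_except_at_1 A PhiF F]) /\
  (forall eps : R, 0 < eps ->
     (exists (PhiF : isotopy R M) (F : R -> M -> R),
        [/\ continuous_system A alpha g PhiF F,
            PhiF 1 = PhiH 1, smooth_except_at_1 A PhiF F,
            dbar (rdist A g) PhiF PhiH < eps &
            (norm1oo A alpha (hsub F H) < eps%:E)%E]) /\
     (exists (PhiF : isotopy R M) (F : R -> M -> R),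
        [/\ continuous_system A alpha g PhiF F,
            PhiF 1 = PhiH 1, smooth_except_at_1 A PhiF F,
            dbar (rdist A g) PhiF id_isotopy
              < dbar (rdist A g) PhiH id_isotopy + eps &
            (normoo A alpha F < norm1oo A alpha H + eps%:E)%E])).
Proof.
split=> [|eps eps0].
  have [PhiF [F [h1 h2 h3 _ _]]] := uniform_approximation hM halpha hg hH ltr01.
  by exists PhiF, F.
by split; [exact: (integral_approximation hM halpha hg hH)|exact: (uniform_approximation hM halpha hg hH)].
Qed.
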